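(* Let $k$ be a perfect field of characteristic two, and let $C$ be a curve of genus two defined over $k$ given by one of the rational models with parameters $(a,b,c,d)$ listed in the context. Let $H_C\subseteq k/\mathrm{AS}(k)$ be the isotropy group of $C$ under hyperelliptic twisting. Then: 1. If $C$ is supersingular (type (5)), then $H_C=\delta_{abc}(\Gamma_{abc})$. 2. If $C$ is of type (1,1,1)-split, at least two of $a,b,c$ are equal, and the third coefficient (equal to the former two or not) does not belong to $\mathrm{AS}(k)$, then $H_C\simeq C_2$ is the subgroup generated by (the class of) this third coefficient. 3. If $C$ is of type (1,1,1)-quadratic, $b=0$ and $a\notin\mathrm{AS}(k)$, then $H_C\simeq C_2$ is the subgroup generated by (the class of) $a$. 4. In all other cases, $H_C$ is trivial.
   Context: $\mathrm{AS}(k)=\{x+x^2 : x\in k\}$. A curve given by an equation $y^2+y=u(x)$, $u(x)\in k(x)$, means the smooth projective curve with this quasi-affine model. The group $H=k/\mathrm{AS}(k)$ acts on curves of genus two over $k$ (up to $k$-isomorphism) by hyperelliptic twisting: $e\in H$ sends $y^2+y=u(x)$ to $y^2+y=u(x)+e$. $H_C$ is the isotropy group of $C$: the subgroup of those $e\in H$ such that the twist of $C$ by $e$ is $k$-isomorphic to $C$. Rational models (here $d\in k/\mathrm{AS}(k)$, with any representative used in the equation): - type (1,1,1)-split: $y^2+y=ax+\frac{b}{x}+\frac{c}{x+1}+d$, with $a,b,c\in k^*$; - type (1,1,1)-quadratic: $y^2+y=ax+\frac{bx+c}{x^2+x+r}+d$, with $r\in k\setminus\mathrm{AS}(k)$,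 $a\in k^*$, $(b,c)\in k^2\setminus\{(0,0)\}$; - type (1,1,1)-cubic: $y^2+y=\frac{ax^2+bx+c}{x^3+sx+s}+d$, with $x^3+sx+s\in k[x]$ irreducible, $(a,b,c)\in k^3\setminus\{(0,0,0)\}$ (or the analogous model with an irreducible denominator $x^3+s$); - type (1,3): $y^2+y=ax^3+bx+\frac{c}{x}+d$, with $a,c\in k^*$, $b\in k$; - type (5), the supersingular case: $y^2+y=ax^5+bx^4+cx^3+d$, with $a\in k^*$, $b,c\in k$. For $a,b,c\in k$, $a\neq0$, put $E_{ac}(x)=a^4x^{16}+c^4x^8+c^2x^2+ax$ and $$\Gamma_{abc}=\begin{cases}\{(1,\nu)\in k^*\rtimes k : E_{ac}(\nu)=0\}&\text{if }c\ne0,\\ \{(\lambda,\nu)\in k^*\rtimes k : \lambda^5=1,\ E_{ac}(\nu)=b(1+\lambda)\}&\text{if }c=0,\end{cases}$$ a subgroup of $k^*\rtimes k$ with product $(\lambda,\nu)(\lambda',\nu')=(\lambda\lambda',\lambda\nu'+\nu)$; $\delta_{abc}\colon\Gamma_{abc}\to k/\mathrm{AS}(k)$ is the homomorphism $(\lambda,\nu)\mapsto a\nu^5+b\nu^4+c\nu^3$. $C_2$ is the cyclic group of order 2. *)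

(* Defs.v *)
From HB Require Import structures.
From mathcomp Require Import all_boot all_order all_algebra.
From mathcomp Require Import generic_quotient ring_quotient.
From mathcomp Require Import boolp classical_sets.

Set Implicit Arguments.
Unset Strict Implicit.
Unset Printing Implicit Defensive.

Import GRing.Theory.
Local Open Scope classical_set_scope.
Local Open Scope ring_scope.

(* Vacuous in characteristic zero. *)
Definition perfect (k : fieldType) : Prop :=
  forall p, p \in [pchar k] -> forall x : k, exists y : k, x = y ^+ p.

Definition AS (k : fieldType) : {pred k} :=
  fun x => `[< exists y : k, x = y + y ^+ 2 >].
Arguments AS k : clear implicits.

Lemma AS_zmod_closed (k : fieldType) : 2%N \in [pchar k] -> zmod_closed (AS k).
Proof.
move=> k2; split=> [|x y].
  by apply/asboolP; exists 0; rewrite expr0n addr0.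
move=> /asboolP[a ->] /asboolP[b ->]; apply/asboolP; exists (a + b).
have sqD : (a + b) ^+ 2 = a ^+ 2 + b ^+ 2.
  by rewrite sqrrD mulr2n (addrr_pchar2 k2) addr0.
by rewrite sqD (oppr_pchar2 k2) addrACA.
Qed.

Definition AS_subgroup (k : fieldType) (k2 : 2%N \in [pchar k]) : zmodClosed k :=
  HB.pack (AS k) (GRing.isZmodClosed.Build k (AS k) (AS_zmod_closed k2)).

Definition twist_group (k : fieldType) (k2 : 2%N \in [pchar k]) : zmodType :=
  Quotient.quot (AS_subgroup k2).

Definition twist_class (k : fieldType) (k2 : 2%N \in [pchar k]) (e : k) :
  twist_group k2 := (\pi_(Quotient.quot (AS_subgroup k2)) e)%qT.

Definition ratfun (k : fieldType) : fieldType := {fraction {poly k}}.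

Definition ratX (k : fieldType) : ratfun k := FracField.tofrac ('X : {poly k}).

Definition ratC (k : fieldType) (c : k) : ratfun k := FracField.tofrac c%:P.

(* The function field k(x)[y]/(y^2 + y - u) of the curve y^2 + y = u(x); it is
   a field exactly when u is not of the form f^2 + f with f in k(x), as is the
   case for all the models below. The modulus is monic of degree 2, so {poly %/ _}
   does not fall back on its default modulus 'X. *)
Definition function_field (k : fieldType) (u : ratfun k) : comUnitRingType :=
  {poly %/ ('X^2 + 'X - u%:P : {poly ratfun k})}.

Definition function_fieldC (k : fieldType) (u : ratfun k) (c : k) :
  function_field u := qpolyC _ (ratC c).

(* The smooth projective curve with function field K over k is encoded, as a
   normal integral separated scheme in the sense of Chevalley, by the set of
   the local rings of its closed points inside K: since the curve is complete
   and normal these are exactly the valuation rings O of K with k <= O < K. *)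
Definition closed_point (k : fieldType) (u : ratfun k)
    (O : set (function_field u)) : Prop :=
  [/\ forall c, O (function_fieldC u c),
      forall f g, O f -> O g -> O (f - g) /\ O (f * g),
      exists f, ~ O f
    & forall f, O f \/ exists2 g, O g & f * g = 1].

(* A k-isomorphism from the smooth projective curve y^2 + y = u(x) to the
   smooth projective curve y^2 + y = v(x): an isomorphism of function fields
   over k (the pull-back theta) under which the local rings of the closed points
   of the two curves correspond. *)
Definition curve_isom (k : fieldType) (u v : ratfun k) : Prop :=
  exists theta : {rmorphism function_field v -> function_field u},
    [/\ bijective theta,
        forall c, theta (function_fieldC v c) = function_fieldC u c
      & forall O : set (function_field v),
          closed_point O <-> closed_point (theta @` O)].

Definition twist (k : fieldType) (u : ratfun k) (e : k) : ratfun k :=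
  u + ratC e.

Definition isotropy_group (k : fieldType) (k2 : 2%N \in [pchar k])
    (u : ratfun k) : set (twist_group k2) :=
  [set h | exists2 e, twist_class k2 e = h & curve_isom (twist u e) u].
Arguments isotropy_group [k] k2 u.

(* The last parameter d of each model is a representative of a class of
   k / AS(k). *)
Inductive rational_model (k : fieldType) : Type :=
  | Split111 (a b c d : k)
  | Quadratic111 (r a b c d : k)
  | Cubic111 (s a b c d : k)
  | PureCubic111 (s a b c d : k)
  | Type13 (a b c d : k)
  | Type5 (a b c d : k).

Definition admissible (k : fieldType) (M : rational_model k) : Prop :=
  match M with
  | Split111 a b c d => [/\ a != 0, b != 0 & c != 0]
  | Quadratic111 r a b c d => [/\ r \notin AS k, a != 0 & (b, c) != (0, 0)]
  | Cubic111 s a b c d =>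
      irreducible_poly ('X^3 + s *: 'X + s%:P) /\ (a, b, c) != (0, 0, 0)
  | PureCubic111 s a b c d =>
      irreducible_poly ('X^3 + s%:P) /\ (a, b, c) != (0, 0, 0)
  | Type13 a b c d => a != 0 /\ c != 0
  | Type5 a b c d => a != 0
  end.

Definition model_rhs (k : fieldType) (M : rational_model k) : ratfun k :=
  let x := ratX k in let C := @ratC k in
  match M with
  | Split111 a b c d => C a * x + C b / x + C c / (x + 1) + C d
  | Quadratic111 r a b c d =>
      C a * x + (C b * x + C c) / (x ^+ 2 + x + C r) + C d
  | Cubic111 s a b c d =>
      (C a * x ^+ 2 + C b * x + C c) / (x ^+ 3 + C s * x + C s) + C d
  | PureCubic111 s a b c d =>
      (C a * x ^+ 2 + C b * x + C c) / (x ^+ 3 + C s) + C d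
  | Type13 a b c d => C a * x ^+ 3 + C b * x + C c / x + C d
  | Type5 a b c d => C a * x ^+ 5 + C b * x ^+ 4 + C c * x ^+ 3 + C d
  end.

Definition E_ (k : fieldType) (a c : k) : {poly k} :=
  a ^+ 4 *: 'X^16 + c ^+ 4 *: 'X^8 + c ^+ 2 *: 'X^2 + a *: 'X.

(* The underlying set of Gamma_abc inside the semidirect product of k^* and k,
   whose underlying set is the set of pairs (lambda, nu) with lambda <> 0. *)
Definition Gamma (k : fieldType) (a b c : k) : set (k * k) :=
  [set g | let: (lambda, nu) := g in
     lambda != 0 /\
     if c != 0 then lambda = 1 /\ (E_ a c).[nu] = 0
     else lambda ^+ 5 = 1 /\ (E_ a c).[nu] = b * (1 + lambda)].

Definition delta (k : fieldType) (k2 : 2%N \in [pchar k]) (a b c : k)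
    (g : k * k) : twist_group k2 :=
  twist_class k2 (a * g.2 ^+ 5 + b * g.2 ^+ 4 + c * g.2 ^+ 3).

Definition subgroup_gen (V : zmodType) (h : V) : set V :=
  [set h *~ n | n in [set: int]].

Definition isog_C2 (V : zmodType) (S : set V) : Prop :=
  exists f : {additive 'Z_2 -> V}, injective f /\ range f = S.

Definition supersingular_model (k : fieldType) (M : rational_model k) : Prop :=
  exists a b c d, M = Type5 a b c d.

(* At least two of a, b, c are equal and e is the third one. *)
Definition third_coefficient (k : fieldType) (a b c e : k) : Prop :=
  [\/ b = c /\ e = a, a = c /\ e = b | a = b /\ e = c].

Definition split_case (k : fieldType) (M : rational_model k) (e : k) : Prop :=
  exists a b c d,
    [/\ M = Split111 a b c d, third_coefficient a b c e & e \notin AS k].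

Definition quadratic_case (k : fieldType) (M : rational_model k) (a : k) :
    Prop :=
  exists r b c d, [/\ M = Quadratic111 r a b c d, b = 0 & a \notin AS k].

(* Main.v *)
From HB Require Import structures.
Require Import Defs.
From mathcomp Require Import all_boot all_order all_algebra.
From mathcomp Require Import generic_quotient ring_quotient.
From mathcomp Require Import boolp classical_sets.
From mathcomp Require Import ring zify.

(* Write u = P/Q^2 with deg Q <= 3, deg P <= 6, so that z = Qy satisfies
   z^2 + Qz = P, and let D be the derivation of the function field K extending
   d/dx. Call f in K regular if f is in O.D(O) for all valuation rings O of K,
   that is, if f dx is a regular differential. When the model is smooth, on its
   two affine charts, the regular f are the (c0 + c1 x)/Q. An isomorphism
   K' -> K over k preserves regularity, up to the factor D(x') where x' is the
   image of the coordinate of K', so x' is the quotient of two regular elements,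
   hence x' = m(x) for a Moebius map m, and y' = y + w with w in k(x). Therefore
   the twist of C by e is isomorphic to C if and only if
   u(m(x)) = u(x) + e + w^2 + w for some m and w, and moreover m preserves Q,
   seen as a binary cubic form. These equations are solved for each model: m has
   to permute the poles of u and w is a constant as soon as they are simple. *)

Set Implicit Arguments.
Unset Strict Implicit.
Unset Printing Implicit Defensive.

Import GRing.Theory.
Local Open Scope classical_set_scope.
Local Open Scope ring_scope.

(** Points exist only as valuation rings, so the bound on regular elements is local algebra: a pole
    of f Q / D x on a chart would lie over a maximal ideal of k[x,z], and localizing there has to
    give a valuation ring. It does because k[x,z] is normal, which is where smoothness enters, as
    coprimality of Q with P'^2 + P Q'^2. The chart at infinity is treated by the same lemmas,
    applied to the reversed polynomials. Normality is used again in two places. It turns w into r/Q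
    with r a polynomial of degree at most 3, and it excludes u = w^2 + w, so that the function
    fields are indeed fields. The condition on m and w thus becomes a pair of polynomial identities,
    [moebius_equiv], for a binary cubic Q and a binary sextic P; the determinant in them comes from
    D(m(x)) = det / l^2, with l the denominator of m. Twisting by e keeps Q and replaces P by P + e
    Q^2, so a curve and its twists are smooth models with the same Q, and the rest is comparison of
    coefficients. *)

Section CharTwo.
Variables (R : comNzRingType) (two0 : 2 = 0 :> R).

Lemma char2_4 : 4 = 0 :> R.
Proof. by rewrite -[4]/((2 * 2)%N%:R) natrM two0 mul0r. Qed.

Lemma char2_6 : 6 = 0 :> R.
Proof. by rewrite -[6]/((2 * 3)%N%:R) natrM two0 mul0r. Qed.

Lemma char2_8 : 8 = 0 :> R.
Proof. by rewrite -[8]/((2 * 4)%N%:R) natrM two0 mul0r. Qed.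

Lemma char2_10 : 10 = 0 :> R.
Proof. by rewrite -[10]/((2 * 5)%N%:R) natrM two0 mul0r. Qed.

Lemma char2_N2 : -2 = 0 :> R. Proof. by rewrite two0 oppr0. Qed.
Lemma char2_N4 : -4 = 0 :> R. Proof. by rewrite char2_4 oppr0. Qed.
Lemma char2_N6 : -6 = 0 :> R. Proof. by rewrite char2_6 oppr0. Qed.
Lemma char2_N10 : -10 = 0 :> R. Proof. by rewrite char2_10 oppr0. Qed.

End CharTwo.

(* [ring: H] only rewrites monomials whose coefficient is literally that of the
   left-hand side of [H], hence the list of even integers. *)
Ltac ring2 H :=
  apply: subr0_eq;
  ring: H (char2_N2 H) (char2_4 H) (char2_N4 H) (char2_6 H) (char2_N6 H)
        (char2_8 H) (char2_10 H) (char2_N10 H).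
Ltac ring2_mod H E :=
  apply: subr0_eq;
  ring: E H (char2_N2 H) (char2_4 H) (char2_N4 H) (char2_6 H) (char2_N6 H)
        (char2_8 H) (char2_10 H) (char2_N10 H).

Lemma char2_poly (R : nzRingType) : 2 = 0 :> R -> 2 = 0 :> {poly R}.
Proof. by move=> two0; rewrite -polyC_natr two0. Qed.

(** * Irreducible factors and normality of the coordinate ring *)

Section Poly.
Variable k : fieldType.
Implicit Types p q a b c d n : {poly k}.

Lemma exists_irreducible_dvdp p :
  (1 < size p)%N -> exists2 q, irreducible_poly q & q %| p.
Proof.
have [m] := ubnP (size p); elim: m p => // m IH p lt_pm p_gt1.
have [p_irr|] := pselect (irreducible_poly p); first by exists p.
move=> /not_andP[//|/existsNP[q /not_implyP[q1 /not_implyP[q_p nqp]]]].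
have p0 : p != 0 by rewrite -size_poly_gt0 ltnW.
have q0 : q != 0 by apply: contraNneq p0 => q0; move: q_p; rewrite q0 dvd0p.
have lt_qp : (size q < size p)%N.
  rewrite ltn_neqAle dvdp_leq // andbT; apply/negP => e.
  by apply: nqp; rewrite -dvdp_size_eqp.
have q_gt1 : (1 < size q)%N by rewrite ltn_neqAle eq_sym q1 size_poly_gt0.
have [r r_irr r_q] := IH q (leq_trans lt_qp lt_pm) q_gt1.
by exists r => //; apply: dvdp_trans q_p.
Qed.

Lemma irreducible_dvdpM p a b :
  irreducible_poly p -> (p %| a * b) = (p %| a) || (p %| b).
Proof.
move=> p_irr; case: (boolP (p %| a)) => [|pa] /=; first exact: dvdp_mulr.
by rewrite Gauss_dvdpr // irreducible_poly_coprime.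
Qed.

Lemma irreducible_dvdpX p a m :
  irreducible_poly p -> p %| a ^+ m -> p %| a.
Proof.
move=> p_irr; elim: m => [|m IH].
  by rewrite dvdp1 => /eqP p1; case: p_irr; rewrite p1.
by rewrite exprS irreducible_dvdpM // => /orP[|/IH].
Qed.

(** In characteristic two the partial derivatives of z^2 + Qz - P are Q and Q'z - P'. Where Q = 0
    one has z^2 = P, and the square of the second is this polynomial: the singular points lie over
    its common roots with Q. *)
Definition discr (P Q : {poly k}) := P^`() ^+ 2 + P * Q^`() ^+ 2.

(* Normality of k[x,z]/(z^2+Qz+P): if (a+cz)/n has its trace and its norm in
   k[x], then it lies in k[x]+k[x]z. *)
Lemma dvdp_trace_norm (two0 : 2 = 0 :> k) (P Q : {poly k}) n a c :
  coprimep Q (discr P Q) -> n != 0 -> n %| c * Q ->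
  n ^+ 2 %| a ^+ 2 + a * c * Q + c ^+ 2 * P -> n %| a /\ n %| c.
Proof.
move=> smPQ; have two0P := char2_poly two0.
have [m] := ubnP (size n); elim: m n a c => // m IH n a c lt_nm n0 n_cQ n2.
have [n_le1|n_gt1] := leqP (size n) 1.
  have n1 : n %= 1.
    by rewrite -size_poly_eq1 eqn_leq n_le1 size_poly_gt0.
  by rewrite !(eqp_dvdl _ n1) !dvd1p.
have [p p_irr p_n] := exists_irreducible_dvdp n_gt1.
have p_gt1 : (1 < size p)%N by case: p_irr.
have p0 : p != 0 by rewrite -size_poly_gt0 ltnW.
set F := a ^+ 2 + _ + _ in n2.
have p2_F : p ^+ 2 %| F by apply: dvdp_trans n2; rewrite dvdp_exp2r.
have p_F : p %| F by apply: dvdp_trans p2_F; rewrite expr2 dvdp_mulr.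
have p_cQ : p %| c * Q by apply: dvdp_trans n_cQ.
have p_c : p %| c.
  case: (boolP (p %| Q)) => pQ; last first.
    by move: p_cQ; rewrite irreducible_dvdpM // (negPf pQ) orbF.
  (* The derivative of q p^2 is q' p^2, since the derivative of a square vanishes. *)
  have p_dF : p %| F^`().
    move: p2_F => /dvdpP[q ->].
    have -> : (q * p ^+ 2)^`() = q^`() * p * p by rewrite expr2 !derivM; ring2 two0P.
    exact: dvdp_mull.
  have dF : F^`() = a * c * Q^`() + c ^+ 2 * P^`() + (a * c)^`() * Q.
    rewrite /F !derivD !derivM; ring2 two0P.
  have p_1 : p %| a * c * Q^`() + c ^+ 2 * P^`().
    by move: p_dF; rewrite dF dvdp_addl // dvdp_mull.
  have p_2 : p %| a ^+ 2 + c ^+ 2 * P.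
    have -> : a ^+ 2 + c ^+ 2 * P = F - a * c * Q by rewrite /F; ring.
    by rewrite dvdp_sub // dvdp_mull.
  (* Squaring [p_1] and adding (cQ')^2 times [p_2] eliminates a. As p divides Q, it cannot divide
     discr, so it divides c. *)
  have p_3 : p %| c ^+ 4 * discr P Q.
    have -> : c ^+ 4 * discr P Q =
       (a * c * Q^`() + c ^+ 2 * P^`()) ^+ 2
       + (c * Q^`()) ^+ 2 * (a ^+ 2 + c ^+ 2 * P).
      rewrite /discr; ring2 two0P.
    by rewrite dvdp_add ?dvdp_exp // dvdp_mull.
  move: p_3; rewrite irreducible_dvdpM // => /orP[/irreducible_dvdpX -> //|].
  move=> p_G; move: smPQ; rewrite coprimep_def => /eqP g1.
  have : p %| gcdp Q (discr P Q) by rewrite dvdp_gcd pQ.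
  by move=> /dvdp_leq; rewrite -size_poly_eq0 g1 => /(_ isT); rewrite leqNgt p_gt1.
have p_a : p %| a.
  apply: (@irreducible_dvdpX _ _ 2) => //.
  have -> : a ^+ 2 = F - c * (a * Q + c * P) by rewrite /F; ring.
  by rewrite dvdp_sub // dvdp_mulr.
move: n2; rewrite {}/F in p2_F p_F * => n2.
move/dvdpP: p_a n2 {p2_F p_F} => [a1 ->]; move/dvdpP: p_c n_cQ p_cQ => [c1 ->].
move/dvdpP: p_n n0 n_gt1 lt_nm => [n1 ->]; rewrite mulf_eq0 => /norP[n10 _].
move=> n_gt1 lt_nm n_cQ _ n2.
have [|||] := IH n1 a1 c1 _ n10.
- move: lt_nm p_gt1; rewrite size_mul //; move: (size p) (size n1); lia.
- move: n_cQ; rewrite -[c1 * p * Q]mulrA [p * Q]mulrC mulrA dvdp_mul2r //.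
- rewrite -(@dvdp_mul2r _ (p ^+ 2)) ?expf_neq0 // -exprMn.
  by apply: etrans n2; congr (_ %| _); ring.
by move=> d1 d2; rewrite !dvdp_mul2r.
Qed.

End Poly.

(** In the product r (r + Q), once deg r exceeds 3 both factors have degree deg r, so the product
    has degree at least 8. This bounds the change of variable z -> z + r. *)
Lemma size_sqrD_mul_leq (k : fieldType) (r Q : {poly k}) :
  (size Q <= 4)%N -> (size (r ^+ 2 + r * Q)%R <= 7)%N -> (size r <= 4)%N.
Proof.
move=> Q4; have -> : r ^+ 2 + r * Q = r * (r + Q) by ring.
move=> s7; rewrite leqNgt; apply/negP => r5.
have r0 : r != 0 by rewrite -size_poly_gt0 (leq_trans _ r5).
have srQ : size (r + Q) = size r by rewrite size_polyDl // (leq_ltn_trans Q4).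
move: s7; rewrite size_mul // -?size_poly_gt0 srQ; last by rewrite size_poly_gt0.
by move: r5; move: (size r) => sr; lia.
Qed.

(** * Maximal ideals by Zorn's lemma *)

Section MaximalIdeal.
Variables (K : comNzRingType) (R : set K).
Hypotheses (R0 : R 0) (R1 : R 1) (RD : forall f g, R f -> R g -> R (f + g))
  (RM : forall f g, R f -> R g -> R (f * g)).

Definition ideal_of (J : set K) :=
  [/\ J `<=` R, J 0, forall f g, J f -> J g -> J (f + g)
    & forall r f, R r -> J f -> J (r * f)].

(** Rings and ideals are sets of elements of [K], so that localizations need no new type. The last
    clause is maximality in the form in which it is applied: every element outside m is invertible
    modulo m. *)
Lemma exists_maximal_ideal (I : set K) : ideal_of I -> ~ I 1 ->
  exists m, [/\ ideal_of m, ~ m 1, I `<=` m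
    & forall s, R s -> ~ m s -> exists x r, [/\ m x, R r & 1 = x + s * r]].
Proof.
move=> Iid I1.
pose ok J := J = set0 \/ [/\ ideal_of J, ~ J 1 & I `<=` J].
have [F okF totF|m [okm maxm]] := @Zorn_bigcup K ok.
  have [[X [FX X0]]|allE] := pselect (exists X, F X /\ X <> set0).
    right; have nonempty Y f : F Y -> Y f -> [/\ ideal_of Y, ~ Y 1 & I `<=` Y].
      by move=> FY Yf; case: (okF Y FY) => // Y0; move: Yf; rewrite Y0.
    have [[XR Xz XD XM] X1 IX] : [/\ ideal_of X, ~ X 1 & I `<=` X].
      by case: (okF X FX).
    split; first split.
    - by move=> f [Y FY Yf]; have [[YR _ _ _] _ _] := nonempty _ _ FY Yf; apply: YR.
    - by exists X.
    - move=> f g [Y FY Yf] [Z FZ Zg].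
      have [[_ _ YD _] _ _] := nonempty _ _ FY Yf.
      have [[_ _ ZD _] _ _] := nonempty _ _ FZ Zg.
      by case: (totF Y Z FY FZ) => sub; [exists Z|exists Y] => //;
        [apply: ZD => //; apply: sub|apply: YD => //; apply: sub].
    - move=> r f Rr [Y FY Yf]; exists Y => //.
      by have [[_ _ _ YM] _ _] := nonempty _ _ FY Yf; apply: YM.
    - by move=> [Y FY Y1]; have [_ /(_ Y1)] := nonempty _ _ FY Y1.
    - by move=> f If; exists X => //; apply: IX.
  left; apply/seteqP; split=> // f [Y FY Yf].
  by apply: allE; exists Y; split=> // Y0; move: Yf; rewrite Y0.
have okI : ok I by right; split.
case: okm => [m0|[mid m1 Im]].
  have [_ I0 _ _] := Iid.
  by case: (maxm I) => //; rewrite m0; split=> // /(_ _ I0).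
exists m; split=> // s Rs ms; have [mR m0 mD mM] := mid.
apply: contrapT => nex.
pose J := [set f | exists x r, [/\ m x, R r & f = x + s * r]].
have mJ : m `<=` J by move=> x mx; exists x, 0; rewrite mulr0 addr0.
case: (maxm J).
  split=> // Jm; apply: ms; apply: Jm.
  by exists 0, 1; rewrite add0r mulr1.
right; split; last by apply: subset_trans mJ.
  split.
  - by move=> f [x [r [mx Rr ->]]]; apply: RD; [apply: mR|apply: RM].
  - exact: mJ.
  - move=> f g [x [r [mx Rr ->]]] [x' [r' [mx' Rr' ->]]].
    exists (x + x'), (r + r'); split; [exact: mD|exact: RD|by ring].
  - move=> a f Ra [x [r [mx Rr ->]]].
    by exists (a * x), (a * r); split; [exact: mM|exact: RM|ring].
by move=> [x [r [mx Rr e]]]; apply: nex; exists x, r.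
Qed.

End MaximalIdeal.

(* [closed_point], for an arbitrary ring with constants [c]. *)
Definition place (k : Type) (K : comNzRingType) (c : k -> K) (O : set K) : Prop :=
  [/\ forall a, O (c a),
      forall f g, O f -> O g -> O (f - g) /\ O (f * g),
      exists f, ~ O f
    & forall f, O f \/ exists2 g, O g & f * g = 1].

Lemma place_image (k : Type) (K1 K2 : comNzRingType) (c1 : k -> K1) (c2 : k -> K2)
    (th : {rmorphism K1 -> K2}) (O : set K1) :
  bijective th -> (forall a, th (c1 a) = c2 a) -> place c1 O <-> place c2 (th @` O).
Proof.
move=> [ht thK htK] thc.
have imE f : (th @` O) (th f) <-> O f.
  split; last by exists f.
  by move=> [g Og /(can_inj thK) <-].
split=> -[Oc Oring [f nOf] Oval]; split.
- by move=> a; rewrite -thc; apply/imE; apply: Oc.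
- move=> _ _ [f1 Of <-] [g1 Og <-].
  by rewrite -rmorphB -rmorphM !imE; apply: Oring.
- by exists (th f); rewrite imE.
- move=> f1; rewrite -[f1]htK; case: (Oval (ht f1)) => [Of|[g Og fg]]; [left|right].
    exact/imE.
  by exists (th g); [exact/imE|rewrite -rmorphM fg rmorph1].
- by move=> a; apply/imE; rewrite thc; apply: Oc.
- move=> f1 g1 /imE Of /imE Og.
  by rewrite -!imE rmorphB rmorphM; apply: Oring.
- by exists (ht f); rewrite -imE htK.
- move=> f1; case: (Oval (th f1)) => [/imE|[g Og fg]]; [by left|right].
  exists (ht g); first by rewrite -imE htK.
  by apply: (can_inj thK); rewrite rmorphM htK fg rmorph1.
Qed.

(** * Valuation rings and evaluation of polynomials *)

Section Place.
Variables (k K : fieldType) (c : {rmorphism k -> K}).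
Variables (O : set K) (plO : place c O).

Lemma place0 : O 0. Proof. by case: plO => + _ _ _ => /(_ 0); rewrite rmorph0. Qed.
Lemma place1 : O 1. Proof. by case: plO => + _ _ _ => /(_ 1); rewrite rmorph1. Qed.
Lemma placeB f g : O f -> O g -> O (f - g).
Proof. by case: plO => _ + _ _ => /(_ f g) h Of Og; case: h. Qed.
Lemma placeM f g : O f -> O g -> O (f * g).
Proof. by case: plO => _ + _ _ => /(_ f g) h Of Og; case: h. Qed.
Lemma placeN f : O f -> O (- f).
Proof. by move=> Of; rewrite -sub0r; apply: placeB => //; apply: place0. Qed.
Lemma placeD f g : O f -> O g -> O (f + g).
Proof. by move=> Of Og; rewrite -[g]opprK; apply: placeB => //; apply: placeN. Qed.
Lemma placeX f n : O f -> O (f ^+ n).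
Proof.
move=> Of; elim: n => [|n IH]; first exact: place1.
by rewrite exprS; apply: placeM.
Qed.

Lemma placeV f : O f \/ O f^-1 /\ f != 0.
Proof.
case: plO => _ _ _ /(_ f)[|[g Og fg]]; first by left.
right; have f0 : f != 0.
  by apply/eqP => f0; move/eqP: fg; rewrite f0 mul0r eq_sym oner_eq0.
by split=> //; rewrite -[f^-1]mulr1 -fg mulKf.
Qed.

End Place.

Section Evaluation.
Variables (k K : fieldType) (c : {rmorphism k -> K}).

Definition ev (u : K) : {poly k} -> K :=
  horner_morph (fun a => mulrC u (c a)).

HB.instance Definition _ u := GRing.RMorphism.on (ev u).

Lemma evX u : ev u 'X = u. Proof. exact: horner_morphX. Qed.
Lemma evC u a : ev u a%:P = c a. Proof. exact: horner_morphC. Qed.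

Lemma evE u p : ev u p = \sum_(i < size p) c p`_i * u ^+ i.
Proof.
rewrite -{1}[p]coefK poly_def rmorph_sum; apply: eq_bigr => j _ /=.
by rewrite -mul_polyC rmorphM rmorphXn /= evC evX.
Qed.

Lemma ev_wide u (p : {poly k}) N : (size p <= N)%N -> ev u p = \sum_(i < N) c p`_i * u ^+ i.
Proof.
move=> pN; rewrite evE (big_ord_widen _ (fun i => c p`_i * u ^+ i) pN).
rewrite big_mkcond; apply: eq_bigr => i _; case: ltnP => // h.
by rewrite nth_default // rmorph0 mul0r.
Qed.

Lemma place_ev O u p : place c O -> O u -> O (ev u p).
Proof.
move=> plO Ou; elim/poly_ind: p => [|p a IH].
  by rewrite rmorph0; apply: place0 plO.
rewrite rmorphD rmorphM /= evX evC; apply: (placeD plO); last by case: plO.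
exact: (placeM plO).
Qed.

(* The form of degree N attached to p, composed with the matrix M; p has degree
   at most N. *)
Definition hsub N (M : k * k * k * k) (p : {poly k}) : {poly k} :=
  let: (a, b, g, d) := M in
  \sum_(i < N.+1) p`_i *: ((a *: 'X + b%:P) ^+ i * (g *: 'X + d%:P) ^+ (N - i)).

Lemma ev_lin u a b : ev u (a *: 'X + b%:P) = c a * u + c b.
Proof. by rewrite -mul_polyC rmorphD rmorphM /= !evC evX. Qed.

Lemma ev_hsub u N a b g d (p : {poly k}) : (size p <= N.+1)%N -> c g * u + c d != 0 ->
  ev u (hsub N (a, b, g, d) p) =
  (c g * u + c d) ^+ N * ev ((c a * u + c b) / (c g * u + c d)) p.
Proof.
move=> pN l0; rewrite (ev_wide _ pN) rmorph_sum mulr_sumr; apply: eq_bigr => i _.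
rewrite -mul_polyC !rmorphM !rmorphXn /= evC !ev_lin expr_div_n.
have -> : (c g * u + c d) ^+ N =
    (c g * u + c d) ^+ (N - i) * (c g * u + c d) ^+ i.
  by rewrite -exprD subnK // -ltnS.
by field; rewrite expf_neq0.
Qed.

Lemma size_hsub N M p : (size (hsub N M p) <= N.+1)%N.
Proof.
have lin (x y : k) : (size (x *: 'X + y%:P)%R <= 2)%N.
  rewrite (leq_trans (size_polyD _ _)) // geq_max (leq_trans (size_scale_leq _ _)).
    by rewrite (leq_trans (size_polyC_leq1 _)).
  by rewrite size_polyX.
have linX (x y : k) n : (size ((x *: 'X + y%:P) ^+ n)%R <= n.+1)%N.
  rewrite (leq_trans (size_poly_exp_leq _ _)) // ltnS.
  by have := lin x y; move: (size _); nia.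
case: M => [[[a b] g] d]; apply: (leq_trans (size_sum _ _ _)).
apply/bigmax_leqP => i _; rewrite (leq_trans (size_scale_leq _ _)) //.
rewrite (leq_trans (size_polyMleq _ _)) //.
have := linX a b i; have := linX g d (N - i)%N; have := ltn_ord i.
move: (size _) (size _); lia.
Qed.

End Evaluation.

(** * Regular differentials on an affine chart *)

Section Chart.
Variables (k K : fieldType) (c : {rmorphism k -> K}) (D : K -> K).

Definition derivation :=
  [/\ forall a, D (c a) = 0, forall f g, D (f + g) = D f + D g
    & forall f g, D (f * g) = D f * g + f * D g].

Definition coord_ring (u z f : K) := exists a b, f = ev c u a + ev c u b * z.

(* [K] is the fraction field of the affine curve z^2 + Q(u)z = P(u), which is
   smooth by the last clause. *)
Definition chart (P Q : {poly k}) (u z : K) :=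
  [/\ z ^+ 2 = ev c u P + ev c u Q * z,
      Q != 0,
      forall f, exists a b d, d != 0 /\ f * ev c u d = ev c u a + ev c u b * z,
      forall a b, ev c u a + ev c u b * z = 0 -> a = 0 /\ b = 0
    & coprimep Q (discr P Q)].

Variables (two0 : 2 = 0 :> k) (P Q : {poly k}) (u z : K).
Hypotheses (ch : chart P Q u z) (derD : derivation) (tau0 : D u != 0).

Local Notation i := (ev c u).
Let zE : z ^+ 2 = i P + i Q * z. Proof. by case: ch. Qed.
Let free a b : i a + i b * z = 0 -> a = 0 /\ b = 0.
Proof. by case: ch => _ _ _ + _; apply. Qed.
Let smPQ : coprimep Q (discr P Q). Proof. by case: ch. Qed.

Let two0K : 2 = 0 :> K.
Proof. by rewrite -(rmorph_nat c) two0 rmorph0. Qed.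
Let two0P : 2 = 0 :> {poly k}. Proof. exact: char2_poly. Qed.

Lemma ev_eq0 p : (i p == 0) = (p == 0).
Proof.
apply/eqP/eqP => [ip0|->]; last by rewrite rmorph0.
have e : i p + i 0 * z = 0 by rewrite ip0 raddf0 mul0r addr0.
by case: (free e).
Qed.

Lemma deriv_ev p : D (i p) = i p^`() * D u.
Proof.
case: derD => Dc DD DM; elim/poly_ind: p => [|p a IH].
  by rewrite deriv0 !rmorph0 mul0r; have := Dc 0; rewrite rmorph0.
rewrite derivD derivM derivX derivC !rmorphD !rmorphM /= evX evC DD DM Dc.
by rewrite IH; ring.
Qed.

(** Implicit differentiation of z^2 + Qz = P, in which the term 2z D z vanishes. It trades D u / Q
    for D z where Q vanishes. *)
Lemma deriv_coord : i Q * D z = D u * (i P^`() + i Q^`() * z).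
Proof.
case: derD => Dc DD DM.
have := congr1 D zE; rewrite expr2 DD !DM !deriv_ev => e.
have e2 : D z * z + z * D z = 0 by ring2 two0K.
rewrite e2 in e; apply/eqP; rewrite -subr_eq0 -oppr_eq0; apply/eqP.
by rewrite {1}e; ring2 two0K.
Qed.

Lemma coord_ring_ev p : coord_ring u z (i p).
Proof. by exists p, 0; rewrite rmorph0 mul0r addr0. Qed.

Lemma coord_ringD f g :
  coord_ring u z f -> coord_ring u z g -> coord_ring u z (f + g).
Proof.
by move=> [a [b ->]] [a' [b' ->]]; exists (a + a'), (b + b'); rewrite !rmorphD /=; ring.
Qed.

Lemma coord_ringM f g :
  coord_ring u z f -> coord_ring u z g -> coord_ring u z (f * g).
Proof.
move=> [a [b ->]] [a' [b' ->]].
exists (a * a' + b * b' * P), (a * b' + b * a' + b * b' * Q).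
by rewrite !rmorphD !rmorphM /=; ring: zE.
Qed.

Lemma coord_ringN f : coord_ring u z f -> coord_ring u z (- f).
Proof. by move=> [a [b ->]]; exists (- a), (- b); rewrite !rmorphN /=; ring. Qed.

(** z is integral over k[u]: if 1/z is in O, then so is z = P/z + Q. *)
Lemma place_coord O : place c O -> O u -> O z.
Proof.
move=> plO Ou; have Oi p : O (i p) by apply: place_ev.
have [//|[Oz z0]] := placeV plO z.
have -> : z = i P * z^-1 + i Q.
  by apply: (mulIf z0); rewrite mulrDl mulfVK // -zE expr2.
by apply: (placeD plO) => //; apply: (placeM plO).
Qed.

Definition regular_at (O : set K) f := exists g h, [/\ O g, O h & f = g * D h].

(* Over a valuation ring, a sum of multiples of two elements is a multiple of
   one of them. *)
Lemma regular_at_span O f1 h1 f2 h2 : place c O -> O f1 -> O h1 -> O f2 -> O h2 ->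
  regular_at O (f1 * D h1 + f2 * D h2).
Proof.
move=> plO Of1 Oh1 Of2 Oh2.
have [Dh20|Dh20] := eqVneq (D h2) 0.
  by exists f1, h1; rewrite Dh20 mulr0 addr0.
have [Oq|[Oq q0]] := placeV plO (D h1 / D h2).
  exists (f1 * (D h1 / D h2) + f2), h2; split=> //.
    by apply: (placeD plO) => //; apply: (placeM plO).
  by field.
have Dh10 : D h1 != 0 by apply: contraNneq q0 => ->; rewrite mul0r.
exists (f1 + f2 * (D h1 / D h2)^-1), h1; split=> //.
  by apply: (placeD plO) => //; apply: (placeM plO).
by field; rewrite Dh10 Dh20.
Qed.

(** On the curve, discr is (P' + Q'z)^2 + z Q Q'^2. Multiplying the Bezout relation al Q + be discr
    = 1 by D u / Q and applying [deriv_coord] gives a combination of D u and D z with coefficients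
    in O. *)
Lemma chart_regular O : place c O -> O u -> regular_at O (D u / i Q).
Proof.
move=> plO Ou; have Oz := place_coord plO Ou.
have Oi p : O (i p) by apply: place_ev.
have iQ0 : i Q != 0 by rewrite ev_eq0; case: ch.
have /Bezout_eq1_coprimepP[[al be] /= e1] := smPQ.
have e : i al * i Q + i be * (i P^`() ^+ 2 + i P * i Q^`() ^+ 2) = 1.
  by rewrite -!rmorphXn -!rmorphM -rmorphD -rmorphM -rmorphD /= -/(discr P Q) e1 rmorph1.
have -> : D u / i Q = (i al + i be * z * i Q^`() ^+ 2) * D u
    + (i be * (i P^`() + i Q^`() * z)) * D z.
  apply: (mulIf iQ0); rewrite mulfVK // mulrDl.
  have -> : i be * (i P^`() + i Q^`() * z) * D z * i Q =
      i be * (i P^`() + i Q^`() * z) * (i Q * D z) by ring.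
  by rewrite deriv_coord -[LHS]mulr1 -e; ring2_mod two0K zE.
apply: regular_at_span => //.
  by repeat first [apply: (placeD plO)|apply: (placeM plO)|apply: (placeX _ plO)|exact: Oi|exact: Oz].
by repeat first [apply: (placeD plO)|apply: (placeM plO)|apply: (placeX _ plO)|exact: Oi|exact: Oz].
Qed.

(* k[x,z] is a Dedekind domain: the ideal (f, g) is invertible, its inverse being
   (f^s, g^s)/n for the conjugation s, where n is the gcd of N(f), N(g) and
   Tr(f g^s). *)
Lemma coord_ring_invertible f g : coord_ring u z f -> coord_ring u z g -> g != 0 ->
  exists a b, [/\ a * f + b * g = 1,
    coord_ring u z (a * f), coord_ring u z (a * g),
    coord_ring u z (b * f) & coord_ring u z (b * g)].
Proof.
move=> [r0 [r1 fE]] [s0 [s1 gE]] g0.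
(* The conjugation of K over k(u) is z -> z + Q. *)
pose fb := i (r0 + r1 * Q) + i r1 * z; pose gb := i (s0 + s1 * Q) + i s1 * z.
pose Nf := r0 ^+ 2 + r0 * r1 * Q + r1 ^+ 2 * P.
pose Ng := s0 ^+ 2 + s0 * s1 * Q + s1 ^+ 2 * P.
pose e0 := r0 * s0 + r0 * s1 * Q + r1 * s1 * P; pose e1 := r0 * s1 + r1 * s0.
have NfE : f * fb = i Nf.
  by rewrite fE /fb /Nf; ring2_mod two0K zE.
have NgE : g * gb = i Ng.
  by rewrite gE /gb /Ng; ring2_mod two0K zE.
have TE : f * gb = i e0 + i e1 * z.
  by rewrite fE /gb /e0 /e1; ring2_mod two0K zE.
have TbE : fb * g = i (e0 + e1 * Q) + i e1 * z.
  by rewrite gE /fb /e0 /e1; ring2_mod two0K zE.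
have Ng0 : Ng != 0.
  rewrite -ev_eq0 -NgE mulf_neq0 //; apply: contraNneq g0 => /free[s00 s10].
  by rewrite gE; move: s00; rewrite s10 mul0r addr0 => ->; rewrite !rmorph0 mul0r addr0.
pose d := gcdp Nf Ng; pose n := gcdp d (e1 * Q).
have n0 : n != 0 by rewrite !gcdp_eq0 (negPf Ng0) !(andbF, andFb).
have n_d : n %| d by apply: dvdp_gcdl.
have n_Nf : n %| Nf by apply: dvdp_trans n_d (dvdp_gcdl _ _).
have n_Ng : n %| Ng by apply: dvdp_trans n_d (dvdp_gcdr _ _).
(* The norm of f g^s is N(f) N(g), divisible by n^2, and its trace is e1 Q, divisible by n. By
   normality f g^s / n lies in the coordinate ring; its coordinates are [h0] and [h1]. *)
have n2 : n ^+ 2 %| e0 ^+ 2 + e0 * e1 * Q + e1 ^+ 2 * P.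
  have -> : e0 ^+ 2 + e0 * e1 * Q + e1 ^+ 2 * P = Nf * Ng.
    by rewrite /e0 /e1 /Nf /Ng; ring2 two0P.
  by rewrite expr2 dvdp_mul.
have [] := dvdp_trace_norm two0 smPQ n0 (dvdp_gcdr _ _) n2.
move=> /dvdpP[h0 h0E] /dvdpP[h1 h1E].
have [gf gfE] := dvdpP _ _ n_Nf; have [gg ggE] := dvdpP _ _ n_Ng.
have [[la mu] /= dE] := Bezoutp Nf Ng; have [[rh nu] /= nE] := Bezoutp d (e1 * Q).
(* A Bezout combination equals the gcd only up to a nonzero constant; the constants of the two
   nested gcds combine into [l]. *)
have [l l0 bez] : exists2 l, l != 0 & exists a b e,
    i a * i Nf + i b * i Ng + i e * (i e1 * i Q) = i n * i l%:P.
  move/eqpP: dE => [[a1 a2] /andP[/= a10 a20] a12].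
  move/eqpP: nE => [[b1 b2] /andP[/= b10 b20] b12].
  exists (a2 * b2); first by rewrite mulf_neq0.
  exists (b1%:P * rh * a1%:P * la), (b1%:P * rh * a1%:P * mu), (a2%:P * b1%:P * nu).
  rewrite -!rmorphM -!rmorphD; congr (ev _ _ _).
  rewrite polyCM.
  have -> : n * (a2%:P * b2%:P) = a2%:P * (b2%:P * n) by ring.
  rewrite [b2%:P * n]mul_polyC -/n -b12 -mul_polyC.
  have -> : a2%:P * (b1%:P * (rh * d + nu * (e1 * Q))) =
     b1%:P * rh * (a2%:P * d) + a2%:P * b1%:P * nu * (e1 * Q) by ring.
  by rewrite [a2%:P * d]mul_polyC -/d -a12 -mul_polyC; ring.
have iN0 : i n * i l%:P != 0 by rewrite mulf_neq0 // ev_eq0 // polyC_eq0.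
have iL0 : i l%:P != 0 by rewrite ev_eq0 polyC_eq0.
have in0 : i n != 0 by rewrite ev_eq0.
have [a [b [e bezE]]] := bez.
pose w := i h0 + i h1 * z; pose wb := i (h0 + h1 * Q) + i h1 * z.
have TE' : f * gb = i n * w.
  by rewrite TE h0E h1E /w !rmorphM /=; ring.
have TbE' : fb * g = i n * wb.
  by rewrite TbE h0E h1E /wb !rmorphD !rmorphM /=; ring.
have Rw : coord_ring u z w by exists h0, h1.
have Rwb : coord_ring u z wb by exists (h0 + h1 * Q), h1.
have NfE' : f * fb = i n * i gf by rewrite NfE gfE rmorphM mulrC.
have NgE' : g * gb = i n * i gg by rewrite NgE ggE rmorphM mulrC.
have aux (x y p q N L : K) : L != 0 ->
    x * (N * p) + y * (N * q) = L^-1 * (x * p + y * q) * (N * L).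
  by move=> L0; field.
pose il := ev c u (l^-1)%:P.
have ilE : il = (i l%:P)^-1 by rewrite /il !evC fmorphV.
pose al := (i a * fb + i e * gb) / (i n * i l%:P).
pose be := (i b * gb + i e * fb) / (i n * i l%:P).
have Ri p : coord_ring u z (i p) by apply: coord_ring_ev.
have af : al * f = il * (i a * i gf + i e * w).
  rewrite ilE /al; apply: (mulIf iN0); rewrite mulrAC mulfVK //.
  transitivity (i a * (f * fb) + i e * (f * gb)); first ring.
  by rewrite NfE' TE'; apply: aux.
have ag : al * g = il * (i a * wb + i e * i gg).
  rewrite ilE /al; apply: (mulIf iN0); rewrite mulrAC mulfVK //.
  transitivity (i a * (fb * g) + i e * (g * gb)); first ring.
  by rewrite NgE' TbE'; apply: aux.
have bf : be * f = il * (i b * w + i e * i gf).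
  rewrite ilE /be; apply: (mulIf iN0); rewrite mulrAC mulfVK //.
  transitivity (i b * (f * gb) + i e * (f * fb)); first ring.
  by rewrite NfE' TE'; apply: aux.
have bg : be * g = il * (i b * i gg + i e * wb).
  rewrite ilE /be; apply: (mulIf iN0); rewrite mulrAC mulfVK //.
  transitivity (i b * (g * gb) + i e * (fb * g)); first ring.
  by rewrite NgE' TbE'; apply: aux.
exists al, be; split.
- apply: (mulIf iN0); rewrite mul1r -[RHS]bezE -NfE -NgE.
  transitivity (i a * (f * fb) + i b * (g * gb) + i e * (f * gb + fb * g)).
    by rewrite /al /be; field; rewrite in0 iL0.
  by rewrite TE TbE; ring2 two0K.
- by rewrite af; repeat first [exact: Ri|exact: Rw|exact: Rwb|apply: coord_ringM|apply: coord_ringD].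
- by rewrite ag; repeat first [exact: Ri|exact: Rw|exact: Rwb|apply: coord_ringM|apply: coord_ringD].
- by rewrite bf; repeat first [exact: Ri|exact: Rw|exact: Rwb|apply: coord_ringM|apply: coord_ringD].
- by rewrite bg; repeat first [exact: Ri|exact: Rw|exact: Rwb|apply: coord_ringM|apply: coord_ringD].
Qed.

End Chart.

Section ChartBound.
Variables (k K : fieldType) (c : {rmorphism k -> K}) (D : K -> K).
Variables (two0 : 2 = 0 :> k) (P Q : {poly k}) (u z : K).
Hypotheses (ch : chart c P Q u z) (derD : derivation c D) (tau0 : D u != 0).

Local Notation i := (ev c u).
Local Notation R := (coord_ring c u z).

Let R0 : R 0. Proof. by exists 0, 0; rewrite rmorph0 mul0r addr0. Qed.
Let R1 : R 1. Proof. by exists 1, 0; rewrite rmorph1 rmorph0 mul0r addr0. Qed.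
Let RD f g : R f -> R g -> R (f + g). Proof. exact: coord_ringD. Qed.
Let RM f g : R f -> R g -> R (f * g). Proof. exact: (coord_ringM ch). Qed.
Let RB f g : R f -> R g -> R (f - g).
Proof. by move=> Rf Rg; apply: RD => //; apply: coord_ringN. Qed.

Section Localization.
Variable m : set K.
Hypotheses (mid : ideal_of R m) (m1 : ~ m 1) (m_neq0 : exists2 d, m d & d != 0)
  (m_max : forall s, R s -> ~ m s -> exists x r, [/\ m x, R r & 1 = x + s * r]).

Definition localization : set K :=
  [set f | exists r s, [/\ R r, R s, ~ m s & f * s = r]].

Let mprime s t : R s -> R t -> ~ m s -> ~ m t -> ~ m (s * t).
Proof.
move=> Rs Rt ms mt mst; apply: m1; have [mR m0 mD mM] := mid.
have [x [r [mx Rr ->]]] := m_max Rs ms.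
have [y [q [my Rq e]]] := m_max Rt mt.
have -> : x + s * r = x + (r * s) * y + (r * q) * (s * t).
  by rewrite -[s * r]mulr1 e; ring.
by apply: (mD); [apply: (mD) => //|]; apply: (mM) => //; apply: RM.
Qed.

(** For the valuation property write f = r/d with r, d in R. Invertibility of the ideal (r, d) gives
    al r + be d = 1 with all four products in R, and m cannot contain both terms. If be d is outside
    m, then f = (be r)/(be d); otherwise 1/f = (al d)/(al r). *)
Lemma localization_place : place c localization.
Proof.
have [mR m0 mD mM] := mid; split.
- by move=> a; exists (i a%:P), 1; split=> //; [exact: coord_ring_ev|rewrite evC mulr1].
- move=> f g [r [s [Rr Rs ms e]]] [r' [s' [Rr' Rs' ms' e']]]; split.
    exists (r * s' - r' * s), (s * s'); split; [|exact: RM|exact: mprime|].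
      by apply: RB; apply: RM.
    by rewrite -e -e'; ring.
  exists (r * r'), (s * s'); split; [exact: RM|exact: RM|exact: mprime|].
  by rewrite -e -e'; ring.
- have [d md d0] := m_neq0; exists d^-1 => -[r [s [Rr Rs ms e]]]; apply: ms.
  by rewrite -[s](mulVKf d0) e mulrC; apply: (mM).
move=> f; have [_ _ gen _ _] := ch; have [a [b [d [d0 e]]]] := gen f.
set r := i a + _ in e; have Rr : R r by exists a, b.
have Rd : R (i d) by apply: coord_ring_ev.
have id0 : i d != 0 by rewrite (ev_eq0 ch).
have [al [be [e1 Rar Rad Rbr Rbd]]] := coord_ring_invertible two0 ch Rr Rd id0.
have [mbd|mbd] := pselect (m (be * i d)); last first.
  left; exists (be * r), (be * i d); split=> //; rewrite -e; ring.
right; have mar : ~ m (al * r).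
  by move=> mar; apply: m1; rewrite -e1; apply: (mD).
have r0 : r != 0 by apply/eqP=> r0; apply: mar; rewrite r0 mulr0.
exists (i d / r); last first.
  by rewrite mulrA e mulfV.
exists (al * i d), (al * r); split=> //.
by field.
Qed.

Lemma localization_coord_ring f : R f -> localization f.
Proof. by move=> Rf; exists f, 1; rewrite mulr1. Qed.

(** On R this is [deriv_coord], and the quotient rule extends it to fractions. Thus O.D(O) lies in
    O.(D u / Q), the converse of what [chart_regular] provides. *)
Lemma localization_deriv h : localization h ->
  exists2 e, localization e & D h * i Q = D u * e.
Proof.
have [Dc DD DM] := derD; have plO := localization_place.
have derivR r : R r -> exists2 e, R e & D r * i Q = D u * e.
  move=> [a [b ->]].
  exists (i a^`() * i Q + i b^`() * i Q * z + i b * (i P^`() + i Q^`() * z)).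
    apply: RD; first apply: RD.
    - by rewrite -rmorphM; apply: coord_ring_ev.
    - by rewrite -rmorphM; exists 0, (b^`() * Q); rewrite rmorph0 add0r.
    - by apply: RM; [apply: coord_ring_ev|exists P^`(), Q^`()].
  rewrite DD DM !(deriv_ev _ derD).
  transitivity (i a^`() * D u * i Q + i b^`() * D u * z * i Q + i b * (i Q * D z)).
    by ring.
  by rewrite (deriv_coord two0 ch derD); ring.
move=> [r [s [Rr Rs ms hs]]].
have [r' Rr' er] := derivR r Rr; have [s' Rs' es] := derivR s Rs.
have s0 : s != 0 by apply/eqP => s0; apply: ms; case: mid => _ m0 _ _; rewrite s0.
have Os : localization s^-1.
  by exists 1, s; split=> //; rewrite mulVf.
have Oh : localization h by exists r, s.
exists ((r' - h * s') * s^-1).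
  apply: (placeM plO) => //; apply: (placeB plO); first exact: localization_coord_ring.
  by apply: (placeM plO) => //; apply: localization_coord_ring.
apply: (mulIf s0); rewrite mulrA mulfVK // mulrBr -er mulrCA -es -hs DM; ring.
Qed.

End Localization.

(** Let I be the ideal of denominators of g0 = f Q / D u. If I were proper, it would lie in a
    maximal ideal m. Regularity at the local ring of m puts g0 in that ring, so g0 has a denominator
    outside m, yet all denominators are in I. *)
Lemma chart_bound f :
  (forall O, place c O -> O u -> regular_at D O f) -> R (f * i Q / D u).
Proof.
move=> freg; apply: contrapT => nR; set g0 := f * i Q / D u in nR.
pose I := [set r | R r /\ R (r * g0)].
have Iid : ideal_of R I.
  split=> //; first by move=> r [].
  - by split=> //; rewrite mul0r.
  - by move=> r s [Rr rg] [Rs sg]; split; [exact: RD|rewrite mulrDl; exact: RD].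
  - by move=> r s Rr [Rs sg]; split; [exact: RM|rewrite -mulrA; exact: RM].
have I1 : ~ I 1 by rewrite /I /= mul1r => -[].
have [m [mid m1 Im mmax]] := exists_maximal_ideal R0 R1 RD RM Iid I1.
have [mR m0 mD mM] := mid.
(* This keeps the localization from being all of K. The nonzero element is a denominator of g0,
   which exists since K is the fraction field of R. *)
have m_neq0 : exists2 d, m d & d != 0.
  have [_ _ gen _ _] := ch; have [a [b [d [d0 e]]]] := gen g0.
  exists (i d); last by rewrite (ev_eq0 ch).
  apply: Im; split; first exact: coord_ring_ev.
  by rewrite mulrC e; exists a, b.
have plO := localization_place mid m1 m_neq0 mmax.
have Ou : localization m u.
  by apply: localization_coord_ring => //; exists 'X, 0; rewrite evX rmorph0 mul0r addr0.
have [g [h [Og Oh e]]] := freg _ plO Ou.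
have [w Ow hw] := localization_deriv mid m1 m_neq0 mmax Oh.
have : localization m g0.
  have -> : g0 = g * w.
    by apply: (mulIf tau0); rewrite mulfVK // e -mulrA hw; ring.
  exact: (placeM plO).
move=> [r [s [Rr Rs ms es]]]; apply: ms; apply: Im; split=> //.
by rewrite mulrC es.
Qed.

End ChartBound.

(** * Regular differentials on the complete curve *)

Definition swap (k : fieldType) : k * k * k * k := (0, 1, 1, 0).

Section Reverse.
Variables (k K : fieldType) (c : {rmorphism k -> K}).
Implicit Types p : {poly k}.
Local Notation swap := (swap k).

Lemma hsub_swap N p : hsub N swap p = \poly_(j < N.+1) p`_(N - j).
Proof.
rewrite poly_def /hsub /swap (reindex_inj rev_ord_inj); apply: eq_bigr => j _.
rewrite scale0r add0r expr1n mul1r scale1r addr0 /= subSS subKn //.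
by rewrite -ltnS.
Qed.

Lemma hsub_swap_eq0 N p : (size p <= N.+1)%N -> hsub N swap p = 0 -> p = 0.
Proof.
move=> pN e; apply/polyP => j; rewrite coef0.
have [jN|jN] := leqP j N; last by rewrite nth_default // (leq_trans pN).
have /(congr1 (fun q : {poly k} => q`_(N - j))) := e.
by rewrite hsub_swap coef_poly coef0 ltnS leq_subr subKn.
Qed.

Lemma ev_swap u N p : (size p <= N.+1)%N -> u != 0 ->
  ev c u (hsub N swap p) = u ^+ N * ev c u^-1 p.
Proof.
move=> pN u0; have l : c 1 * u + c 0 = u by rewrite rmorph1 rmorph0 mul1r addr0.
by rewrite ev_hsub ?l // rmorph1 rmorph0 mul0r add0r mul1r.
Qed.

End Reverse.

(* A model z^2 + Qz = P of a curve of genus two, smooth in the chart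
   z^2 + Q(x)z = P(x) and in the chart at infinity, with coordinates 1/x, z/x^3. *)
Definition smooth_model (k : fieldType) (P Q : {poly k}) :=
  [/\ Q != 0, (size Q <= 4)%N, (size P <= 7)%N, coprimep Q (discr P Q)
    & coprimep (hsub 3 (swap k) Q) (discr (hsub 6 (swap k) P) (hsub 3 (swap k) Q))].

Section Curve.
Variables (k K : fieldType) (c : {rmorphism k -> K}) (D : K -> K).
Variables (two0 : 2 = 0 :> k) (P Q : {poly k}) (x z : K).
Hypotheses (sm : smooth_model P Q) (ch : chart c P Q x z).
Hypotheses (derD : derivation c D) (Dx : D x = 1).

Local Notation i := (ev c x).
Local Notation j := (ev c x^-1).
Local Notation rev N p := (hsub N (swap k) p).

Lemma chart_var_neq0 : x != 0.
Proof. by rewrite -[x](evX c) (ev_eq0 ch) polyX_eq0. Qed.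
Let x0 := chart_var_neq0.

Lemma ev_inv_swap N (p : {poly k}) : (size p <= N.+1)%N -> j (rev N p) = x ^- N * i p.
Proof. by move=> pN; rewrite ev_swap // ?invr_eq0 // exprVn invrK. Qed.

(** Dividing the equation by x^6 reverses P in degree 6 and Q in degree 3. Generation and
    independence are carried over from the finite chart by reversing coefficients. *)
Lemma chart_infinity : chart c (rev 6 P) (rev 3 Q) x^-1 (z / x ^+ 3).
Proof.
have [Q0 Q4 P7 _ smI] := sm; have [zE _ gen free _] := ch.
have wide (p q : {poly k}) : exists N, (size p <= N.+1)%N /\ (size q <= N.+1)%N.
  by exists (size p + size q)%N; split; rewrite ltnW // ltnS (leq_addl, leq_addr).
split=> //.
- rewrite !ev_inv_swap // exprMn zE; field; rewrite ?x0 ?expf_neq0 ?x0 ?iQ0 //.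
- by apply: contraNneq Q0 => /hsub_swap_eq0 ->.
- move=> f; have [a [b [d [d0 e]]]] := gen f.
  have [N [aN bN]] := wide a b; have [N' [dN' _]] := wide d d.
  have aN3 : (size a <= (N + N' + 3).+1)%N by rewrite (leq_trans aN) // ltnS -addnA leq_addr.
  have bN3 : (size b <= (N + N').+1)%N by rewrite (leq_trans bN) // ltnS leq_addr.
  have dN3 : (size d <= (N + N' + 3).+1)%N.
    by rewrite (leq_trans dN') // ltnS addnAC leq_addl.
  (* The relation f d = a + b z is divided by x^(N+N'+3); the factor x^-3 goes with z, which leaves
     N + N' for b. *)
  exists (rev (N + N' + 3) a), (rev (N + N') b), (rev (N + N' + 3) d); split.
    by apply: contraNneq d0 => /(hsub_swap_eq0 dN3) ->.
  rewrite !ev_inv_swap // mulrCA e !exprD; field; rewrite ?x0 ?expf_neq0 ?x0 ?iQ0 //.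
- move=> a b e; have [N [aN bN]] := wide a b.
  have eN (q : {poly k}) : (size q <= N.+1)%N -> j q = x ^- N * i (rev N q).
    by move=> qN; rewrite ev_swap // mulKf // expf_neq0.
  have : i (rev N a * 'X^3) + i (rev N b) * z = 0.
    have := e; rewrite !eN // => e'.
    rewrite !(rmorphXn, rmorphM) /= evX.
    have -> : i (rev N a) * x ^+ 3 + i (rev N b) * z =
      x ^+ N * x ^+ 3 * (x ^- N * i (rev N a) + x ^- N * i (rev N b) * (z / x ^+ 3)).
      by field; rewrite ?x0 ?expf_neq0 ?x0 ?iQ0 //.
    by rewrite e' mulr0.
  move=> /free[/eqP]; rewrite mulf_eq0 expf_eq0 polyX_eq0 orbF.
  by move=> /eqP/(hsub_swap_eq0 aN) -> /(hsub_swap_eq0 bN) ->.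
Qed.

Lemma deriv_inv : D x^-1 = - x ^- 2.
Proof.
have [Dc DD DM] := derD; have D1 : D 1 = 0 by rewrite -(rmorph1 c) Dc.
have := DM x x^-1; rewrite mulfV // D1 Dx mul1r => e.
apply: (mulfI x0); have -> : x * D x^-1 = - x^-1.
  by apply/eqP; rewrite -addr_eq0 addrC -e.
by field; rewrite x0.
Qed.

Definition regular f := forall O, place c O -> regular_at D O f.

Lemma regular_atM O f g : place c O -> O f -> regular_at D O g -> regular_at D O (f * g).
Proof.
move=> plO Of [g1 [h [Og Oh ->]]]; exists (f * g1), h; split=> //; last by rewrite mulrA.
exact: (placeM plO).
Qed.

Let Dx0 : D x != 0. Proof. by rewrite Dx oner_eq0. Qed.
Let Dy0 : D x^-1 != 0.
Proof. by rewrite deriv_inv oppr_eq0 invr_eq0 expf_neq0. Qed.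
Let iQ0 : i Q != 0. Proof. by rewrite (ev_eq0 ch); case: sm. Qed.

(** Where x is in O the finite chart yields 1/Q, and x multiplies it. Where 1/x is in O the chart at
    infinity yields D(1/x) / (x^-3 Q) = -x/Q, and 1/x multiplies it. *)
Lemma regular_basis : regular (i Q)^-1 /\ regular (x / i Q).
Proof.
suff H O : place c O -> regular_at D O (i Q)^-1 /\ regular_at D O (x / i Q).
  by split=> O /H[].
move=> plO; have [Ox|[Oy _]] := placeV plO x.
  have r1 : regular_at D O (i Q)^-1.
    by have := chart_regular two0 ch derD plO Ox; rewrite Dx mul1r.
  by split=> //; apply: regular_atM.
have r1 := chart_regular two0 chart_infinity derD plO Oy.
have r2 : regular_at D O (x / i Q).
  have -> : x / i Q = (- 1) * (D x^-1 / j (rev 3 Q)).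
    rewrite deriv_inv ev_inv_swap; last by case: sm.
    by field; rewrite ?iQ0 ?x0 ?expf_neq0 ?x0 //.
  by apply: regular_atM => //; apply: (placeN plO); apply: (place1 plO).
split=> //.
have -> : (i Q)^-1 = x^-1 * (x / i Q) by field; rewrite ?iQ0 ?x0 ?expf_neq0 ?x0 //.
exact: regular_atM.
Qed.

(** The finite chart gives f Q = a + b z with polynomials a, b. At infinity the bound concerns -f Q
    / x, so a + b z is also -x (a'(1/x) + b'(1/x) z/x^3). Comparing degrees in x leaves b = 0 and
    deg a <= 1. *)
Lemma regular_bound f : regular f -> exists c0 c1, f * i Q = c c0 + c c1 * x.
Proof.
move=> freg; have [zE _ gen free _] := ch.
have [a [b eab]] : coord_ring c x z (f * i Q / D x).
  by apply: (chart_bound two0 ch) => // O plO _; apply: freg.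
have [a' [b' eab']] : coord_ring c x^-1 (z / x ^+ 3) (f * j (rev 3 Q) / D x^-1).
  by apply: (chart_bound two0 chart_infinity) => // O plO _; apply: freg.
have [_ Q4 _ _ _] := sm.
pose N := (size a' + size b')%N.
have aN : (size a' <= N.+1)%N by rewrite ltnW // ltnS leq_addr.
have bN : (size b' <= N.+1)%N by rewrite ltnW // ltnS leq_addl.
have eN (q : {poly k}) : (size q <= N.+1)%N -> j q = x ^- N * i (rev N q).
  by move=> qN; rewrite ev_swap // mulKf // expf_neq0.
rewrite Dx divr1 in eab.
rewrite ev_inv_swap // !eN // deriv_inv in eab'.
(* Both expressions of f Q are multiplied by x^(N+2), which clears all negative powers of x. *)
have e0 : i (a * 'X^(N.+2) + rev N a' * 'X^3) + i (b * 'X^(N.+2) + rev N b') * z = 0.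
  rewrite !(rmorphXn, rmorphD, rmorphM) /= evX.
  have -> : i a * x ^+ N.+2 + i (rev N a') * x ^+ 3 + (i b * x ^+ N.+2 + i (rev N b')) * z
    = x ^+ N * x ^+ 2 * (i a + i b * z) +
      x ^+ N * x ^+ 3 * (x ^- N * i (rev N a') + x ^- N * i (rev N b') * (z / x ^+ 3)).
    by rewrite -addn2 exprD; field; rewrite ?x0 ?expf_neq0 ?x0 ?iQ0 //.
  by rewrite -eab -eab'; field; rewrite x0 oppr_eq0 oner_eq0.
have [ea eb] := free _ _ e0.
have rN (q : {poly k}) : (size (rev N q) <= N.+1)%N by apply: size_hsub.
have b0 : b = 0.
  apply/eqP; apply: contraT => b0.
  have := rN b'; move/eqP: eb; rewrite addrC addr_eq0 => /eqP ->.
  rewrite size_polyN size_mulXn // => h.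
  by move: (leq_trans (leq_addr _ _) h); rewrite ltnn.
have a2 : (size a <= 2)%N.
  have [->|a0] := eqVneq a 0; first by rewrite size_poly0.
  have [e|ra0] := eqVneq (rev N a') 0.
    by move/eqP: ea; rewrite e mul0r addr0 mulf_eq0 expf_eq0 polyX_eq0 andbF orbF (negPf a0).
  have := rN a'; move/eqP: ea; rewrite addr_eq0 => /eqP/(congr1 (fun q : {poly k} => size q)).
  rewrite size_polyN !size_mulXn //; move: (size a) (size (rev N a')) => s1 s2.
  by move: (N); lia.
exists a`_0, a`_1; rewrite eab b0 rmorph0 mul0r addr0 (ev_wide _ _ a2).
by rewrite !big_ord_recl big_ord0 /= expr0 expr1 mulr1 addr0.
Qed.

End Curve.

(** * Isomorphisms induce Moebius maps *)

(** u is a separating element: Q is nonzero, so [deriv_coord] determines D z from D u, and the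
    product rule then determines D on all fractions. *)
Lemma derivation_unique (k K : fieldType) (c : {rmorphism k -> K}) (D1 D2 : K -> K)
    (P Q : {poly k}) u z : 2 = 0 :> k -> chart c P Q u z ->
  derivation c D1 -> derivation c D2 -> D1 u = D2 u -> D1 =1 D2.
Proof.
move=> two0 ch d1 d2 eu f; have [zE Q0 gen free _] := ch.
have iQ0 : ev c u Q != 0 by rewrite (ev_eq0 ch).
have ez : D1 z = D2 z.
  apply: (mulfI iQ0); rewrite (deriv_coord two0 ch d1) (deriv_coord two0 ch d2).
  by rewrite eu.
have ep p : D1 (ev c u p) = D2 (ev c u p).
  by rewrite (deriv_ev _ d1) (deriv_ev _ d2) eu.
have [a [b [d [d0 e]]]] := gen f.
have id0 : ev c u d != 0 by rewrite (ev_eq0 ch).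
have [_ D1D D1M] := d1; have [_ D2D D2M] := d2.
have : D1 (f * ev c u d) = D2 (f * ev c u d).
  by rewrite e D1D D1M D2D D2M ez !ep.
by rewrite D1M D2M ep => /addIr /(mulIf id0).
Qed.

Section Isomorphism.
Variables (k K K' : fieldType) (two0 : 2 = 0 :> k).
Variables (c : {rmorphism k -> K}) (c' : {rmorphism k -> K'}).
Variables (D : K -> K) (D' : K' -> K') (P Q P' Q' : {poly k}) (x z : K) (x' z' : K').
Hypotheses (sm : smooth_model P Q) (ch : chart c P Q x z).
Hypotheses (derD : derivation c D) (Dx : D x = 1).
Hypotheses (sm' : smooth_model P' Q') (ch' : chart c' P' Q' x' z').
Hypotheses (derD' : derivation c' D') (Dx' : D' x' = 1).
Variable th : {rmorphism K' -> K}.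
Hypotheses (th_bij : bijective th) (thc : forall a, th (c' a) = c a).

Local Notation i := (ev c x).

Let two0K : 2 = 0 :> K. Proof. by rewrite -(rmorph_nat c) two0 rmorph0. Qed.
Let two0P : 2 = 0 :> {poly k}. Proof. exact: char2_poly. Qed.

Lemma rmorph_ev u p : th (ev c' u p) = ev c (th u) p.
Proof.
rewrite !evE rmorph_sum; apply: eq_bigr => j _.
by rewrite rmorphM rmorphXn /= thc.
Qed.

Lemma chart_transport : chart c P' Q' (th x') (th z').
Proof.
have [zE Q0 gen free cop] := ch'; have [ht thK htK] := th_bij.
have th_inj : injective th by apply: can_inj thK.
split=> // [|f|a b].
- by rewrite -!rmorph_ev -rmorphXn zE rmorphD rmorphM.
- have [a [b [d [d0 e]]]] := gen (ht f); exists a, b, d; split=> //.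
  by rewrite -!rmorph_ev -{1}[f]htK -!rmorphM -rmorphD e.
rewrite -!rmorph_ev -rmorphM -rmorphD -(rmorph0 th) => /th_inj.
exact: free.
Qed.
Let chX := chart_transport.

Local Notation X := (th x').
Local Notation Z := (th z').

(** Conjugating D' by th and scaling by D X gives a derivation of K with the value D X at X, like D;
    uniqueness on the transported chart identifies the two. *)
Lemma deriv_transport f : D (th f) = D X * th (D' f).
Proof.
have [ht thK htK] := th_bij; have [D'c D'D D'M] := derD'.
have th_inj : injective th by apply: can_inj thK.
have htD f1 g1 : ht (f1 + g1) = ht f1 + ht g1.
  by apply: th_inj; rewrite rmorphD /= !htK.
have htM f1 g1 : ht (f1 * g1) = ht f1 * ht g1.
  by apply: th_inj; rewrite rmorphM /= !htK.
have htc a : ht (c a) = c' a by apply: th_inj; rewrite htK thc.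
pose D2 g := D X * th (D' (ht g)).
have der2 : derivation c D2.
  split=> [a|f1 g1|f1 g1].
  - by rewrite /D2 htc D'c rmorph0 mulr0.
  - by rewrite /D2 htD D'D rmorphD mulrDr.
  - by rewrite /D2 htM D'M rmorphD !rmorphM /= !htK; ring.
have := derivation_unique two0 chX derD der2.
rewrite /D2 thK Dx' rmorph1 mulr1 => /(_ erefl (th f)) ->.
by rewrite thK.
Qed.

Lemma deriv_image_neq0 : D X != 0.
Proof.
have [ht thK htK] := th_bij; apply/eqP => DX0.
have /eqP := deriv_transport (ht x); rewrite htK Dx DX0 mul0r.
by rewrite oner_eq0.
Qed.
Let DX0 := deriv_image_neq0.

Lemma regular_transport f : regular c' D' f -> regular c D (D X * th f).
Proof.
have [ht thK htK] := th_bij; move=> freg O plO.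
have plO' : place c' [set g | O (th g)].
  apply/(place_image _ th_bij thc).
  have -> // : th @` [set g | O (th g)] = O.
  by apply/seteqP; split=> [_ [g Og <-] //|g Og]; exists (ht g); rewrite /= htK.
have [g [h [Og Oh ->]]] := freg _ plO'.
exists (th g), (th h); split=> //.
by rewrite [D (th h)]deriv_transport rmorphM mulrCA.
Qed.

(** The images of the two basic regular elements are D X / Q'(X) = (d + g x)/Q and X D X / Q'(X) =
    (b + a x)/Q, with quotient X. Put l = g x + d. Differentiating X l = a x + b gives D X l^2 =
    det, and substituting the first formula for l yields l^3 Q'(X) = det Q. *)
Lemma moebius_of_isom : exists a b g d,
  [/\ a * d + b * g != 0, c g * x + c d != 0,
      X = (c a * x + c b) / (c g * x + c d)
    & hsub 3 (a, b, g, d) Q' = (a * d + b * g) *: Q].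
Proof.
have [r1 r2] := regular_basis two0 sm' ch' derD' Dx'.
have [d [g e1]] := regular_bound two0 sm ch derD Dx (regular_transport r1).
have [b [a e2]] := regular_bound two0 sm ch derD Dx (regular_transport r2).
move: e1 e2; rewrite rmorphM fmorphV rmorph_ev.
set E := ev c X Q' => e1 e2; have [Dc DD DM] := derD.
have E0 : E != 0 by rewrite (ev_eq0 chX); case: sm'.
have iQ0 : i Q != 0 by rewrite (ev_eq0 ch); case: sm.
have l0 : c g * x + c d != 0.
  by rewrite addrC -e1 !mulf_neq0 // ?invr_eq0.
have eX : X = (c a * x + c b) / (c g * x + c d).
  by rewrite addrC -e2 [_ + c d]addrC -e1; field; rewrite E0 iQ0 DX0.
have eD : D X * (c g * x + c d) ^+ 2 = c (a * d + b * g).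
  have h : X * (c g * x + c d) = c a * x + c b by rewrite eX mulfVK.
  have := congr1 D h; rewrite !(DM, DD) !Dc Dx => e3.
  have -> : D X * (c g * x + c d) ^+ 2 = (D X * (c g * x + c d)
    + X * (0 * x + c g * 1 + 0)) * (c g * x + c d) - c g * (X * (c g * x + c d)) by ring.
  by rewrite e3 h; ring2 two0K.
have D0 : a * d + b * g != 0.
  by rewrite -(fmorph_eq0 c) -eD mulf_neq0 // expf_neq0.
exists a, b, g, d; split=> //.
have Q4 : (size Q' <= 4)%N by case: sm'.
have : i (hsub 3 (a, b, g, d) Q') = i ((a * d + b * g) *: Q).
  rewrite ev_hsub // -eX -/E -mul_polyC rmorphM /= evC -eD.
  move: e1; rewrite [c d + _]addrC => e1; rewrite exprSr -e1.
  by field.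
by move=> e; apply/eqP; rewrite -subr_eq0 -(ev_eq0 ch) rmorphB /= e subrr eqxx.
Qed.

Let rational f := exists a d, d != 0 /\ f * i d = i a.

Let i_neq0 p : p != 0 -> i p != 0. Proof. by rewrite (ev_eq0 ch). Qed.

Let rationalD f g : rational f -> rational g -> rational (f + g).
Proof.
move=> [a [d [d0 e]]] [a' [d' [d0' e']]]; exists (a * d' + a' * d), (d * d').
by rewrite mulf_neq0 //; split=> //; rewrite rmorphD !rmorphM /= -e -e'; ring.
Qed.

Let rationalM f g : rational f -> rational g -> rational (f * g).
Proof.
move=> [a [d [d0 e]]] [a' [d' [d0' e']]]; exists (a * a'), (d * d').
by rewrite mulf_neq0 //; split=> //; rewrite !rmorphM /= -e -e'; ring.
Qed.

Let rationalV f : rational f -> rational f^-1.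
Proof.
move=> [a [d [d0 e]]]; have [->|f0] := eqVneq f 0.
  by exists 0, 1; rewrite oner_neq0 invr0 mul0r rmorph0.
exists d, a; split; last by rewrite -e mulKf.
by rewrite -(ev_eq0 ch) -e mulf_neq0 // i_neq0.
Qed.

Let rational_ev p : rational (i p).
Proof. by exists p, 1; rewrite oner_neq0 rmorph1 mulr1. Qed.

(** After rescaling, the image of z' satisfies a quadratic equation with the same linear term Q as
    z. Two generators of this kind differ by an element of k(x), and normality makes it a polynomial
    r. *)
Lemma isom_criterion_necessary : exists a b g d (r : {poly k}),
  [/\ a * d + b * g != 0, (size r <= 4)%N,
      hsub 3 (a, b, g, d) Q' = (a * d + b * g) *: Q
    & hsub 6 (a, b, g, d) P' = (a * d + b * g) ^+ 2 *: (P + r ^+ 2 + r * Q)].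
Proof.
have [a [b [g [d [De0 l0 eX eQ]]]]] := moebius_of_isom.
set De := a * d + b * g in De0 eQ *.
have [zE _ gen free cop] := ch; have [ZE _ genX _ _] := chX.
have [Q0 Q4 P7 _ _] := sm; have [Q'0 Q'4 P'7 _ _] := sm'.
have cDe0 : c De != 0 by rewrite fmorph_eq0.
set l := c g * x + c d in l0 eX.
(* The factor l^3 / det turns Q'(X) into Q, by the equality of cubic forms, so that v^2 = S + Q
   v. *)
pose v := Z * l ^+ 3 / c De.
pose S := De ^- 2 *: hsub 6 (a, b, g, d) P'.
have S7 : (size S <= 7)%N.
  by rewrite (leq_trans (size_scale_leq _ _)) // size_hsub.
have vE : v ^+ 2 = i S + i Q * v.
  have h6 : i (hsub 6 (a, b, g, d) P') = l ^+ 6 * ev c X P' by rewrite ev_hsub // eX.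
  have h3 : c De * i Q = l ^+ 3 * ev c X Q'.
    by rewrite -(evC c x) -rmorphM /= mul_polyC -eQ ev_hsub // eX.
  rewrite /S -mul_polyC rmorphM /= h6 evC fmorphV rmorphXn /=.
  have -> : i Q = l ^+ 3 * ev c X Q' / c De by rewrite -h3 mulrAC mulfV // mul1r.
  by rewrite /v !exprMn ZE; field.
have [e0 [e1 [n [n0 ev_v]]]] := gen v.
have in0 := i_neq0 n0.
have eq1 : i (e0 ^+ 2 + e1 ^+ 2 * P + n ^+ 2 * S + n * e0 * Q)
  + i (e1 * Q * (e1 + n)) * z = 0.
  have h : (v * i n) ^+ 2 = i S * i n ^+ 2 + i Q * i n * (v * i n).
    by rewrite exprMn vE; ring.
  rewrite ev_v in h.
  have -> : i (e0 ^+ 2 + e1 ^+ 2 * P + n ^+ 2 * S + n * e0 * Q)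
    + i (e1 * Q * (e1 + n)) * z = (i e0 + i e1 * z) ^+ 2
    + (i S * i n ^+ 2 + i Q * i n * (i e0 + i e1 * z)).
    by ring2_mod two0K zE.
  by rewrite -h; ring2 two0K.
have [h0 h1] := free _ _ eq1.
have e1n : e1 = n.
  move/eqP: h1; rewrite !mulf_eq0 (negPf Q0) orbF => /orP[/eqP e10|]; last first.
    rewrite addr_eq0 => /eqP ->; ring2 two0P.
  (* All of K would be contained in k(x). *)
  have ratl : rational l.
    by exists (g *: 'X + d%:P), 1; rewrite oner_neq0 rmorph1 mulr1 ev_lin.
  have rat_c t : rational (c t) by rewrite -(evC c x); apply: rational_ev.
  have ratZ : rational Z.
    have -> : Z = v * c De * (l ^+ 3)^-1 by rewrite /v mulfVK // mulfK // expf_neq0.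
    apply: rationalM; last first.
      by apply: rationalV; rewrite !exprS; do 3!apply: rationalM => //; exists 1, 1; rewrite oner_neq0 mul1r rmorph1.
    apply: rationalM => //; exists e0, n; split=> //.
    by rewrite ev_v e10 rmorph0 mul0r addr0.
  have ratX : rational X.
    rewrite eX; apply: rationalM; last exact: rationalV.
    by rewrite -ev_lin; apply: rational_ev.
  have rat_ev p : rational (ev c X p).
    elim/poly_ind: p => [|p t IH]; first by exists 0, 1; rewrite oner_neq0 !rmorph0 mul0r.
    by rewrite rmorphD rmorphM /= evX evC; apply: rationalD => //; apply: rationalM.
  have [s [t [w [w0 ezw]]]] := genX z.
  have iw0 : ev c X w != 0 by rewrite (ev_eq0 chX).
  have [p [q [q0 eq]]] : rational z.
    rewrite -[z](mulfK iw0) ezw; apply: rationalM; last exact: rationalV.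
    by apply: rationalD => //; apply: rationalM.
  have e3 : i p + i (- q) * z = 0 by rewrite -eq rmorphN; ring.
  have [_ /eqP] := free _ _ e3; rewrite oppr_eq0 => /eqP q00.
  by rewrite q00 eqxx in q0.
rewrite {}e1n in h0 ev_v {eq1 h1}.
have eS : e0 ^+ 2 + e0 * n * Q + n ^+ 2 * P = n ^+ 2 * S.
  apply/eqP; rewrite -subr_eq0; apply/eqP; rewrite -h0; ring2 two0P.
(* v = (e0 + n z)/n has trace Q and norm S, both polynomials; hence n divides e0 and v = z + r. *)
have [|] := dvdp_trace_norm two0 cop n0 (dvdp_mulr _ (dvdpp n)) (a := e0).
  by rewrite eS dvdp_mulr.
move=> /dvdpP[r er] _; rewrite {}er in eS {ev_v h0}.
have eS' : S = P + r ^+ 2 + r * Q.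
  by apply: (mulfI (expf_neq0 2 n0)); rewrite -eS; ring.
exists a, b, g, d, r; split=> //; last first.
  by rewrite -eS' /S scalerA mulfV ?scale1r // expf_neq0.
apply: (size_sqrD_mul_leq Q4); have -> : r ^+ 2 + r * Q = S + P by rewrite eS'; ring2 two0P.
by rewrite (leq_trans (size_polyD _ _)) // geq_max S7.
Qed.

End Isomorphism.

(** * Rational functions and Artin-Schreier extensions *)

Section FieldIdentities.
Variables (L : fieldType) (n d n' d' p q p' q' : L).
Hypotheses (d0 : d != 0) (d0' : d' != 0).

(** Here p, q, p', q' stand for the derivatives of n, d, n', d', and the second hypothesis is the
    first one differentiated: the quotient rule does not depend on the chosen fraction. *)
Lemma quotient_rule_eq :
  n * d' = n' * d -> p * d' + n * q' = p' * d + n' * q ->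
  (p' * d' - n' * q') / d' ^+ 2 = (p * d - n * q) / d ^+ 2.
Proof.
move=> e de; apply: (mulIf (mulf_neq0 (expf_neq0 2 d0) (expf_neq0 2 d0'))).
transitivity ((p' * d' - n' * q') * d ^+ 2); first by field; rewrite d0'.
transitivity ((p * d - n * q) * d' ^+ 2); last by field; rewrite d0.
transitivity (d * d' * (p * d' + n * q') - (d * q' + d' * q) * (n * d')); last by ring.
by rewrite de e; ring.
Qed.

Lemma quotientD : n / d + n' / d' = (n * d' + n' * d) / (d * d').
Proof. by field; rewrite d0 d0'. Qed.

Lemma quotientB : n / d - n' / d' = (n * d' - n' * d) / (d * d').
Proof. by field; rewrite d0 d0'. Qed.

Lemma quotientM : n / d * (n' / d') = (n * n') / (d * d').
Proof. by field; rewrite d0 d0'. Qed.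

Lemma quotient_ruleD :
  ((p * d' + n * q' + (p' * d + n' * q)) * (d * d')
    - (n * d' + n' * d) * (q * d' + d * q')) / (d * d') ^+ 2 =
  (p * d - n * q) / d ^+ 2 + (p' * d' - n' * q') / d' ^+ 2.
Proof. by field; rewrite d0 d0'. Qed.

Lemma quotient_ruleM :
  ((p * n' + n * p') * (d * d') - n * n' * (q * d' + d * q')) / (d * d') ^+ 2 =
  (p * d - n * q) / d ^+ 2 * (n' / d') + n / d * ((p' * d' - n' * q') / d' ^+ 2).
Proof. by field; rewrite d0 d0'. Qed.

End FieldIdentities.

Lemma fracP (R : idomainType) (f : {fraction R}) : exists nd : R * R,
  nd.2 != 0 /\ f = FracField.tofrac nd.1 / FracField.tofrac nd.2.
Proof.
elim/quotW: f => r; have d0 : r.2 != 0 := denom_ratioP r.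
exists (frac r); split => //=.
have d0F : FracField.tofrac r.2 != 0 by rewrite tofrac_eq0.
apply: (mulIf d0F); rewrite mulfVK //.
rewrite [FracField.tofrac r.1]piE [FracField.tofrac r.2]piE -[LHS]FracField.pi_mul.
apply/eqmodP; rewrite /= FracField.equivfE /FracField.mulf.
by rewrite !numden_Ratio ?mulf_neq0 ?oner_eq0 // !mulr1 mulrC.
Qed.

(* [F] is k(x), seen abstractly in order to block the unfolding of {fraction _}. *)
Section RationalFunctions.
Variables (k F : fieldType) (tofrac : {rmorphism {poly k} -> F}).
Hypothesis tofrac_neq0 : forall p, p != 0 -> tofrac p != 0.
Hypothesis tofrac_surj : forall f : F, exists nd : {poly k} * {poly k},
  nd.2 != 0 /\ f = tofrac nd.1 / tofrac nd.2.
Implicit Types f g : F.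

Lemma tofrac_inj : injective tofrac.
Proof.
move=> p q e; apply/eqP; rewrite -subr_eq0; apply: contraT => /tofrac_neq0.
by rewrite rmorphB e subrr eqxx.
Qed.

Lemma frac_eq n d n' d' : d != 0 -> d' != 0 ->
  tofrac n / tofrac d = tofrac n' / tofrac d' -> n * d' = n' * d :> {poly k}.
Proof.
move=> d0 d0' e; apply: tofrac_inj; rewrite !rmorphM.
by apply/eqP; rewrite -eqr_div ?tofrac_neq0 // e.
Qed.

Definition numden f : {poly k} * {poly k} := projT1 (cid (tofrac_surj f)).

Lemma numden_neq0 f : (numden f).2 != 0.
Proof. by rewrite /numden; case: cid => nd []. Qed.

Lemma numdenE f : f = tofrac (numden f).1 / tofrac (numden f).2.
Proof. by rewrite /numden; case: (cid (tofrac_surj f)) => nd []. Qed.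

Definition ratderiv f : F :=
  let: (n, d) := numden f in
  (tofrac n^`() * tofrac d - tofrac n * tofrac d^`()) / tofrac d ^+ 2.

Lemma ratderivE n d : d != 0 -> ratderiv (tofrac n / tofrac d) =
  (tofrac n^`() * tofrac d - tofrac n * tofrac d^`()) / tofrac d ^+ 2.
Proof.
move=> d0; set f := _ / _; have := numdenE f; have := numden_neq0 f.
rewrite /ratderiv; case: (numden f) => n' d' /= d0' fE.
have e : n * d' = n' * d.
  exact: (frac_eq d0 d0' fE).
have e' : tofrac n * tofrac d' = tofrac n' * tofrac d by rewrite -!rmorphM e.
have := congr1 (fun p : {poly k} => tofrac p^`()) e.
rewrite !derivM !rmorphD !rmorphM /= => de.
exact: (quotient_rule_eq (tofrac_neq0 d0) (tofrac_neq0 d0') e' de).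
Qed.

Lemma ratderiv_tofrac p : ratderiv (tofrac p) = tofrac p^`().
Proof.
rewrite -[X in ratderiv X]divr1 -(rmorph1 tofrac) ratderivE ?oner_neq0 //.
by rewrite derivC !rmorph0 !rmorph1 mulr0 subr0 mulr1 expr1n divr1.
Qed.

Lemma ratderivD f g : ratderiv (f + g) = ratderiv f + ratderiv g.
Proof.
rewrite [f]numdenE [g]numdenE; have := numden_neq0 f; have := numden_neq0 g.
case: (numden f) => a b; case: (numden g) => n d; rewrite [_.1]/= [_.2]/= => d0 b0.
rewrite quotientD ?tofrac_neq0 // -!rmorphM -rmorphD !ratderivE ?mulf_neq0 //.
by rewrite derivD !derivM !(rmorphD, rmorphM) quotient_ruleD ?tofrac_neq0.
Qed.

Lemma ratderivM f g : ratderiv (f * g) = ratderiv f * g + f * ratderiv g.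
Proof.
rewrite [f]numdenE [g]numdenE; have := numden_neq0 f; have := numden_neq0 g.
case: (numden f) => a b; case: (numden g) => n d; rewrite [_.1]/= [_.2]/= => d0 b0.
rewrite quotientM ?tofrac_neq0 // -!rmorphM !ratderivE ?mulf_neq0 //.
by rewrite !derivM !(rmorphD, rmorphM) quotient_ruleM ?tofrac_neq0.
Qed.

Section Extension.
Variables (L : fieldType) (g : {rmorphism {poly k} -> L}).
Hypothesis g_neq0 : forall p, p != 0 -> g p != 0.

Definition frac_ext f : L := let: (n, d) := numden f in g n / g d.

Lemma frac_extE n d : d != 0 -> frac_ext (tofrac n / tofrac d) = g n / g d.
Proof.
move=> d0; set f := _ / _; have := numdenE f; have := numden_neq0 f.
rewrite /frac_ext; case: (numden f) => n' d' /= d0' fE.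
have gd0 := g_neq0 d0; have gd0' := g_neq0 d0'.
have e : n * d' = n' * d.
  exact: (frac_eq d0 d0' fE).
apply: (mulIf (mulf_neq0 gd0 gd0')); transitivity (g n' * g d).
  by field; rewrite gd0'.
by rewrite -rmorphM -e rmorphM; field; rewrite gd0.
Qed.

Lemma frac_ext_tofrac p : frac_ext (tofrac p) = g p.
Proof.
by rewrite -[X in frac_ext X]divr1 -(rmorph1 tofrac) frac_extE ?oner_neq0 // rmorph1 divr1.
Qed.

Lemma frac_ext_zmod : zmod_morphism frac_ext.
Proof.
move=> f h; rewrite [f]numdenE [h]numdenE.
have := numden_neq0 f; have := numden_neq0 h.
case: (numden f) => a b; case: (numden h) => n d; rewrite [_.1]/= [_.2]/= => d0 b0.
rewrite quotientB ?tofrac_neq0 // -!rmorphM -rmorphB !frac_extE ?mulf_neq0 //.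
by rewrite rmorphB !rmorphM quotientB ?g_neq0.
Qed.

Lemma frac_ext_monoid : monoid_morphism frac_ext.
Proof.
split; first by rewrite -(rmorph1 tofrac) frac_ext_tofrac rmorph1.
move=> f h; rewrite [f]numdenE [h]numdenE.
have := numden_neq0 f; have := numden_neq0 h.
case: (numden f) => a b; case: (numden h) => n d; rewrite [_.1]/= [_.2]/= => d0 b0.
rewrite quotientM ?tofrac_neq0 // -!rmorphM !frac_extE ?mulf_neq0 //.
by rewrite !rmorphM quotientM ?g_neq0.
Qed.

Definition frac_ext_morph : {rmorphism F -> L} :=
  HB.pack frac_ext (GRing.isZmodMorphism.Build _ _ frac_ext frac_ext_zmod)
    (GRing.isMonoidMorphism.Build _ _ frac_ext frac_ext_monoid).

End Extension.

Definition cF : {rmorphism k -> F} := GRing.RMorphism.clone _ _ (tofrac \o polyC) _.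

Lemma ev_ratX p : ev cF (tofrac 'X) p = tofrac p.
Proof.
elim/poly_ind: p => [|p a IH]; first by rewrite !rmorph0.
by rewrite !rmorphD !rmorphM /= IH evX evC.
Qed.

Section Moebius.
Variables (a b g d : k).
Hypothesis det0 : a * d - b * g != 0.
Local Notation x := (tofrac 'X).
Definition moebius_den : F := cF g * x + cF d.
Definition moebius_var : F := (cF a * x + cF b) / moebius_den.

Lemma lin_neq0 (s t : k) : (s != 0) || (t != 0) -> cF s * x + cF t != 0.
Proof.
rewrite -[x](evX cF) -(evC cF x s) -(evC cF x t) -rmorphM -rmorphD /= ev_ratX.
move=> st0; apply: tofrac_neq0; move: st0; rewrite mul_polyC.
apply: contraTneq => /polyP e.
have := e 1%N; have := e 0%N; rewrite !coefE /= !mulr0 !mulr1 add0r addr0.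
by move=> -> ->; rewrite eqxx.
Qed.

Lemma moebius_den_neq0 : moebius_den != 0.
Proof.
apply: lin_neq0; apply: contraNT det0; rewrite negb_or !negbK.
by move=> /andP[/eqP -> /eqP ->]; rewrite !mulr0 subrr.
Qed.

(** m(x) is transcendental over k: otherwise x, which is the inverse Moebius map applied to m(x),
    would be algebraic. *)
Lemma ev_moebius_neq0 p : p != 0 -> ev cF moebius_var p != 0.
Proof.
move=> p0; apply/eqP => ep; have l0 := moebius_den_neq0.
have Xalg : algebraicOver cF moebius_var.
  by exists p => //; apply/eqP; exact: ep.
have l'0 : cF (- g) * moebius_var + cF a != 0.
  have -> : cF (- g) * moebius_var + cF a = cF (a * d - b * g) / moebius_den.
    rewrite /moebius_var rmorphB rmorphN !rmorphM /=.
    by apply: (mulIf l0); rewrite [RHS]mulfVK // mulrDl mulrA mulfVK // /moebius_den; ring.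
  by rewrite mulf_neq0 ?invr_eq0 // fmorph_eq0.
have xE : x = (cF d * moebius_var + cF (- b)) / (cF (- g) * moebius_var + cF a).
  apply: (mulIf l'0); rewrite [RHS]mulfVK //; apply: (mulIf l0).
  rewrite [RHS]mulrDl.
  have -> : x * (cF (- g) * moebius_var + cF a) * moebius_den =
    x * (cF (- g) * (moebius_var * moebius_den) + cF a * moebius_den) by ring.
  have -> : cF d * moebius_var * moebius_den = cF d * (moebius_var * moebius_den) by ring.
  by rewrite /moebius_var mulfVK // /moebius_den; ring.
have [q q0 rq] : algebraicOver cF x.
  rewrite xE; apply: algebraic_div; apply: algebraic_add; try exact: algebraic_id;
  by apply: algebraic_mul => //; exact: algebraic_id.
move/eqP: rq; rewrite -[_.[x]]/(ev cF x q) ev_ratX.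
by apply/eqP; exact: tofrac_neq0.
Qed.

Definition moebius : {rmorphism F -> F} := frac_ext_morph ev_moebius_neq0.

Lemma moebius_tofrac p : moebius (tofrac p) = ev cF moebius_var p.
Proof. exact: (frac_ext_tofrac ev_moebius_neq0). Qed.

Lemma moebiusX : moebius x = moebius_var.
Proof. by rewrite moebius_tofrac evX. Qed.

Lemma moebiusC t : moebius (cF t) = cF t.
Proof. by rewrite moebius_tofrac evC. Qed.

End Moebius.

Lemma rmorph_frac_eq (L : fieldType) (m1 m2 : {rmorphism F -> L}) :
  (forall t, m1 (cF t) = m2 (cF t)) -> m1 (tofrac 'X) = m2 (tofrac 'X) -> m1 =1 m2.
Proof.
move=> ec ex f; rewrite [f]numdenE !fmorph_div.
suff e p : m1 (tofrac p) = m2 (tofrac p) by rewrite !e.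
elim/poly_ind: p => [|p t IH]; first by rewrite !rmorph0.
rewrite !(rmorphD, rmorphM) /= IH; congr (_ * _ + _); [exact: ex|exact: ec].
Qed.

End RationalFunctions.

(** F[y]/(y^2 + y - u) up to isomorphism in characteristic two: free over F with basis 1, y. [K] is
    a ring here, as being a field depends on u; see [as_ext_unit]. *)
Definition as_ext (F : fieldType) (K : comNzRingType) (phi : {rmorphism F -> K})
    (y : K) (u : F) :=
  [/\ y ^+ 2 = y + phi u,
      forall f, exists ab, f = phi ab.1 + phi ab.2 * y
    & forall a b, phi a + phi b * y = 0 -> a = 0 /\ b = 0].

Section ArtinSchreierExtension.
Variables (F : fieldType) (two0 : 2 = 0 :> F).
Variables (K : comNzRingType) (phi : {rmorphism F -> K}) (y : K) (u : F).
Hypothesis ext : as_ext phi y u.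

Let yE : y ^+ 2 = y + phi u. Proof. by case: ext. Qed.
Let surj f : exists ab, f = phi ab.1 + phi ab.2 * y.
Proof. by case: ext => _ + _; apply. Qed.
Let two0K : 2 = 0 :> K. Proof. by rewrite -(rmorph_nat phi) two0 rmorph0. Qed.

Definition coord f : F * F := projT1 (cid (surj f)).

Lemma coordE f : f = phi (coord f).1 + phi (coord f).2 * y.
Proof. by rewrite /coord; case: (cid (surj f)). Qed.

Lemma coord_uniq a b : coord (phi a + phi b * y) = (a, b).
Proof.
have [_ _ free] := ext; have := coordE (phi a + phi b * y).
case: (coord _) => a' b' /= /eqP; rewrite -subr_eq0 => /eqP e.
have [|e1 e2] := free (a - a') (b - b').
  by rewrite !rmorphB -[RHS]e; ring.
by move/eqP: e1 e2; rewrite subr_eq0 => /eqP <- /eqP; rewrite subr_eq0 => /eqP <-.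
Qed.

(** The conjugate of a + b y is a + b + b y, and their product is the norm N. If N = 0 with b
    nonzero, then u = w^2 + w for w = a/b; otherwise the conjugate divided by N is the inverse. *)
Lemma as_ext_unit : (forall w, u <> w ^+ 2 + w) ->
  forall f : K, f != 0 -> exists g, f * g = 1.
Proof.
move=> uN f f0; have := coordE f; case: (coord f) => a b /= fE.
pose N := a ^+ 2 + a * b + b ^+ 2 * u.
have N0 : N != 0.
  have [b0|b0] := eqVneq b 0.
    rewrite /N b0 mulr0 expr0n mul0r !addr0 expf_neq0 //.
    by apply: contraNneq f0 => a0; rewrite fE a0 b0 !rmorph0 mul0r addr0.
  apply/eqP => e; apply: (uN (a / b)).
  apply: (mulfI (expf_neq0 2 b0)); transitivity (a ^+ 2 + a * b); last by field.
  by apply: subr0_eq; rewrite -[RHS]e /N; ring2 two0.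
exists (phi N^-1 * (phi (a + b) + phi b * y)).
have -> : f * (phi N^-1 * (phi (a + b) + phi b * y)) = phi N^-1 * phi N.
  by rewrite fE /N; ring2_mod two0K yE.
by rewrite -rmorphM mulVf // rmorph1.
Qed.

(** Differentiating y^2 = y + u leaves 0 = D y + delta u in characteristic two, which forces D y =
    delta u. *)
Lemma as_ext_derivation (delta : F -> F) :
  (forall a b, delta (a + b) = delta a + delta b) ->
  (forall a b, delta (a * b) = delta a * b + a * delta b) ->
  exists D : K -> K, [/\ forall f g, D (f + g) = D f + D g,
    forall f g, D (f * g) = D f * g + f * D g & forall a, D (phi a) = phi (delta a)].
Proof.
move=> dD dM.
pose D f := phi (delta (coord f).1) + phi (delta (coord f).2) * y
  + phi ((coord f).2 * delta u).
have DE a b : D (phi a + phi b * y) =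
  phi (delta a) + phi (delta b) * y + phi b * phi (delta u).
  by rewrite /D coord_uniq /= rmorphM.
have d0 : delta 0 = 0.
  by apply: (addrI (delta 0)); rewrite -dD !addr0.
exists D; split=> [f g|f g|a].
- rewrite [f]coordE [g]coordE; case: (coord f) => a b; case: (coord g) => a' b' /=.
  have -> : phi a + phi b * y + (phi a' + phi b' * y) =
    phi (a + a') + phi (b + b') * y by rewrite !rmorphD; ring.
  by rewrite !DE !dD !rmorphD /=; ring.
- rewrite [f]coordE [g]coordE; case: (coord f) => a b; case: (coord g) => a' b' /=.
  have -> : (phi a + phi b * y) * (phi a' + phi b' * y) =
    phi (a * a' + b * b' * u) + phi (a * b' + b * a' + b * b') * y.
    by ring2_mod two0K yE.
  rewrite !DE !dD !dM !(rmorphD, rmorphM) /=.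
  by ring2_mod two0K yE.
- have {1}-> : phi a = phi a + phi 0 * y by rewrite rmorph0 mul0r addr0.
  by rewrite DE d0 !rmorph0 !mul0r !addr0.
Qed.

End ArtinSchreierExtension.

Section ArtinSchreierMorphism.
Variables (F : fieldType) (two0 : 2 = 0 :> F).
Variables (K1 K2 : comNzRingType) (phi1 : {rmorphism F -> K1}) (phi2 : {rmorphism F -> K2}).
Variables (y1 : K1) (y2 : K2) (v u : F).
Hypotheses (ext1 : as_ext phi1 y1 v) (ext2 : as_ext phi2 y2 u).
Variables (m : {rmorphism F -> F}) (w : F).
Hypotheses (m_surj : forall a, exists b, m b = a) (mv : m v = u + w ^+ 2 + w).

Let two0K : 2 = 0 :> K2. Proof. by rewrite -(rmorph_nat phi2) two0 rmorph0. Qed.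

(** The extension of m with y1 -> y2 + w. It respects products since (y2 + w)^2 = (y2 + w) + (u +
    w^2 + w), and the last bracket is m v. *)
Definition as_ext_map (f : K1) : K2 :=
  phi2 (m (coord ext1 f).1) + phi2 (m (coord ext1 f).2) * (y2 + phi2 w).

Let thE a b : as_ext_map (phi1 a + phi1 b * y1) =
  phi2 (m a) + phi2 (m b) * (y2 + phi2 w).
Proof. by rewrite /as_ext_map coord_uniq. Qed.

Lemma as_ext_map_zmod : zmod_morphism as_ext_map.
Proof.
move=> f g; rewrite [f](coordE ext1) [g](coordE ext1).
case: (coord _ f) => a b; case: (coord _ g) => a' b' /=.
have -> : phi1 a + phi1 b * y1 - (phi1 a' + phi1 b' * y1) =
  phi1 (a - a') + phi1 (b - b') * y1 by rewrite !rmorphB; ring.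
by rewrite !thE !rmorphB /=; ring.
Qed.

Lemma as_ext_map_monoid : monoid_morphism as_ext_map.
Proof.
have [y1E _ _] := ext1; have [y2E _ _] := ext2; split.
  have -> : 1 = phi1 1 + phi1 0 * y1 by rewrite rmorph1 rmorph0 mul0r addr0.
  by rewrite thE !rmorph0 !rmorph1 mul0r addr0.
move=> f g; rewrite [f](coordE ext1) [g](coordE ext1).
case: (coord _ f) => a b; case: (coord _ g) => a' b' /=.
have -> : (phi1 a + phi1 b * y1) * (phi1 a' + phi1 b' * y1) =
  phi1 (a * a' + b * b' * v) + phi1 (a * b' + b * a' + b * b') * y1.
  by ring: y1E.
rewrite !thE !(rmorphD, rmorphM) /= mv !(rmorphXn, rmorphD, rmorphM) /=.
by ring2_mod two0K y2E.
Qed.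

Definition as_ext_morph : {rmorphism K1 -> K2} :=
  HB.pack as_ext_map (GRing.isZmodMorphism.Build _ _ as_ext_map as_ext_map_zmod)
    (GRing.isMonoidMorphism.Build _ _ as_ext_map as_ext_map_monoid).

Lemma as_ext_morphE a : as_ext_morph (phi1 a) = phi2 (m a).
Proof.
have {1}-> : phi1 a = phi1 a + phi1 0 * y1 by rewrite rmorph0 mul0r addr0.
by rewrite /= thE !rmorph0 mul0r addr0.
Qed.

Lemma as_ext_morph_bij : exists g, cancel as_ext_morph g /\ cancel g as_ext_morph.
Proof.
have inj : injective as_ext_morph.
  move=> f g /eqP; rewrite -subr_eq0 -rmorphB /= => /eqP e.
  apply/eqP; rewrite -subr_eq0; apply/eqP; move: (f - g) e => {f g} f.
  rewrite [f](coordE ext1); case: (coord _ f) => a b /=; rewrite thE => e.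
  have [_ _ free] := ext2; have [|e1 e2] := free (m a + m b * w) (m b).
    by rewrite -[RHS]e rmorphD rmorphM /=; ring.
  move/eqP: e2; rewrite fmorph_eq0 => /eqP b0; move/eqP: e1.
  rewrite b0 rmorph0 mul0r addr0 fmorph_eq0 => /eqP ->.
  by rewrite !rmorph0 mul0r addr0.
have surj f : exists g, as_ext_morph g = f.
  rewrite [f](coordE ext2); case: (coord _ f) => a b /=.
  have [b' <-] := m_surj b; have [a' ea] := m_surj (a - m b' * w).
  exists (phi1 a' + phi1 b' * y1); rewrite /= thE ea rmorphB rmorphM /=; ring.
have [g gK] := choice surj; exists g; split=> // f.
by apply: inj; rewrite gK.
Qed.

End ArtinSchreierMorphism.

(** * The function field as an Artin-Schreier extension *)

Section FunctionField.
Variables (F : fieldType) (u : F).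
Local Notation h := ('X^2 + 'X - u%:P : {poly F}).
Local Notation K := {poly %/ h}.

Lemma as_poly_size : size h = 3.
Proof.
have e : (size ('X - u%:P)%R < size ('X^2 : {poly F})%R)%N.
  by rewrite size_XsubC size_polyXn.
by rewrite -addrA size_polyDl // size_polyXn.
Qed.

Lemma as_poly_monic : h \is monic.
Proof.
have e : (size ('X - u%:P)%R < size ('X^2 : {poly F})%R)%N.
  by rewrite size_XsubC size_polyXn.
by rewrite monicE -addrA lead_coefDl // lead_coefXn.
Qed.

Lemma as_poly_mk_monic : mk_monic h = h.
Proof. by rewrite /mk_monic as_poly_size as_poly_monic. Qed.

Lemma function_field_as_ext : 2 = 0 :> F ->
  as_ext (qpolyC h : {rmorphism F -> K}) (in_qpoly h 'X) u.
Proof.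
move=> two0; have hC a : qpolyC h a = in_qpoly h a%:P.
  apply: val_inj => /=; rewrite -[RHS]/(polyn (in_qpoly h a%:P)).
  by rewrite in_qpoly_small // as_poly_mk_monic as_poly_size size_polyC; case: eqP.
have hE a b : qpolyC h a + qpolyC h b * in_qpoly h 'X =
   in_qpoly h (a%:P + b%:P * 'X).
  by rewrite !hC rmorphD rmorphM.
have lin_size (a b : F) : (size (a%:P + b%:P * 'X)%R < 3)%N.
  rewrite ltnS (leq_trans (size_polyD _ _)) // geq_max mul_polyC.
  rewrite (leq_trans (size_polyC_leq1 _)) //.
  by rewrite (leq_trans (size_scale_leq _ _)) // size_polyX.
split.
- have : in_qpoly h h = 0.
    by apply: val_inj; rewrite /= as_poly_mk_monic Pdiv.RingMonic.rmodpp // as_poly_monic.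
  rewrite !(rmorphB, rmorphD, rmorphXn) /= -hC => e.
  have two0K : 2 = 0 :> K.
    by rewrite -(rmorph_nat (qpolyC h : {rmorphism F -> K})) two0 rmorph0.
  by apply: subr0_eq; rewrite -[RHS]e; ring2 two0K.
- move=> f; exists ((f : {poly F})`_0, (f : {poly F})`_1); rewrite hE /=.
  have fs : (size (f : {poly F}) < 3)%N.
    by rewrite (leq_trans (size_mk_monic f)) // as_poly_mk_monic as_poly_size.
  have -> : ((f : {poly F})`_0)%:P + ((f : {poly F})`_1)%:P * 'X = f.
    apply/polyP => -[|[|j]]; rewrite coefD coefC coefMX coefC /= ?addr0 ?add0r //.
    by rewrite nth_default //; apply: (@leq_trans 2).
  exact/val_inj/esym/in_qpoly_small/size_mk_monic.
- move=> a b; rewrite hE => /(congr1 (fun q : K => (q : {poly F}))).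
  rewrite in_qpoly_small ?as_poly_mk_monic ?as_poly_size // -[RHS]/(0 : {poly F}) => /polyP e.
  have := e 0%N; have := e 1%N; rewrite !coefD !coefC !coefMX !coefC /= addr0 add0r.
  by move=> -> ->.
Qed.

End FunctionField.

(** * Smooth models and isomorphisms of their function fields *)

Section SmoothModel.
Variables (k F : fieldType) (tofrac : {rmorphism {poly k} -> F}).
Hypothesis tofrac_neq0 : forall p, p != 0 -> tofrac p != 0.
Hypothesis tofrac_surj : forall f : F, exists nd : {poly k} * {poly k},
  nd.2 != 0 /\ f = tofrac nd.1 / tofrac nd.2.
Variable two0 : 2 = 0 :> k.
Let two0P : 2 = 0 :> {poly k}. Proof. exact: char2_poly. Qed.
Let two0F : 2 = 0 :> F. Proof. by rewrite -(rmorph_nat tofrac) two0P rmorph0. Qed.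
Local Notation rev N p := (hsub N (swap k) p).
Local Notation c := (cF tofrac).

Lemma hsubD N M (p q : {poly k}) : hsub N M (p + q) = hsub N M p + hsub N M q.
Proof.
case: M => [[[a b] g] d]; rewrite /hsub -big_split; apply: eq_bigr => j _.
by rewrite coefD scalerDl.
Qed.

Lemma hsubZ N M t (p : {poly k}) : hsub N M (t *: p) = t *: hsub N M p.
Proof.
case: M => [[[a b] g] d]; rewrite /hsub scaler_sumr; apply: eq_bigr => j _.
by rewrite coefZ scalerA.
Qed.

(** In k(x) the transform of p in degree N is l^N p(m(x)), with l = g x + d nonzero, and this
    expression is visibly multiplicative. *)
Lemma hsubM N N' a b g d (p q : {poly k}) : (g != 0) || (d != 0) ->
  (size p <= N.+1)%N -> (size q <= N'.+1)%N ->
  hsub (N + N') (a, b, g, d) (p * q) = hsub N (a, b, g, d) p * hsub N' (a, b, g, d) q.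
Proof.
move=> gd pN qN; apply: (tofrac_inj tofrac_neq0); rewrite rmorphM.
have l0 := lin_neq0 tofrac_neq0 gd.
have pqN : (size (p * q)%R <= (N + N').+1)%N.
  by rewrite (leq_trans (size_polyMleq _ _)) //; move: (size p) (size q) pN qN; lia.
have evh n (r : {poly k}) : (size r <= n.+1)%N ->
    tofrac (hsub n (a, b, g, d) r) = moebius_den tofrac g d ^+ n *
      ev c (moebius_var tofrac a b g d) r.
  by move=> rn; rewrite -{1}ev_ratX ev_hsub.
by rewrite !evh // rmorphM exprD; ring.
Qed.

Lemma hsub_swapM N N' (p q : {poly k}) :
  (size p <= N.+1)%N -> (size q <= N'.+1)%N ->
  rev (N + N') (p * q) = rev N p * rev N' q.
Proof. by apply: hsubM; rewrite oner_neq0. Qed.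

(** The derivative of Q^2 vanishes, so discr changes only by e Q^2 Q'^2, a multiple of Q; the same
    holds for the reversed polynomials. *)
Lemma smooth_model_twist (P Q : {poly k}) e : smooth_model P Q ->
  smooth_model (P + e *: Q ^+ 2) Q.
Proof.
have discrE (P' Q' : {poly k}) t : coprimep Q' (discr P' Q') ->
    coprimep Q' (discr (P' + t *: Q' ^+ 2) Q').
  have -> : discr (P' + t *: Q' ^+ 2) Q' = t *: (Q' * Q'^`() ^+ 2) * Q' + discr P' Q'.
    rewrite /discr derivD derivZ expr2 derivM.
    have -> : Q'^`() * Q' + Q' * Q'^`() = 0 by ring2 two0P.
    by rewrite scaler0 addr0 -!mul_polyC; ring.
  by rewrite coprimep_addl_mul.
move=> [Q0 Q4 P7 sm smI]; split=> //; last 2 first.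
- exact: discrE.
- have -> : rev 6 (P + e *: Q ^+ 2) = rev 6 P + e *: rev 3 Q ^+ 2.
    by rewrite hsubD hsubZ expr2 (@hsub_swapM 3 3).
  exact: discrE.
rewrite (leq_trans (size_polyD _ _)) // geq_max P7 (leq_trans (size_scale_leq _ _)) //.
by rewrite (leq_trans (size_poly_exp_leq _ _)) //; move: (size Q) Q4; lia.
Qed.

(** In this case the curve splits into z = r and z = r + Q, which meet where Q vanishes;
    algebraically, Q divides discr. *)
Lemma sqrDmul_not_coprime (P Q r : {poly k}) :
  coprimep Q (discr P Q) -> r ^+ 2 + r * Q = P -> size Q = 1.
Proof.
move=> cop e; have : Q %| discr P Q.
  have -> : discr P Q = Q * (r^`() ^+ 2 * Q + r * Q^`() ^+ 2).
    by rewrite /discr -e derivD expr2 !derivM; ring2 two0P.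
  exact: dvdp_mulr.
move=> QG; have : Q %| gcdp Q (discr P Q) by rewrite dvdp_gcd dvdpp.
by move: cop; rewrite -gcdp_eqp1 => /eqp_dvdr ->; rewrite dvdp1 => /eqP.
Qed.

(** If u = w^2 + w, normality makes w Q a polynomial r and the curve splits in both charts. Then Q
    and its reversal in degree 3 are both constant, but the reversal of a nonzero constant has
    degree 3. *)
Lemma smooth_model_not_AS (P Q : {poly k}) : smooth_model P Q ->
  forall w : F, tofrac P / tofrac Q ^+ 2 <> w ^+ 2 + w.
Proof.
move=> [Q0 Q4 P7 sm smI] w e; have [[n d] /= [d0 wE]] := tofrac_surj w.
have Qf := tofrac_neq0 Q0; have df := tofrac_neq0 d0.
pose a := Q * n.
have ae : a ^+ 2 + a * d * Q + d ^+ 2 * P = 0.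
  apply: (tofrac_inj tofrac_neq0); rewrite rmorph0.
  have Pe : tofrac P = tofrac Q ^+ 2 * (w ^+ 2 + w) by rewrite -e mulrC mulfVK // expf_neq0.
  have ne : tofrac n = w * tofrac d by rewrite wE mulfVK.
  rewrite /a !(rmorphXn, rmorphD, rmorphM) /= Pe ne; ring2 two0F.
have [|] := dvdp_trace_norm two0 sm d0 (dvdp_mulr _ (dvdpp d)) (a := a).
  by rewrite ae dvdp0.
move=> /dvdpP[r er] _; rewrite {}er in ae.
have {}ae : r ^+ 2 + r * Q = P.
  apply: (mulfI (expf_neq0 2 d0)); apply: subr0_eq; rewrite -[RHS]ae.
  by ring2 two0P.
have r4 : (size r <= 4)%N by apply: (size_sqrD_mul_leq Q4); rewrite ae.
have Q1 := sqrDmul_not_coprime sm ae.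
have aeI : rev 3 r ^+ 2 + rev 3 r * rev 3 Q = rev 6 P.
  by rewrite -ae hsubD expr2 !(@hsub_swapM 3 3).
have := sqrDmul_not_coprime smI aeI.
have /eqP/size_poly1P[q q0 ->] := Q1.
rewrite hsub_swap => /(congr1 (fun n => (3 < n)%N)) /=.
have -> : \poly_(j < 4) (q%:P)`_(3 - j) = q *: 'X^3.
  apply/polyP => j; rewrite coef_poly coefZ coefXn coefC.
  by case: j => [|[|[|[|j]]]] //=; rewrite ?mulr0 ?mulr1.
by rewrite size_scale // size_polyXn.
Qed.

Section Chart.
Variables (K : fieldType) (phi : {rmorphism F -> K}) (y : K) (P Q : {poly k}).
Hypotheses (sm : smooth_model P Q) (ext : as_ext phi y (tofrac P / tofrac Q ^+ 2)).

Definition cK : {rmorphism k -> K} := GRing.RMorphism.clone _ _ (phi \o c) _.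

Lemma ev_cK p : ev cK (phi (tofrac 'X)) p = phi (tofrac p).
Proof.
elim/poly_ind: p => [|p a IH]; first by rewrite !rmorph0.
by rewrite !rmorphD !rmorphM /= IH evX evC.
Qed.

Lemma as_ext_chart : chart cK P Q (phi (tofrac 'X)) (phi (tofrac Q) * y).
Proof.
have [Q0 _ _ cop _] := sm; have [yE surj free] := ext.
have Qf := tofrac_neq0 Q0.
split=> //.
- rewrite !ev_cK; set v := _ / _ in yE.
  have -> : tofrac P = tofrac Q ^+ 2 * v by rewrite mulrC mulfVK // expf_neq0.
  by ring: yE.
- move=> f; have [[a b] /= ->] := surj f.
  have [[n d] /= [d0 ->]] := tofrac_surj a; have [[n' d'] /= [d0' ->]] := tofrac_surj b.
  have df := tofrac_neq0 d0; have df' := tofrac_neq0 d0'.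
  exists (n * d' * Q), (n' * d), (d * d' * Q); rewrite !mulf_neq0 //; split=> //.
  have fd : phi (tofrac d) != 0 by rewrite fmorph_eq0.
  have fd' : phi (tofrac d') != 0 by rewrite fmorph_eq0.
  by rewrite !ev_cK !(rmorphM, fmorphV) /=; field; rewrite fd fd'.
- move=> a b; rewrite !ev_cK mulrA -rmorphM => /free[ea /eqP].
  rewrite mulf_eq0 (negPf Qf) orbF => /eqP eb.
  by split; apply: (tofrac_inj tofrac_neq0); rewrite rmorph0.
Qed.

Lemma as_ext_chart_derivation : exists D, derivation cK D /\ D (phi (tofrac 'X)) = 1.
Proof.
have [||D [DD DM Dphi]] := as_ext_derivation two0F ext (delta := ratderiv tofrac_surj).
- exact: (ratderivD tofrac_neq0).
- exact: (ratderivM tofrac_neq0).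
exists D; split; last by rewrite Dphi (ratderiv_tofrac tofrac_neq0) derivX !rmorph1.
split=> // a; rewrite Dphi /= (ratderiv_tofrac tofrac_neq0) derivC.
by rewrite !rmorph0.
Qed.

End Chart.

(** With u = P/Q^2, u' = P'/Q'^2 and w = r/Q, this is u'(m(x)) = u + w^2 + w cleared of
    denominators, together with the compatibility of m with the cubic forms. *)
Definition moebius_equiv (P Q P' Q' : {poly k}) := exists a b g d (r : {poly k}),
  [/\ a * d + b * g != 0, (size r <= 4)%N,
      hsub 3 (a, b, g, d) Q' = (a * d + b * g) *: Q
    & hsub 6 (a, b, g, d) P' = (a * d + b * g) ^+ 2 *: (P + r ^+ 2 + r * Q)].

Lemma isom_moebius_equiv (K K' : fieldType) (phi : {rmorphism F -> K}) y
    (phi' : {rmorphism F -> K'}) y' (P Q P' Q' : {poly k}) :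
  smooth_model P Q -> as_ext phi y (tofrac P / tofrac Q ^+ 2) ->
  smooth_model P' Q' -> as_ext phi' y' (tofrac P' / tofrac Q' ^+ 2) ->
  (exists th : {rmorphism K' -> K}, bijective th /\
    forall a, th (phi' (c a)) = phi (c a)) ->
  moebius_equiv P Q P' Q'.
Proof.
move=> sm ext sm' ext' [th [th_bij thc]].
have [D [derD Dx]] := as_ext_chart_derivation ext.
have [D' [derD' Dx']] := as_ext_chart_derivation ext'.
exact: (isom_criterion_necessary two0 sm (as_ext_chart sm ext) derD Dx sm'
  (as_ext_chart sm' ext') derD' Dx' th_bij thc).
Qed.

Lemma moebius_equiv_isom (K K' : comNzRingType) (phi : {rmorphism F -> K}) y
    (phi' : {rmorphism F -> K'}) y' (P Q P' Q' : {poly k}) :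
  smooth_model P Q -> as_ext phi y (tofrac P / tofrac Q ^+ 2) ->
  smooth_model P' Q' -> as_ext phi' y' (tofrac P' / tofrac Q' ^+ 2) ->
  moebius_equiv P Q P' Q' ->
  exists th : {rmorphism K' -> K}, bijective th /\
    forall a, th (phi' (c a)) = phi (c a).
Proof.
move=> [Q0 Q4 P7 _ _] ext [Q'0 Q'4 P'7 _ _] ext' [a [b [g [d [r [De0 _ eQ eP]]]]]].
have det0 : a * d - b * g != 0.
  by apply: contraNneq De0 => e; apply/eqP; rewrite -[RHS]e; ring2 two0.
pose m := moebius tofrac_neq0 tofrac_surj det0.
have mX : m (tofrac 'X) = moebius_var tofrac a b g d by apply: moebiusX.
have mC t : m (c t) = c t by apply: moebiusC.
have l0 : moebius_den tofrac g d != 0 by apply: (moebius_den_neq0 tofrac_neq0 det0).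
(* A preimage comes from the Moebius substitution of the adjugate matrix (d, -b, -g, a). *)
have m_surj f : exists h, m h = f.
  have det0' : d * a - (- b) * (- g) != 0.
    by have -> : d * a - (- b) * (- g) = a * d - b * g by ring.
  pose m' := moebius tofrac_neq0 tofrac_surj det0'.
  exists (m' f).
  apply: (rmorph_frac_eq tofrac_surj (m1 := GRing.RMorphism.clone _ _ (m \o m') _)
    (m2 := GRing.RMorphism.clone _ _ idfun _)) => [t|].
    by rewrite -[LHS]/(m (m' (c t))) -[RHS]/(c t) /m' moebiusC mC.
  rewrite -[LHS]/(m (m' (tofrac 'X))) -[RHS]/(tofrac 'X) /m' moebiusX /moebius_var /moebius_den fmorph_div !(rmorphD, rmorphM) !mC mX.
  have cD0 : c a * c d - c b * c g != 0 by rewrite -!rmorphM -rmorphB fmorph_eq0.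
  move: l0; rewrite /moebius_var /moebius_den !rmorphN.
  move: (tofrac 'X) (c a) (c b) (c g) (c d) cD0 => x A B G D cD0 l0.
  field.
  rewrite l0 /=.
  have -> : (- G * (A * x + B) + A * (G * x + D)) = A * D - B * G by ring.
  by [].
have De0F : c (a * d + b * g) != 0 by rewrite fmorph_eq0.
have Qf := tofrac_neq0 Q0; have Qf' := tofrac_neq0 Q'0.
pose w := tofrac r / tofrac Q.
have mP N (p : {poly k}) : (size p <= N.+1)%N ->
    tofrac (hsub N (a, b, g, d) p) = moebius_den tofrac g d ^+ N * m (tofrac p).
  move=> pN; rewrite /m (moebius_tofrac tofrac_neq0 tofrac_surj) -{1}ev_ratX.
  by rewrite ev_hsub.
have mv : m (tofrac P' / tofrac Q' ^+ 2) = tofrac P / tofrac Q ^+ 2 + w ^+ 2 + w.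
  have l6 := expf_neq0 6 l0; have l3 := expf_neq0 3 l0.
  have -> : m (tofrac P' / tofrac Q' ^+ 2) =
     tofrac (hsub 6 (a, b, g, d) P') / tofrac (hsub 3 (a, b, g, d) Q') ^+ 2.
    have mQ0 : m (tofrac Q') != 0 by rewrite fmorph_eq0.
    by rewrite (mP 6%N) // (mP 3%N) // fmorph_div rmorphXn /=; field; rewrite ?l0 ?mQ0.
  rewrite eP eQ; move: (a * d + b * g) De0F => De De0F; rewrite -!mul_polyC /w.
  have -> : tofrac ((De ^+ 2)%:P * (P + r ^+ 2 + r * Q)) =
      c De ^+ 2 * (tofrac P + tofrac r ^+ 2 + tofrac r * tofrac Q).
    by rewrite !(rmorphXn, rmorphD, rmorphM).
  have -> : tofrac (De%:P * Q) = c De * tofrac Q by rewrite rmorphM.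
  by field; rewrite Qf De0F.
exists (as_ext_morph two0F ext' ext mv); split.
  by have [h [h1 h2]] := as_ext_morph_bij two0F ext' ext m_surj mv; exists h.
by move=> t; rewrite as_ext_morphE mC.
Qed.

End SmoothModel.

(** * The isomorphism criterion for curves *)

Section Criterion.
Variables (k : fieldType) (two0 : 2 = 0 :> k).
Local Notation F := (ratfun k).

Definition ratfrac : {rmorphism {poly k} -> F} :=
  GRing.RMorphism.clone _ _ (@FracField.tofrac {poly k}) _.

Lemma ratfrac_neq0 p : p != 0 -> ratfrac p != 0.
Proof. by rewrite /= tofrac_eq0. Qed.

Lemma ratfrac_surj (f : F) : exists nd : {poly k} * {poly k},
  nd.2 != 0 /\ f = ratfrac nd.1 / ratfrac nd.2.
Proof. exact: fracP. Qed.

Lemma two0_ratfun : 2 = 0 :> F.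
Proof. by rewrite -(rmorph_nat ratfrac) (char2_poly two0) rmorph0. Qed.

Definition ff_embed (u : F) : {rmorphism F -> function_field u} :=
  GRing.RMorphism.clone _ _ (qpolyC ('X^2 + 'X - u%:P)) _.

Lemma ff_ext (u : F) : as_ext (ff_embed u) (in_qpoly _ 'X) u.
Proof. exact: function_field_as_ext two0_ratfun. Qed.

(** [closed_point] only speaks of the ring structure and the constants, so [place_image] carries it
    along any isomorphism over k. *)
Lemma curve_isom_exists (u v : F) :
  curve_isom u v <-> exists th : {rmorphism function_field v -> function_field u},
    bijective th /\ forall c, th (ff_embed v (cF ratfrac c)) = ff_embed u (cF ratfrac c).
Proof.
split.
  by move=> [th [bij thc _]]; exists th; split; [exact: bij|exact: thc].
move=> [th [bij thc]]; exists th; split; [exact: bij|exact: thc|move=> O].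
exact: (@place_image k _ _ (ff_embed v \o cF ratfrac) (ff_embed u \o cF ratfrac) th O bij thc).
Qed.

Section Field.
Variables (u : F) (uN : forall w, u <> w ^+ 2 + w).

Lemma ff_unit (f : function_field u) : f != 0 -> f \is a GRing.unit.
Proof.
move=> /(as_ext_unit two0_ratfun (ff_ext u) uN)[g fg].
by apply/unitrPr; exists g.
Qed.

(** The field structure is put on the same underlying ring, so the ring morphisms of [curve_isom]
    are directly morphisms between these fields. *)
Definition ff_field : fieldType :=
  HB.pack (function_field u)
    (GRing.ComUnitRing_isField.Build (function_field u) ff_unit).

End Field.

Lemma curve_isom_criterion (P Q P' Q' : {poly k}) :
  smooth_model P Q -> smooth_model P' Q' ->
  curve_isom (ratfrac P / ratfrac Q ^+ 2) (ratfrac P' / ratfrac Q' ^+ 2) <->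
  moebius_equiv P Q P' Q'.
Proof.
move=> sm sm'; rewrite curve_isom_exists.
have uN := smooth_model_not_AS ratfrac_neq0 ratfrac_surj two0 sm.
have vN := smooth_model_not_AS ratfrac_neq0 ratfrac_surj two0 sm'.
split.
- move=> H.
  exact: (@isom_moebius_equiv k F ratfrac ratfrac_neq0 ratfrac_surj two0
   (ff_field uN) (ff_field vN) (ff_embed _) _ (ff_embed _) _ P Q P' Q' sm (ff_ext _) sm' (ff_ext _) H).
- move=> H.
  exact: (@moebius_equiv_isom k F ratfrac ratfrac_neq0 ratfrac_surj two0
   (function_field _) (function_field _) (ff_embed _) _ (ff_embed _) _ P Q P' Q' sm (ff_ext _) sm' (ff_ext _) H).
Qed.

End Criterion.

(** * The rational models *)

Section SmoothCriterion.
Variables (k : fieldType) (two0 : 2 = 0 :> k).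
Implicit Types p q P Q W r : {poly k}.
Local Notation rev N p := (hsub N (swap k) p).
Let two0P : 2 = 0 :> {poly k}. Proof. exact: char2_poly. Qed.

Lemma revM N N' p q : (size p <= N.+1)%N -> (size q <= N'.+1)%N ->
  rev (N + N') (p * q) = rev N p * rev N' q.
Proof. exact: (hsub_swapM (@ratfrac_neq0 k)). Qed.

Lemma coef_mulX_deriv p j : ('X * p^`())`_j = p`_j *+ j.
Proof. by rewrite coefXM coef_deriv; case: j. Qed.

(** The Euler operator X d/dX multiplies X^j by j, and reversal exchanges j and N - j. *)
Lemma mulX_deriv_rev N p :
  'X * (rev N p)^`() = N%:R * rev N p - rev N ('X * p^`()).
Proof.
apply/polyP => j; rewrite coefB mulr_natl coefMn coef_mulX_deriv !hsub_swap !coef_poly.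
rewrite coef_mulX_deriv; case: ltnP => jN; last by rewrite !mul0rn subrr.
by rewrite -mulrnBr ?leq_subr // subKn.
Qed.

Lemma size_mulX_deriv n p : (size p <= n.+1)%N -> (size ('X * p^`())%R <= n.+1)%N.
Proof.
move=> pn; apply/leq_sizeP => j nj; rewrite coef_mulX_deriv nth_default ?mul0rn //.
exact: leq_trans nj.
Qed.

Lemma size_sqr_leq n p : (size p <= n.+1)%N -> (size (p ^+ 2)%R <= (n + n).+1)%N.
Proof.
by move=> pn; rewrite (leq_trans (size_poly_exp_leq _ _)) //; move: (size p) pn; lia.
Qed.

Lemma mulX2_discr P Q :
  'X^2 * discr P Q = ('X * P^`()) ^+ 2 + P * ('X * Q^`()) ^+ 2.
Proof. by rewrite /discr; ring. Qed.

Lemma size_mulX2_discr P Q : (size P <= 7)%N -> (size Q <= 4)%N ->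
  (size ('X^2 * discr P Q)%R <= 13)%N.
Proof.
move=> P7 Q4; rewrite mulX2_discr (leq_trans (size_polyD _ _)) // geq_max.
rewrite (@size_sqr_leq 6) ?size_mulX_deriv //= (leq_trans (size_polyMleq _ _)) //.
have := @size_sqr_leq 3 _ (size_mulX_deriv Q4).
by move: (size P) (size _) P7; lia.
Qed.

(** In characteristic two the Euler operator commutes with reversal in degree 6, and in degree 3 up
    to the summand [rev 3 Q]. So, modulo [rev 3 Q] and up to the factor X^2, discr at infinity is
    the reversal of discr. *)
Lemma mulX2_discr_rev P Q : (size P <= 7)%N -> (size Q <= 4)%N ->
  'X^2 * discr (rev 6 P) (rev 3 Q) =
  rev 12 ('X^2 * discr P Q) + rev 6 P * rev 3 Q ^+ 2.
Proof.
move=> P7 Q4; have P7' := size_mulX_deriv P7; have Q4' := size_mulX_deriv Q4.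
have e1 : 'X * (rev 6 P)^`() = rev 6 ('X * P^`()).
  by rewrite mulX_deriv_rev; ring2 two0P.
have e2 : 'X * (rev 3 Q)^`() = rev 3 Q + rev 3 ('X * Q^`()).
  by rewrite mulX_deriv_rev; ring2 two0P.
rewrite !mulX2_discr e1 e2 hsubD expr2 [in RHS]expr2.
rewrite (@revM 6 6) // (@revM 6 6) //; last exact: (@size_sqr_leq 3).
by rewrite [('X * Q^`()) ^+ 2]expr2 (@revM 3 3 ('X * Q^`())) //; ring2 two0P.
Qed.

(** Away from 0 and infinity the two charts see the same points, so only 1/x = 0 remains to be
    checked. There the reversed Q takes the value Q_3 and its discr the value P_5^2 + P_6 Q_2^2. *)
Lemma smooth_modelI P Q : Q != 0 -> (size Q <= 4)%N -> (size P <= 7)%N ->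
  coprimep Q (discr P Q) ->
  (Q`_3 != 0) || (P`_5 ^+ 2 + P`_6 * Q`_2 ^+ 2 != 0) -> smooth_model P Q.
Proof.
move=> Q0 Q4 P7 cop infty; split=> //.
have /Bezout_eq1_coprimepP[[al be] /= e1] := cop.
pose m := (size al + size be)%N.
have am : (size ('X^2 * al)%R <= (m + 9).+1)%N.
  rewrite (leq_trans (size_polyMleq _ _)) // size_polyXn /m.
  by move: (size al) (size be); lia.
have bm : (size be <= m.+1)%N by rewrite /m; move: (size al) (size be); lia.
have dm : (size ('X^2 * discr P Q)%R <= 13)%N.
  exact: size_mulX2_discr.
(* The Bezout relation of the finite chart, times X^2 and reversed in degree m + 12. Its left-hand
   side is X^(m+10), so a common irreducible factor at infinity must be X. *)
have e2 : rev (m + 12) 'X^2 = rev (m + 9) ('X^2 * al) * rev 3 Q +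
    rev m be * (rev 12 ('X^2 * discr P Q)).
  rewrite -revM // -[RHS]addrC -revM // -addnA -hsubD -[in LHS](mulr1 'X^2) -e1.
  by congr (hsub _ _ _); ring.
have e3 : rev (m + 12) 'X^2 = 'X^(m + 10) :> {poly k}.
  rewrite hsub_swap; apply/polyP => j; rewrite coef_poly !coefXn.
  move: (m) => n; case: ltnP => h.
    by have -> : ((n + 12 - j)%N == 2) = (j == n + 10)%N by apply/eqP/eqP; lia.
  by have -> : (j == n + 10)%N = false by apply/eqP; lia.
apply: contraT => ncop; have g0 : gcdp (rev 3 Q) (discr (rev 6 P) (rev 3 Q)) != 0.
  by rewrite gcdp_eq0 negb_and; apply/orP; left; apply: contraNneq Q0 => /hsub_swap_eq0 ->.
have [|p p_irr] := @exists_irreducible_dvdp _ (gcdp (rev 3 Q) (discr (rev 6 P) (rev 3 Q))).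
  by rewrite ltn_neqAle eq_sym size_poly_gt0 g0 andbT.
rewrite dvdp_gcd => /andP[pQ pd].
have pX : p %| 'X.
  apply: (@irreducible_dvdpX _ _ _ (m + 10)) => //; rewrite -e3 e2.
  rewrite dvdp_add ?dvdp_mull //.
  have -> : rev 12 ('X^2 * discr P Q) =
    'X^2 * discr (rev 6 P) (rev 3 Q) - rev 6 P * rev 3 Q ^+ 2.
    by rewrite mulX2_discr_rev //; ring.
  by rewrite dvdp_sub ?dvdp_mull // dvdp_exp.
have eqpX : p %= 'X.
  have := (irredp_XsubC (0 : k)).2 p; rewrite subr0; apply=> //.
  by case: p_irr => p1 _; rewrite neq_ltn p1 orbT.
have root0 q : 'X %| q -> q`_0 = 0.
  by rewrite -['X]subr0 -[0]/(0%:P) dvdp_XsubCl => /eqP; rewrite horner_coef0.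
have XQ : 'X %| rev 3 Q by rewrite -(eqp_dvdl _ eqpX).
have Xd : 'X %| discr (rev 6 P) (rev 3 Q) by rewrite -(eqp_dvdl _ eqpX).
have Q3 : Q`_3 = 0 by have := root0 _ XQ; rewrite hsub_swap coef_poly.
have := root0 _ Xd.
rewrite -horner_coef0 /discr !(horner_exp, hornerD, hornerM) !horner_coef0 !coef_deriv.
rewrite !hsub_swap !coef_poly /= !mulr1n => e.
move: infty; rewrite Q3 eqxx /= => /eqP[]; rewrite -[RHS]e; ring.
Qed.

End SmoothCriterion.

(** * Models with simple poles, u = W/Q *)

Section SimplePoles.
Variables (k : fieldType) (two0 : 2 = 0 :> k).
Implicit Types p q W Q r : {poly k}.
Let two0P : 2 = 0 :> {poly k}. Proof. exact: char2_poly. Qed.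

Lemma det_den_neq0 (a b g d : k) : a * d + b * g != 0 -> (g != 0) || (d != 0).
Proof.
by apply: contraNT; rewrite negb_or !negbK => /andP[/eqP -> /eqP ->]; rewrite !mulr0 addr0.
Qed.

(** With P = W Q, discr is (W Q')^2 modulo Q. *)
Lemma simple_poles_smooth W Q :
  coprimep Q W -> coprimep Q Q^`() -> coprimep Q (discr (W * Q) Q).
Proof.
move=> QW QQ'.
have -> : discr (W * Q) Q =
    (W^`() ^+ 2 * Q + W * Q^`() ^+ 2) * Q + (W * Q^`()) ^+ 2.
  by rewrite /discr derivM; ring2 two0P.
by rewrite coprimep_addl_mul coprimep_expr // coprimepMr QW.
Qed.

(* For u = W/Q with simple poles, w = r/Q in u(mx) = u + e + w^2 + w has no
   pole, so that it is a constant t. *)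
Lemma simple_poles_necessary W Q e : (size W <= 4)%N -> (2 < size Q <= 4)%N ->
  (forall r, Q %| r ^+ 2 -> Q %| r) ->
  moebius_equiv (W * Q + e *: Q ^+ 2) Q (W * Q) Q ->
  exists a b g d t, [/\ a * d + b * g != 0,
    hsub 3 (a, b, g, d) Q = (a * d + b * g) *: Q
    & hsub 3 (a, b, g, d) W = (a * d + b * g) *: (W + (e + (t + t ^+ 2)) *: Q)].
Proof.
move=> W4 /andP[Q2 Q4] sqf [a [b [g [d [r [De0 r4 eQ eP]]]]]].
have gd := det_den_neq0 De0.
exists a, b, g, d; move: eP; rewrite (@hsubM k _ _ (@ratfrac_neq0 k) 3 3) //.
rewrite eQ; move: (a * d + b * g) (hsub 3 _ W) (size_hsub 3 (a, b, g, d) W) De0.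
move=> De V V4 De0 eP.
have Q0 : Q != 0 by rewrite -size_poly_gt0 ltnW // ltnW.
have eP' : De^-1 *: V * Q = W * Q + e *: Q ^+ 2 + r ^+ 2 + r * Q.
  apply: (scalerI (expf_neq0 2 De0)); rewrite -eP -scalerAl scalerA expr2 mulfK //.
  by rewrite -scalerAr.
(* Both W Q and its transform are multiples of Q, hence so is the remaining term r^2. *)
have /sqf/dvdpP[h hE] : Q %| r ^+ 2.
  have -> : r ^+ 2 = (De^-1 *: V - W - e *: Q - r) * Q.
    by rewrite !mulrBl eP' -scalerAl; ring.
  exact: dvdp_mulIr.
have hQ : (h ^+ 2 + h) * Q = De^-1 *: V - W - e *: Q.
  apply: (mulIf Q0); rewrite !mulrBl eP' hE -scalerAl; ring.
(* A nonconstant h would give (h^2 + h) Q degree at least 2 + 2, as deg Q >= 2, while the right-hand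
   side of [hQ] has degree at most 3. *)
have hs : (size h <= 1)%N.
  rewrite leqNgt; apply/negP => h1.
  have h0 : h != 0 by rewrite -size_poly_gt0 ltnW.
  have : (size ((h ^+ 2 + h) * Q)%R <= 4)%N.
    rewrite hQ (leq_trans (size_polyD _ _)) // geq_max size_polyN.
    rewrite (leq_trans (size_polyD _ _)) ?geq_max ?size_polyN ?W4.
      by rewrite (leq_trans (size_scale_leq _ _)).
    by rewrite (leq_trans (size_scale_leq _ _)).
  have h2 : size (h ^+ 2) = (size h + size h).-1 by rewrite expr2 size_mul.
  have hh : size (h ^+ 2 + h) = (size h + size h).-1.
    by rewrite size_polyDl h2 //; move: h1; move: (size h); lia.
  rewrite size_mul // -?size_poly_gt0 hh; last by move: h1; move: (size h); lia.
  by move: h1 Q2; move: (size h) (size Q); lia.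
have hc := size1_polyC hs; exists h`_0; split=> //.
have -> : V = De *: (De^-1 *: V) by rewrite scalerA mulfV ?scale1r.
congr (_ *: _); apply: (mulIf Q0); rewrite eP' hE hc coefC /= -!mul_polyC.
by rewrite !(rmorphD, rmorphXn) /=; ring.
Qed.

Lemma simple_poles_sufficient W Q e a b g d t :
  (size W <= 4)%N -> (size Q <= 4)%N -> a * d + b * g != 0 ->
  hsub 3 (a, b, g, d) Q = (a * d + b * g) *: Q ->
  hsub 3 (a, b, g, d) W = (a * d + b * g) *: (W + (e + (t + t ^+ 2)) *: Q) ->
  moebius_equiv (W * Q + e *: Q ^+ 2) Q (W * Q) Q.
Proof.
move=> W4 Q4 De0 eQ eW; exists a, b, g, d, (t *: Q); split=> //.
  by rewrite (leq_trans (size_scale_leq _ _)).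
have gd := det_den_neq0 De0.
rewrite (@hsubM k _ _ (@ratfrac_neq0 k) 3 3) // eQ eW.
by rewrite -!mul_polyC !(rmorphD, rmorphXn) /=; ring.
Qed.

Lemma hsub3E a b g d (c0 c1 c2 c3 : k) :
  hsub 3 (a, b, g, d) (Poly [:: c0; c1; c2; c3]) =
  c0%:P * (g%:P * 'X + d%:P) ^+ 3
  + c1%:P * (a%:P * 'X + b%:P) * (g%:P * 'X + d%:P) ^+ 2
  + c2%:P * (a%:P * 'X + b%:P) ^+ 2 * (g%:P * 'X + d%:P)
  + c3%:P * (a%:P * 'X + b%:P) ^+ 3.
Proof.
rewrite /hsub !big_ord_recl big_ord0 !coef_Poly /= -!mul_polyC /bump /=; ring.
Qed.

Lemma hsub6E a b g d (c0 c1 c2 c3 c4 c5 c6 : k) :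
  hsub 6 (a, b, g, d) (Poly [:: c0; c1; c2; c3; c4; c5; c6]) =
  c0%:P * (g%:P * 'X + d%:P) ^+ 6
  + c1%:P * (a%:P * 'X + b%:P) * (g%:P * 'X + d%:P) ^+ 5
  + c2%:P * (a%:P * 'X + b%:P) ^+ 2 * (g%:P * 'X + d%:P) ^+ 4
  + c3%:P * (a%:P * 'X + b%:P) ^+ 3 * (g%:P * 'X + d%:P) ^+ 3
  + c4%:P * (a%:P * 'X + b%:P) ^+ 4 * (g%:P * 'X + d%:P) ^+ 2
  + c5%:P * (a%:P * 'X + b%:P) ^+ 5 * (g%:P * 'X + d%:P)
  + c6%:P * (a%:P * 'X + b%:P) ^+ 6.
Proof.
rewrite /hsub !big_ord_recl big_ord0 !coef_Poly /= -!mul_polyC /bump /=; ring.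
Qed.

Lemma Poly4E (c0 c1 c2 c3 : k) : Poly [:: c0; c1; c2; c3] =
  c0%:P + c1%:P * 'X + c2%:P * 'X^2 + c3%:P * 'X^3.
Proof. by rewrite /= !cons_poly_def; ring. Qed.

Lemma Poly7E (c0 c1 c2 c3 c4 c5 c6 : k) : Poly [:: c0; c1; c2; c3; c4; c5; c6] =
  c0%:P + c1%:P * 'X + c2%:P * 'X^2 + c3%:P * 'X^3 + c4%:P * 'X^4 + c5%:P * 'X^5
  + c6%:P * 'X^6.
Proof. by rewrite /= !cons_poly_def; ring. Qed.

Lemma Poly_eq0 (s : seq k) : Poly s = 0 -> forall j, s`_j = 0.
Proof. by move=> e j; rewrite -coef_Poly e coef0. Qed.

Lemma poly4P p : (size p <= 4)%N -> exists c0 c1 c2 c3, p = Poly [:: c0; c1; c2; c3].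
Proof.
move=> p4; exists p`_0, p`_1, p`_2, p`_3; apply/polyP => -[|[|[|[|j]]]];
  rewrite coef_Poly //= nth_nil nth_default // (leq_trans p4) //.
Qed.

End SimplePoles.

(** * Twists of the cubic models and of type (1,3) *)

Section Models.
Variables (k : fieldType) (two0 : 2 = 0 :> k).
Implicit Types p q L W Q r : {poly k}.
Let two0P : 2 = 0 :> {poly k}. Proof. exact: char2_poly. Qed.

Lemma subrr_eq (V : zmodType) (x y : V) : x = y -> x - y = 0.
Proof. by move=> ->; rewrite subrr. Qed.

Definition twistable P Q e := moebius_equiv (P + e *: Q ^+ 2) Q P Q.

Lemma ASP (e : k) : reflect (exists t, e = t + t ^+ 2) (e \in AS k).
Proof. exact: asboolP. Qed.

Lemma hsub_id N p : (size p <= N.+1)%N -> hsub N (1, 0, 0, 1) p = p.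
Proof.
move=> pN; rewrite /hsub; apply/polyP => j; rewrite coef_sum.
under eq_bigr => i _ do rewrite scale1r scale0r addr0 add0r expr1n mulr1 coefZ coefXn.
have [jN|jN] := ltnP j N.+1; last first.
  rewrite nth_default ?(leq_trans pN) // big1 // => i _.
  by rewrite gtn_eqF ?mulr0 // (leq_trans (ltn_ord i)).
rewrite (bigD1 (Ordinal jN)) //= eqxx mulr1 big1 ?addr0 // => i.
by rewrite -val_eqE eq_sym /= => /negPf ->; rewrite mulr0.
Qed.

Lemma twistable0 P Q : smooth_model P Q -> twistable P Q 0.
Proof.
move=> [_ Q4 P7 _ _]; exists 1, 0, 0, 1, 0; rewrite size_poly0 !hsub_id //.
rewrite !mulr1 mulr0 addr0 oner_neq0 expr1n !scale1r scale0r.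
by split=> //; ring.
Qed.

Lemma hsubS N a b g d p : (size p <= N.+1)%N ->
  hsub N.+1 (a, b, g, d) p = (g *: 'X + d%:P) * hsub N (a, b, g, d) p.
Proof.
move=> pN; rewrite /hsub big_ord_recr /= nth_default // scale0r addr0 mulr_sumr.
apply: eq_bigr => j _; rewrite subSn -1?ltnS // exprS.
by rewrite -scalerAr; congr (_ *: _); ring.
Qed.

(* The fixed points of a Moebius map x |-> m/l are the roots of x l - m, and
   there the forms p and p o M only differ by the factor l^N. *)
Lemma dvdp_fixed_form N a b g d p : (size p <= N.+1)%N ->
  g *: 'X^2 + (a + d) *: 'X + b%:P %|
    hsub N (a, b, g, d) p - (g *: 'X + d%:P) ^+ N * p.
Proof.
move=> pN; set f := _ + b%:P; set l := g *: 'X + d%:P; set m := a *: 'X + b%:P.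
have -> : l ^+ N * p = \sum_(j < N.+1) p`_j *: ((l * 'X) ^+ j * l ^+ (N - j)).
  have {1}-> : p = \poly_(j < N.+1) p`_j.
    apply/polyP => j; rewrite coef_poly; case: ltnP => // Nj.
    by rewrite nth_default // (leq_trans pN).
  rewrite poly_def mulr_sumr; apply: eq_bigr => j _.
  have -> : l ^+ N = l ^+ j * l ^+ (N - j) by rewrite -exprD subnKC // -ltnS.
  by rewrite -scalerAr exprMn; congr (_ *: _); ring.
rewrite /hsub -/l -/m -sumrB; elim/big_ind: _ => [|x y|j _]; first exact: dvdp0.
  exact: dvdp_add.
rewrite -scalerBr -mulrBl -mul_polyC dvdp_mull // subrXX -mulrA dvdp_mulr //.
have -> : m - l * 'X = f; last exact: dvdpp.
by rewrite /m /l /f -!mul_polyC !rmorphD /=; ring2 two0P.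
Qed.

(* For u = L/Q, u(Mx) = u(x) + eps at all x: evaluate at a fixed point of M, which
   is not a pole since Q is irreducible of degree 3, or at infinity if g = 0. *)
Lemma cubic_twistable Q L d e :
  irreducible_poly Q -> size Q = 4 -> (size L <= 3)%N ->
  twistable ((L + d *: Q) * Q) Q e -> e \in AS k.
Proof.
move=> Qirr Q4 L3 tw; have Q0 : Q != 0 := irredp_neq0 Qirr.
have W4 : (size (L + d *: Q)%R <= 4)%N.
  rewrite (leq_trans (size_polyD _ _)) // geq_max (leq_trans L3) //.
  by rewrite (leq_trans (size_scale_leq _ _)) // Q4.
have [|r|a [b [g [h [t [De0 eQ]]]]]] := simple_poles_necessary W4 _ _ tw.
- by rewrite Q4.
- exact: irreducible_dvdpX.
set De := a * h + b * g in De0 eQ *; rewrite hsubD hsubZ eQ => eW.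
have eL : hsub 3 (a, b, g, h) L = De *: (L + (e + (t + t ^+ 2)) *: Q).
  apply: (addIr (d *: (De *: Q))); rewrite eW -!mul_polyC !rmorphD /=; ring.
suff e0 : e + (t + t ^+ 2) = 0.
  by apply/ASP; exists t; apply: subr0_eq; rewrite -[RHS]e0; ring2 two0.
set eps := e + _ in eL *; apply/eqP; apply: contraT => eps0.
(* Infinity is fixed and u - d vanishes there: the transform of L still has degree at most 2, so the
   X^3 coefficient of [eL] is det eps times the leading coefficient of Q. *)
have [g0|g0] := eqVneq g 0.
  have := congr1 (fun p : {poly k} => p`_3) eL; rewrite coefZ coefD coefZ.
  rewrite [L`_3]nth_default // add0r.
  have -> : Q`_3 = lead_coef Q by rewrite lead_coefE Q4.
  rewrite hsubS // g0 scale0r add0r mul_polyC coefZ.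
  rewrite [(hsub 2 _ L)`_3]nth_default ?size_hsub // mulr0.
  by move/eqP; rewrite eq_sym !mulf_eq0 (negPf De0) (negPf eps0) lead_coef_eq0 (negPf Q0).
set f := g *: 'X^2 + (a + h) *: 'X + b%:P; set l := g *: 'X + h%:P.
have f3 : size f = 3.
  rewrite /f -addrA size_polyDl size_scale // size_polyXn // ltnS.
  rewrite (leq_trans (size_polyD _ _)) // geq_max (leq_trans (size_scale_leq _ _)) ?size_polyX //.
  by rewrite (leq_trans (size_polyC_leq1 _)).
have cop : coprimep f Q.
  rewrite coprimep_sym irreducible_poly_coprime //; apply/negP => /dvdp_leq.
  by rewrite -size_poly_eq0 f3 Q4 => /(_ isT).
(* At the fixed points the transform of Q is both det Q and l^3 Q, and Q has no root there. *)
have fQ : f %| De%:P - l ^+ 3.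
  rewrite -(Gauss_dvdpl _ cop) mulrBl mul_polyC -eQ.
  by apply: dvdp_fixed_form; rewrite Q4.
(* The same comparison for L, with l^3 replaced by det thanks to [fQ]; since f is coprime to Q, it
   would divide a nonzero constant. *)
have : f %| (De * eps)%:P * Q.
  have -> : (De * eps)%:P * Q = (hsub 3 (a, b, g, h) L - l ^+ 3 * L) - (De%:P - l ^+ 3) * L.
    by rewrite eL -!mul_polyC rmorphM /=; ring.
  by rewrite dvdp_sub ?dvdp_mulr //; apply: dvdp_fixed_form; apply: leq_trans L3 _.
rewrite (Gauss_dvdpl _ cop) => /dvdp_leq; rewrite polyC_eq0 mulf_neq0 // => /(_ isT).
by rewrite f3 size_polyC mulf_neq0.
Qed.

Lemma dvdp_sqr_irreducible Q : irreducible_poly Q -> forall r, Q %| r ^+ 2 -> Q %| r.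
Proof. by move=> Qirr r; apply: irreducible_dvdpX. Qed.

Lemma cubic_smooth Q L d : irreducible_poly Q -> size Q = 4 -> Q^`() != 0 ->
  (size L <= 3)%N -> L != 0 -> smooth_model ((L + d *: Q) * Q) Q.
Proof.
move=> Qirr Q4 dQ0 L3 L0; have Q0 := irredp_neq0 Qirr.
have cop p : p != 0 -> (size p <= 3)%N -> coprimep Q p.
  move=> p0 p3; rewrite irreducible_poly_coprime //; apply/negP => /dvdp_leq.
  by rewrite p0 Q4 => /(_ isT) h; move: (leq_trans h p3).
have W4 : (size (L + d *: Q)%R <= 4)%N.
  rewrite (leq_trans (size_polyD _ _)) // geq_max (leq_trans L3) //.
  by rewrite (leq_trans (size_scale_leq _ _)) // Q4.
apply: (smooth_modelI two0) => //; rewrite ?Q4 //.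
- rewrite (leq_trans (size_polyMleq _ _)) // Q4.
  by move: (size _) W4; lia.
- apply: (simple_poles_smooth two0).
    by rewrite addrC -mul_polyC coprimep_addl_mul; apply: cop.
  by apply: cop => //; have := lt_size_deriv Q0; rewrite Q4.
have -> : Q`_3 = lead_coef Q by rewrite lead_coefE Q4.
by rewrite lead_coef_eq0 Q0.
Qed.

(** As a binary cubic, Q = X has a simple root at 0 and a double root at infinity. So m fixes both
    points, and the determinant normalizes [de] to 1: m(x) = al x. The constant term of u is
    unaffected by m, and the X^2 coefficient of P gives e = r1 + r1^2. *)
Lemma type13_twistable (a b c d : k) e : a != 0 -> c != 0 ->
  twistable (Poly [:: 0; c; d; b; 0; a; 0]) (Poly [:: 0; 1; 0; 0]) e -> e \in AS k.
Proof.
move=> a0 c0 [al [be [ga [de [r [De0 r4 eQ eP]]]]]].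
have [r0 [r1 [r2 [r3 rE]]]] := poly4P r4.
move: eQ; rewrite hsub3E => eQ.
have /Poly_eq0 cQ : Poly [:: be * de ^+ 2; al * de ^+ 2 - (al * de + be * ga); be * ga ^+ 2; al * ga ^+ 2] = 0.
  rewrite Poly4E -[RHS](subrr_eq eQ) Poly4E -!mul_polyC; ring2 two0P.
have /= c_0 := cQ 0%N; have /= c_1 := cQ 1%N; have /= c_2 := cQ 2%N; have /= c_3 := cQ 3%N.
have ga0 : ga = 0.
  apply/eqP; apply: contraT => ga0; move/eqP: c_3; move/eqP: c_2.
  rewrite !(expf_eq0, mulf_eq0) (negPf ga0) /= !orbF => /eqP be0 /eqP al0.
  by move: De0; rewrite be0 al0 !mul0r addr0 eqxx.
move: De0 c_1 eP; rewrite {}ga0 mulr0 addr0 mulf_eq0 negb_or => /andP[al0 de0] c_1 eP {c_2 c_3 cQ eQ}.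
have be0 : be = 0.
  by move/eqP: c_0; rewrite !(expf_eq0, mulf_eq0) (negPf de0) /= orbF => /eqP.
have de1 : de = 1.
  apply: (mulfI (mulf_neq0 al0 de0)); apply: subr0_eq; rewrite -[RHS]c_1; ring.
move: eP; rewrite be0 de1 mulr1 rE hsub6E {c_0 c_1 de0 r4 rE} => eP.
have /Poly_eq0 cP : Poly [:: al ^+ 2 * r0 ^+ 2; c * al - al ^+ 2 * (c + r0);
    al ^+ 2 * (e + r1 ^+ 2 + r1);
    b * al ^+ 3 - al ^+ 2 * (b + r2); al ^+ 2 * (r3 + r2 ^+ 2);
    a * al ^+ 5 - al ^+ 2 * a; al ^+ 2 * r3 ^+ 2] = 0.
  rewrite Poly7E -[RHS](subrr_eq eP) !Poly4E !Poly7E -!mul_polyC; ring2 two0P.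
have /= c_0 := cP 0%N; have /= c_1 := cP 1%N; have /= c_2 := cP 2%N.
have al20 : al ^+ 2 != 0 by rewrite expf_neq0.
move/eqP: c_2; rewrite mulf_eq0 (negPf al20) /= => /eqP c_2.
by apply/ASP; exists r1; apply: subr0_eq; rewrite -[RHS]c_2; ring2 two0.
Qed.

End Models.

(** * The split model and the six permutations of its poles *)

Section Types.
Variables (k : fieldType) (two0 : 2 = 0 :> k).
Implicit Types p q L W Q : {poly k}.
Let two0P : 2 = 0 :> {poly k}. Proof. exact: char2_poly. Qed.

Lemma sqrD_eq0 (x : k) : x + x ^+ 2 = 0 -> x = 0 \/ x = 1.
Proof.
have -> : x + x ^+ 2 = x * (x - 1) by ring2 two0.
by move/eqP; rewrite mulf_eq0 subr_eq0 => /orP[]/eqP; [left|right].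
Qed.

Lemma split_denomE : Poly [:: 0; 1; 1; 0] = ('X - 0%:P) * ('X - 1%:P) :> {poly k}.
Proof. by rewrite Poly4E; ring2 two0P. Qed.

Lemma split_denom_coprime : coprimep ('X - 0%:P) ('X - 1%:P : {poly k}).
Proof. by rewrite coprimep_XsubC root_XsubC ?oner_eq0 1?eq_sym ?oner_eq0. Qed.

Lemma split_dvdp_sqr (r : {poly k}) :
  Poly [:: 0; 1; 1; 0] %| r ^+ 2 -> Poly [:: 0; 1; 1; 0] %| r.
Proof.
rewrite split_denomE !Gauss_dvdp ?split_denom_coprime //.
by rewrite !dvdp_XsubCl !rootE !horner_exp !expf_eq0.
Qed.

(** W is a x + d + b/x + c/(x+1) times Q = x (x + 1), whose cubic form vanishes at 0, 1 and
    infinity. The equations on Q leave the six maps permuting these points. A transposition equates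
    two coefficients and gives the third as e modulo AS; the identity and the 3-cycles give 0. *)
Lemma split_twistable (a b c d e : k) :
  twistable (Poly [:: b; d + b + c; a + d; a] * Poly [:: 0; 1; 1; 0])
    (Poly [:: 0; 1; 1; 0]) e ->
  exists2 f, f = 0 \/ third_coefficient a b c f & e - f \in AS k.
Proof.
set W := Poly [:: b; _; _; _]; set Q := Poly _ => tw.
have Q3 : size Q = 3 by rewrite /Q split_denomE size_mul ?polyXsubC_eq0 // !size_XsubC.
have W4 : (size W <= 4)%N := size_Poly _.
have [|al [be [ga [de [t [De0 eQ eW]]]]]] := simple_poles_necessary W4 _ split_dvdp_sqr tw.
  by rewrite Q3.
have /Poly_eq0 cQ : Poly [:: be * de ^+ 2 + be ^+ 2 * de;
    al * de ^+ 2 + be ^+ 2 * ga - (al * de + be * ga);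
    be * ga ^+ 2 + al ^+ 2 * de - (al * de + be * ga);
    al * ga ^+ 2 + al ^+ 2 * ga] = 0.
  rewrite Poly4E -[RHS](subrr_eq eQ) hsub3E Poly4E -!mul_polyC; ring2 two0P.
have /= c0 := cQ 0%N; have /= c1 := cQ 1%N; have /= c2 := cQ 2%N; have /= c3 := cQ 3%N.
have fin f g : e + (t + t ^+ 2) = f -> f = g -> e - g \in AS k.
  move=> <- <-; apply/ASP; exists t; ring2 two0.
(* m fixes infinity: it is x or x + 1. *)
have [ga0|ga0] := eqVneq ga 0.
  move: De0 c0 c1 c2 eW; rewrite {}ga0 mulr0 addr0 mulf_eq0 negb_or => /andP[al0 de0].
  rewrite expr0n !mulr0 !addr0 add0r => c0 c1 c2.
  have al1 : al = 1.
    by apply: (mulfI (mulf_neq0 al0 de0)); apply: subr0_eq; rewrite -[RHS]c2; ring.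
  have de1 : de = 1.
    by apply: (mulfI (mulf_neq0 al0 de0)); apply: subr0_eq; rewrite -[RHS]c1; ring.
  move: c0; rewrite al1 de1 !expr1n !mulr1 => /sqrD_eq0[]->.
    rewrite hsub3E => eW; exists 0; first by left.
    have /Poly_eq0/(_ 1%N) /= h : Poly [:: 0; e + (t + t ^+ 2); e + (t + t ^+ 2); 0] = 0.
      rewrite Poly4E -[RHS](subrr_eq eW) /W /Q !Poly4E -!mul_polyC; ring2 two0P.
    exact: fin h erefl.
  rewrite hsub3E => eW.
  have /Poly_eq0 h : Poly [:: c + b; a + (e + (t + t ^+ 2)); a + (e + (t + t ^+ 2)); 0] = 0.
    rewrite Poly4E -[RHS](subrr_eq eW) /W /Q !Poly4E -!mul_polyC; ring2 two0P.
  have /= h0 := h 0%N; have /= h1 := h 1%N; exists a.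
    by right; constructor 1; split=> //; apply: subr0_eq; rewrite -[RHS]h0; ring2 two0.
  by apply: (fin a) => //; apply: subr0_eq; rewrite -[RHS]h1; ring2 two0.
(* m sends infinity to 0: it is 1/x or 1/(x + 1). *)
have [al0|al0] := eqVneq al 0.
  move: De0 c0 c1 c2 eW; rewrite {}al0 mul0r add0r mulf_eq0 negb_or => /andP[be0 _].
  rewrite expr0n !mul0r !addr0 add0r => c0 c1 c2.
  have ga1 : ga = 1.
    by apply: (mulfI (mulf_neq0 be0 ga0)); apply: subr0_eq; rewrite -[RHS]c2; ring.
  have be1 : be = 1.
    by apply: (mulfI (mulf_neq0 be0 ga0)); apply: subr0_eq; rewrite -[RHS]c1; ring.
  move: c0; rewrite ga1 be1 expr1n !mul1r addrC => /sqrD_eq0[]->.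
    rewrite hsub3E => eW.
    have /Poly_eq0 h : Poly [:: a - b; a + b + c + (e + (t + t ^+ 2));
        a + b + c + (e + (t + t ^+ 2)); b - a] = 0.
      rewrite Poly4E -[RHS](subrr_eq eW) /W /Q !Poly4E -!mul_polyC; ring2 two0P.
    have /= h0 := h 0%N; have /= h1 := h 1%N.
    have ab : a = b by apply: subr0_eq.
    exists c; first by right; constructor 3.
    by apply: (fin c) => //; apply: subr0_eq; rewrite -[RHS]h1 ab; ring2 two0.
  rewrite hsub3E => eW.
  have /Poly_eq0 h : Poly [:: c - b; a + c + (e + (t + t ^+ 2));
      a + c + (e + (t + t ^+ 2)); b - a] = 0.
    rewrite Poly4E -[RHS](subrr_eq eW) /W /Q !Poly4E -!mul_polyC; ring2 two0P.
  have /= h0 := h 0%N; have /= h1 := h 1%N; have /= h3 := h 3%N.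
  have cb : c = b by apply: subr0_eq. have ba : b = a by apply: subr0_eq.
  exists 0; first by left.
  by apply: (fin 0) => //; apply: subr0_eq; rewrite -[RHS]h1 cb ba; ring2 two0.
(* m sends infinity to 1: it is x/(x + 1) or (x + 1)/x. *)
have alga : al = ga.
  apply: (mulfI (mulf_neq0 al0 ga0)); apply: subr0_eq; rewrite -[RHS]c3; ring2 two0.
move: De0 c0 c1 c2 eW; rewrite -alga => De0 c0 c1 c2.
have D0 : de + be != 0.
  by apply: contraNneq De0 => h; apply/eqP; transitivity (al * (de + be)); [ring|rewrite h mulr0].
have al1 : al = 1.
  apply: (mulfI (mulf_neq0 al0 D0)); apply: subr0_eq; rewrite -[RHS]c2; ring.
have D1 : de + be = 1.
  apply: (mulfI D0); apply: subr0_eq; rewrite -[RHS]c1 al1; ring2 two0.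
have deE : de = 1 + be by rewrite -D1; ring2 two0.
have : be + be ^+ 2 = 0 by rewrite -[RHS]c0 deE; ring2 two0.
rewrite al1 deE => /sqrD_eq0[]->.
  rewrite hsub3E => eW.
  have /Poly_eq0 h : Poly [:: 0; b + (e + (t + t ^+ 2)); b + (e + (t + t ^+ 2)); c - a] = 0.
    rewrite Poly4E -[RHS](subrr_eq eW) /W /Q !Poly4E -!mul_polyC; ring2 two0P.
  have /= h1 := h 1%N; have /= h3 := h 3%N.
  exists b; first by right; constructor 2; split=> //; apply/esym/subr0_eq.
  by apply: (fin b) => //; apply: subr0_eq; rewrite -[RHS]h1; ring2 two0.
rewrite -[1 + 1]/(2%:R) two0 hsub3E => eW.
have /Poly_eq0 h : Poly [:: a - b; b + c + (e + (t + t ^+ 2));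
    b + c + (e + (t + t ^+ 2)); c - a] = 0.
  rewrite Poly4E -[RHS](subrr_eq eW) /W /Q !Poly4E -!mul_polyC; ring2 two0P.
have /= h0 := h 0%N; have /= h1 := h 1%N; have /= h3 := h 3%N.
have ab : a = b by apply: subr0_eq. have ca : c = a by apply: subr0_eq.
exists 0; first by left.
by apply: (fin 0) => //; apply: subr0_eq; rewrite -[RHS]h1 ca ab; ring2 two0.
Qed.

End Types.

(** * Smoothness of the models; quadratic and supersingular twists *)

Section MoreTypes.
Variables (k : fieldType) (two0 : 2 = 0 :> k).
Implicit Types p q L W Q : {poly k}.
Let two0P : 2 = 0 :> {poly k}. Proof. exact: char2_poly. Qed.

Lemma deriv_Poly4 (c0 c1 c2 c3 : k) :
  (Poly [:: c0; c1; c2; c3])^`() = c1%:P + c3%:P * 'X^2.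
Proof.
rewrite Poly4E; have -> : c0%:P + c1%:P * 'X + c2%:P * 'X^2 + c3%:P * 'X^3 =
  c0%:P + c1%:P * 'X + c2%:P * ('X * 'X) + c3%:P * ('X * 'X * 'X) by ring.
by rewrite !derivD !derivM !derivC !derivX; ring2 two0P.
Qed.

Lemma size_Poly_neq0 (c0 c1 c2 c3 : k) (j : nat) :
  (Poly [:: c0; c1; c2; c3])`_j != 0 -> Poly [:: c0; c1; c2; c3] != 0.
Proof. by apply: contraNneq => ->; rewrite coef0. Qed.

Lemma size_PolyM_leq7 (s s' : seq k) : size s = 4 -> size s' = 4 ->
  (size (Poly s * Poly s')%R <= 7)%N.
Proof.
move=> s4 s4'; rewrite (leq_trans (size_polyMleq _ _)) //.
have := size_Poly s; have := size_Poly s'; rewrite s4 s4'.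
by move: (size (Poly s)) (size (Poly s')); lia.
Qed.

Lemma coef5_PolyM (c0 c1 c2 c3 e0 e1 e2 : k) :
  (Poly [:: c0; c1; c2; c3] * Poly [:: e0; e1; e2; 0])`_5 = c3 * e2
  /\ (Poly [:: c0; c1; c2; c3] * Poly [:: e0; e1; e2; 0])`_6 = 0.
Proof.
have -> : Poly [:: c0; c1; c2; c3] * Poly [:: e0; e1; e2; 0] = Poly [:: c0 * e0;
   c0 * e1 + c1 * e0; c0 * e2 + c1 * e1 + c2 * e0; c1 * e2 + c2 * e1 + c3 * e0;
   c2 * e2 + c3 * e1; c3 * e2; 0].
  by rewrite !Poly4E Poly7E; ring.
by rewrite !coef_Poly.
Qed.

(** Each coefficient controls its own pole: W(0) = b, W(1) = c, and P_5 = a at infinity. *)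
Lemma split_smooth (a b c d : k) : a != 0 -> b != 0 -> c != 0 ->
  smooth_model (Poly [:: b; d + b + c; a + d; a] * Poly [:: 0; 1; 1; 0])
    (Poly [:: 0; 1; 1; 0]).
Proof.
move=> a0 b0 c0; have [P5 P6] := coef5_PolyM b (d + b + c) (a + d) a 0 1 1.
apply: (smooth_modelI two0).
- by apply: (@size_Poly_neq0 _ _ _ _ 1%N); rewrite coef_Poly /= oner_eq0.
- exact: size_Poly.
- exact: size_PolyM_leq7.
- apply: (simple_poles_smooth two0); last first.
    by rewrite deriv_Poly4 mul0r addr0 coprimep1.
  have e0 : (Poly [:: b; d + b + c; a + d; a]).[0] = b by rewrite horner_coef0 coef_Poly.
  have e1 : (Poly [:: b; d + b + c; a + d; a]).[1] = c.
    rewrite Poly4E !(hornerD, hornerM, hornerX, hornerC, hornerXn); ring2 two0.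
  rewrite (split_denomE two0) coprimepMl.
  by apply/andP; split; rewrite coprimep_sym coprimep_XsubC rootE ?e0 ?e1.
- by rewrite P5 P6 mul0r addr0 mulr1 expf_eq0 /= a0 orbT.
Qed.

Lemma unimodular_twistable W Q e a b g d :
  (size W <= 4)%N -> (size Q <= 4)%N -> a * d + b * g = 1 ->
  hsub 3 (a, b, g, d) Q = Q -> hsub 3 (a, b, g, d) W = W + e *: Q ->
  twistable (W * Q) Q e.
Proof.
move=> W4 Q4 De1 eQ eW; apply: (@simple_poles_sufficient _ _ _ _ a b g d 0) => //.
- by rewrite De1 oner_neq0.
- by rewrite De1 scale1r.
- by rewrite De1 scale1r eW expr0n !addr0.
Qed.

(** The map exchanging the two poles with equal coefficients, namely x + 1, x/(x + 1) or 1/x,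
    changes u by the coefficient at the pole it fixes; for instance a (x + 1) = a x + a. *)
Lemma third_twistable (a b c d f : k) : third_coefficient a b c f ->
  twistable (Poly [:: b; d + b + c; a + d; a] * Poly [:: 0; 1; 1; 0])
    (Poly [:: 0; 1; 1; 0]) f.
Proof.
have W4 := size_Poly [:: b; d + b + c; a + d; a].
have Q4 := size_Poly [:: 0; 1; 1; 0 : k].
case=> [[bc ->]|[ac ->]|[ab ->]].
- apply: (@unimodular_twistable _ _ _ 1 1 0 1) => //; first ring.
    by rewrite hsub3E Poly4E; ring2 two0P.
  by rewrite hsub3E !Poly4E bc -mul_polyC; ring2 two0P.
- apply: (@unimodular_twistable _ _ _ 1 0 1 1) => //; first ring.
    by rewrite hsub3E Poly4E; ring2 two0P.
  by rewrite hsub3E !Poly4E ac -mul_polyC; ring2 two0P.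
- apply: (@unimodular_twistable _ _ _ 0 1 1 0) => //; first ring.
    by rewrite hsub3E Poly4E; ring2 two0P.
  by rewrite hsub3E !Poly4E ab -mul_polyC; ring2 two0P.
Qed.

Lemma quadratic_irreducible (r : k) : r \notin AS k ->
  irreducible_poly (Poly [:: r; 1; 1; 0]) /\ size (Poly [:: r; 1; 1; 0] : {poly k}) = 3.
Proof.
move=> rAS; have s3 : size (Poly [:: r; 1; 1; 0] : {poly k}) = 3.
  have -> : Poly [:: r; 1; 1; 0] = 'X^2 + ('X + r%:P) by rewrite Poly4E; ring.
  by rewrite size_polyDl size_polyXn // size_XaddC.
split=> //; apply: cubic_irreducible; first by rewrite s3.
move=> x; rewrite rootE Poly4E !(hornerD, hornerM, hornerX, hornerC, hornerXn); apply: contra rAS => /eqP h.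
by apply/ASP; exists x; apply: subr0_eq; rewrite -[RHS]h; ring2 two0.
Qed.

Lemma quadratic_smooth (r a b c d : k) : r \notin AS k -> a != 0 -> (b, c) != (0, 0) ->
  smooth_model (Poly [:: d * r + c; a * r + d + b; a + d; a] * Poly [:: r; 1; 1; 0])
    (Poly [:: r; 1; 1; 0]).
Proof.
move=> rAS a0 bc0; have [Qirr Q3] := quadratic_irreducible rAS.
have [P5 P6] := coef5_PolyM (d * r + c) (a * r + d + b) (a + d) a r 1 1.
apply: (smooth_modelI two0).
- exact: irredp_neq0.
- by rewrite Q3.
- exact: size_PolyM_leq7.
- apply: (simple_poles_smooth two0); last first.
    by rewrite deriv_Poly4 mul0r addr0 coprimep1.
  have -> : Poly [:: d * r + c; a * r + d + b; a + d; a] =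
      (a%:P * 'X + d%:P) * Poly [:: r; 1; 1; 0] + (b%:P * 'X + c%:P).
    by rewrite !Poly4E; ring.
  rewrite coprimep_addl_mul irreducible_poly_coprime //; apply/negP => /dvdp_leq.
  have -> : b%:P * 'X + c%:P != 0.
    apply: contraNneq bc0 => /polyP h; have := h 0%N; have := h 1%N.
    by rewrite !coefD !coefMX !coefC /= addr0 add0r => -> ->.
  have s2 : (size (b%:P * 'X + c%:P)%R <= 2)%N.
    rewrite mul_polyC (leq_trans (size_polyD _ _)) // geq_max.
    by rewrite (leq_trans (size_scale_leq _ _)) ?size_polyX // (leq_trans (size_polyC_leq1 _)).
  by rewrite Q3 => /(_ isT) h; move: (leq_trans h s2).
- by rewrite P5 P6 mul0r addr0 mulr1 expf_eq0 /= a0 orbT.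
Qed.

Lemma quadratic_twistable (r a b c d e : k) : r \notin AS k ->
  twistable (Poly [:: d * r + c; a * r + d + b; a + d; a] * Poly [:: r; 1; 1; 0])
    (Poly [:: r; 1; 1; 0]) e ->
  e \in AS k \/ b = 0 /\ e - a \in AS k.
Proof.
move=> rAS; set W := Poly [:: _; _; _; a]; set Q := Poly [:: r; _; _; _] => tw.
have [Qirr Q3] := quadratic_irreducible rAS.
have W4 : (size W <= 4)%N := size_Poly _.
have [|al [be [ga [de [t [De0 eQ eW]]]]]] :=
  simple_poles_necessary W4 _ (dvdp_sqr_irreducible Qirr) tw.
  by rewrite -/Q Q3.
have /Poly_eq0 cQ : Poly [:: r * de ^+ 3 + be * de ^+ 2 + be ^+ 2 * de - r * (al * de + be * ga);
    r * ga * de ^+ 2 + al * de ^+ 2 + be ^+ 2 * ga - (al * de + be * ga);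
    r * ga ^+ 2 * de + be * ga ^+ 2 + al ^+ 2 * de - (al * de + be * ga);
    r * ga ^+ 3 + al * ga ^+ 2 + al ^+ 2 * ga] = 0.
  rewrite Poly4E -[RHS](subrr_eq eQ) hsub3E Poly4E -!mul_polyC; ring2 two0P.
have /= c0 := cQ 0%N; have /= c1 := cQ 1%N; have /= c2 := cQ 2%N; have /= c3 := cQ 3%N.
(* Otherwise m(infinity) = al/ga would be a rational root of x^2 + x + r, against r not being in
   AS(k). *)
have ga0 : ga = 0.
  apply/eqP; apply: contraNT rAS => ga0; apply/ASP; exists (al / ga).
  apply: subr0_eq; apply: (mulfI (expf_neq0 3 ga0)); rewrite mulr0 -c3.
  have -> : ga ^+ 3 * (r - (al / ga + (al / ga) ^+ 2)) =
    r * ga ^+ 3 - al * ga ^+ 2 - al ^+ 2 * ga by field.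
  ring2 two0.
move: De0 c0 c1 c2 eW; rewrite {}ga0 mulr0 addr0 mulf_eq0 negb_or => /andP[al0 de0].
rewrite expr0n !mulr0 !mul0r !addr0 !add0r => c0 c1 c2.
have al1 : al = 1.
  by apply: (mulfI (mulf_neq0 al0 de0)); apply: subr0_eq; rewrite -[RHS]c2; ring.
have de1 : de = 1.
  by apply: (mulfI (mulf_neq0 al0 de0)); apply: subr0_eq; rewrite -[RHS]c1; ring.
have : be + be ^+ 2 = 0 by rewrite -[RHS]c0 al1 de1; ring.
(* Two maps remain, x and x + 1. The second fixes the denominator and adds b to the numerator b x +
   c, so b = 0, and it adds a to a x. *)
rewrite al1 de1 => /(sqrD_eq0 two0)[]->; rewrite hsub3E => eW; [left|right].
  have /Poly_eq0/(_ 2%N) /= h : Poly [:: r * (e + (t + t ^+ 2)); e + (t + t ^+ 2);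
       e + (t + t ^+ 2); 0] = 0.
    rewrite Poly4E -[RHS](subrr_eq eW) /W /Q !Poly4E -!mul_polyC; ring2 two0P.
  by apply/ASP; exists t; apply: subr0_eq; rewrite -[RHS]h; ring2 two0.
have /Poly_eq0 h : Poly [:: a * r + b + r * (e + (t + t ^+ 2)); a + (e + (t + t ^+ 2));
     a + (e + (t + t ^+ 2)); 0] = 0.
  rewrite Poly4E -[RHS](subrr_eq eW) /W /Q !Poly4E -!mul_polyC; ring2 two0P.
have /= h0 := h 0%N; have /= h1 := h 1%N; split.
  by transitivity (a * r + b + r * (e + (t + t ^+ 2)) - r * (a + (e + (t + t ^+ 2))));
    [ring|rewrite h0 h1 mulr0 subrr].
by apply/ASP; exists t; apply: subr0_eq; rewrite -[RHS]h1; ring2 two0.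
Qed.

Lemma quadratic_twistable_a (r a c d : k) :
  twistable (Poly [:: d * r + c; a * r + d + 0; a + d; a] * Poly [:: r; 1; 1; 0])
    (Poly [:: r; 1; 1; 0]) a.
Proof.
apply: (@unimodular_twistable _ _ _ 1 1 0 1); rewrite ?size_Poly //; first ring.
  by rewrite hsub3E Poly4E; ring2 two0P.
by rewrite hsub3E !Poly4E -mul_polyC; ring2 two0P.
Qed.

Lemma E_horner (a c x : k) :
  (E_ a c).[x] = a ^+ 4 * x ^+ 16 + c ^+ 4 * x ^+ 8 + c ^+ 2 * x ^+ 2 + a * x.
Proof. by rewrite /E_ !(hornerD, hornerZ, hornerX, hornerXn). Qed.

Lemma type5_smooth (a b c d : k) : a != 0 ->
  smooth_model (Poly [:: d; 0; 0; c; b; a; 0]) (Poly [:: 1; 0; 0; 0]).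
Proof.
move=> a0; have Q1 : Poly [:: 1; 0; 0; 0] = 1 :> {poly k} by rewrite Poly4E; ring.
apply: (smooth_modelI two0); rewrite ?size_Poly ?Q1 ?oner_neq0 ?size_poly1 //.
  exact: coprime1p.
by rewrite !coef_Poly !coef1 /= mul0r addr0 expf_eq0 /= a0 orbT.
Qed.

Lemma type13_smooth (a b c d : k) : a != 0 -> c != 0 ->
  smooth_model (Poly [:: 0; c; d; b; 0; a; 0]) (Poly [:: 0; 1; 0; 0]).
Proof.
move=> a0 c0; have QX : Poly [:: 0; 1; 0; 0] = 'X - 0%:P :> {poly k}.
  by rewrite Poly4E; ring.
apply: (smooth_modelI two0); rewrite ?size_Poly ?QX ?polyXsubC_eq0 ?size_XsubC //.
  rewrite coprimep_sym coprimep_XsubC rootE /discr derivXsubC.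
  rewrite !(horner_exp, hornerD, hornerM) !horner_coef0 coef_deriv !coef_Poly /=.
  by rewrite mul0r addr0 mulr1n expf_eq0.
by rewrite subr0 !coef_Poly !coefX /= mul0r addr0 expf_eq0 /= a0 orbT.
Qed.

(** Q = 1 is a triple root at infinity, so m(x) = la x + nu. In u(m(x)) = u + e + r^2 + r the
    coefficients of x and x^2 determine r1 and r2; substituted into that of x^4, they produce the
    polynomial E. The constant term gives e modulo AS. *)
Lemma type5_twistable (a b c d e : k) : a != 0 ->
  twistable (Poly [:: d; 0; 0; c; b; a; 0]) (Poly [:: 1; 0; 0; 0]) e ->
  exists2 g, Gamma a b c g & e - (a * g.2 ^+ 5 + b * g.2 ^+ 4 + c * g.2 ^+ 3) \in AS k.
Proof.
move=> a0 [al [be [ga [la [r [De0 r4 eQ eP]]]]]].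
have [r0 [r1 [r2 [r3 rE]]]] := poly4P r4.
have /Poly_eq0 cQ : Poly [:: la ^+ 3 - (al * la + be * ga); ga * la ^+ 2; ga ^+ 2 * la; ga ^+ 3] = 0.
  rewrite Poly4E -[RHS](subrr_eq eQ) hsub3E Poly4E -!mul_polyC; ring2 two0P.
have /= c0 := cQ 0%N; have /= c3 := cQ 3%N.
have ga0 : ga = 0 by move/eqP: c3; rewrite expf_eq0 => /eqP.
move: De0 c0 eP; rewrite {}ga0 mulr0 addr0 mulf_eq0 negb_or => /andP[al0 la0] c0.
have alE : al = la ^+ 2.
  by apply: (mulIf la0); apply/esym; apply: subr0_eq; rewrite -[RHS]c0; ring.
pose nu := be / la; have beE : be = la * nu by rewrite mulrC mulfVK.
rewrite alE beE rE hsub6E => eP.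
have /Poly_eq0 h : Poly [::
    la ^+ 6 * (a * nu ^+ 5 + b * nu ^+ 4 + c * nu ^+ 3 + e + r0 ^+ 2 + r0);
    la ^+ 6 * (a * la * nu ^+ 4 + c * la * nu ^+ 2 + r1);
    la ^+ 6 * (c * la ^+ 2 * nu + r1 ^+ 2 + r2);
    la ^+ 6 * (c * la ^+ 3 + c + r3);
    la ^+ 6 * (a * la ^+ 4 * nu + b * la ^+ 4 + b + r2 ^+ 2);
    la ^+ 6 * (a * la ^+ 5 + a);
    la ^+ 6 * r3 ^+ 2] = 0.
  rewrite Poly7E -[RHS](subrr_eq eP) !Poly4E !Poly7E -!mul_polyC; ring2 two0P.
have cancel (s : k) : la ^+ 6 * s = 0 -> s = 0.
  by move/eqP; rewrite mulf_eq0 expf_eq0 (negPf la0) /= => /eqP.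
have /= h0 := cancel _ (h 0%N); have /= h1 := cancel _ (h 1%N).
have /= h2 := cancel _ (h 2%N); have /= h3 := cancel _ (h 3%N).
have /= h4 := cancel _ (h 4%N); have /= h5 := cancel _ (h 5%N).
have r30 : r3 = 0 by have /eqP := cancel _ (h 6%N); rewrite expf_eq0 => /eqP.
have la5 : la ^+ 5 = 1.
  by apply: (mulfI a0); apply: subr0_eq; rewrite -[RHS]h5; ring2 two0.
have r1E : r1 = a * la * nu ^+ 4 + c * la * nu ^+ 2.
  by apply: subr0_eq; rewrite -[RHS]h1; ring2 two0.
have r2E : r2 = c * la ^+ 2 * nu + r1 ^+ 2.
  by apply: subr0_eq; rewrite -[RHS]h2; ring2 two0.
exists (la, nu); last first.
  by apply/ASP; exists r0; apply: subr0_eq; rewrite -[RHS]h0 /=; ring2 two0.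
rewrite /Gamma /=; split=> //; rewrite E_horner; case: eqVneq => [c00|cn0] /=.
  split=> //; apply: subr0_eq.
  (* The factor la completes la^4 to la^5 = 1 and leaves b la as the only trace of la. *)
  have h4' : la * (a * la ^+ 4 * nu + b * la ^+ 4 + b + r2 ^+ 2) = 0 by rewrite h4 mulr0.
  rewrite -[RHS]h4' r2E r1E c00.
  transitivity (a ^+ 4 * nu ^+ 16 + a * nu + b + b * la).
    by ring2 two0.
  transitivity (a ^+ 4 * nu ^+ 16 * la ^+ 5 + a * nu * la ^+ 5 + b * la ^+ 5 + b * la).
    by rewrite la5; ring.
  by ring2 two0.
(* The coefficient of x^3 is c la^3 + c; with la^5 = 1 this forces la = 1. *)
have la3 : la ^+ 3 = 1.
  by apply: (mulfI cn0); apply: subr0_eq; rewrite -[RHS]h3 r30; ring2 two0.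
have la1 : la = 1.
  have la6 : la ^+ 6 = 1 by rewrite (exprM la 3 2) la3 expr1n.
  by rewrite -[RHS]la6 exprSr la5 mul1r.
split=> //; rewrite -[RHS]h4 r2E r1E la1; ring2 two0.
Qed.

Lemma type5_twistable_Gamma (a b c d : k) g : Gamma a b c g ->
  twistable (Poly [:: d; 0; 0; c; b; a; 0]) (Poly [:: 1; 0; 0; 0])
    (a * g.2 ^+ 5 + b * g.2 ^+ 4 + c * g.2 ^+ 3).
Proof.
case: g => la nu [la0]; rewrite E_horner [(la, nu).2]/= => H.
pose r1 := a * la * nu ^+ 4 + c * la * nu ^+ 2.
pose r2 := c * la ^+ 2 * nu + r1 ^+ 2.
have [la5 la3 h4] : [/\ la ^+ 5 = 1, c * la ^+ 3 = c
    & a * la ^+ 4 * nu + b * la ^+ 4 + b + r2 ^+ 2 = 0].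
  move: H; case: eqVneq => [c0 /=|cn0 /=] [la_eq e].
    split=> //; first by rewrite c0 mul0r.
    apply: (mulfI la0); rewrite mulr0 /r2 /r1 c0.
    transitivity ((a ^+ 4 * nu ^+ 16 + a * nu + b) * la ^+ 5 + b * la); first ring2 two0.
    rewrite la_eq mulr1; move: e; rewrite c0 => e.
    transitivity (a ^+ 4 * nu ^+ 16 + 0 ^+ 4 * nu ^+ 8 + 0 ^+ 2 * nu ^+ 2 + a * nu - b * (1 + la)).
      by ring2 two0.
    by rewrite e subrr.
  rewrite la_eq !expr1n mulr1; split=> //; rewrite -[RHS]e /r2 /r1 la_eq; ring2 two0.
(* Among the matrices of x -> la x + nu this one has determinant la^3, which is also the factor by
   which it scales the form Q = 1. *)
exists (la ^+ 2), (la * nu), 0, la, (Poly [:: 0; r1; r2; 0]).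
have la30 : la ^+ 3 != 0 by rewrite expf_neq0.
rewrite mulr0 addr0 -exprSr; split; [exact: la30|exact: size_Poly| |].
  by rewrite hsub3E Poly4E -mul_polyC; ring2 two0P.
have h1 : a * la * nu ^+ 4 + c * la * nu ^+ 2 + r1 = 0 by rewrite /r1; ring2 two0.
have h2 : c * la ^+ 2 * nu + r1 ^+ 2 + r2 = 0 by rewrite /r2; ring2 two0.
move: (r1) (r2) h1 h2 h4 => s1 s2 h1 h2 h4; rewrite hsub6E.
have e1 : a%:P * la%:P * nu%:P ^+ 4 + c%:P * la%:P * nu%:P ^+ 2 + s1%:P = 0.
  by rewrite -[RHS](rmorph0 polyC) -h1; ring.
have e2 : c%:P * la%:P ^+ 2 * nu%:P + s1%:P ^+ 2 + s2%:P = 0.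
  by rewrite -[RHS](rmorph0 polyC) -h2; ring.
have e3 : c%:P * la%:P ^+ 3 = c%:P by rewrite -rmorphXn -rmorphM la3.
have e5 : la%:P ^+ 5 = 1 :> {poly k} by rewrite -rmorphXn la5.
have e4 : a%:P * la%:P ^+ 4 * nu%:P + b%:P * la%:P ^+ 4 + b%:P + s2%:P ^+ 2 = 0.
  by rewrite -[RHS](rmorph0 polyC) -h4; ring.
apply: subr0_eq.
transitivity (la%:P ^+ 6 * ((c%:P * la%:P ^+ 3 - c%:P) * 'X^3
  + a%:P * (la%:P ^+ 5 - 1) * 'X^5
  + (a%:P * la%:P ^+ 4 * nu%:P + b%:P * la%:P ^+ 4 + b%:P + s2%:P ^+ 2) * 'X^4
  + (c%:P * la%:P ^+ 2 * nu%:P + s1%:P ^+ 2 + s2%:P) * 'X^2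
  + (a%:P * la%:P * nu%:P ^+ 4 + c%:P * la%:P * nu%:P ^+ 2 + s1%:P) * 'X)).
  by rewrite Poly7E !Poly4E -!mul_polyC; ring2 two0P.
by rewrite e1 e2 e3 e4 e5 !subrr !mulr0 !mul0r !addr0 mulr0.
Qed.

End MoreTypes.

(** * The models written as P/Q^2 *)

Section RightHandSides.
Variables (k F : fieldType) (tofrac : {rmorphism {poly k} -> F}).
Hypothesis tofrac_neq0 : forall p, p != 0 -> tofrac p != 0.
Local Notation x := (tofrac 'X).
Local Notation c_ t := (tofrac t%:P).

Lemma twist_rhs P Q e : Q != 0 ->
  tofrac P / tofrac Q ^+ 2 + c_ e = tofrac (P + e *: Q ^+ 2) / tofrac Q ^+ 2.
Proof.
move=> /tofrac_neq0 Q0; rewrite -mul_polyC !(rmorphXn, rmorphD, rmorphM) /=.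
by field.
Qed.

Lemma split_rhs a b c d : c_ a * x + c_ b / x + c_ c / (x + 1) + c_ d =
  tofrac (Poly [:: b; d + b + c; a + d; a] * Poly [:: 0; 1; 1; 0]) /
  tofrac (Poly [:: 0; 1; 1; 0]) ^+ 2.
Proof.
have x0 : x != 0 by rewrite tofrac_neq0 ?polyX_eq0.
have x1 : x + 1 != 0.
  by rewrite -(rmorph1 tofrac) -rmorphD tofrac_neq0 // -size_poly_eq0 -polyC1 size_XaddC.
have QE : tofrac (Poly [:: 0; 1; 1; 0]) = x * (x + 1) by rewrite Poly4E; ring.
have WE : tofrac (Poly [:: b; d + b + c; a + d; a]) =
    (c_ a * x + c_ d) * (x * (x + 1)) + c_ b * (x + 1) + c_ c * x.
  by rewrite Poly4E; ring.
by rewrite rmorphM QE WE; field; rewrite x0 x1.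
Qed.

Lemma quadratic_rhs r a b c d : Poly [:: r; 1; 1; 0] != 0 ->
  c_ a * x + (c_ b * x + c_ c) / (x ^+ 2 + x + c_ r) + c_ d =
  tofrac (Poly [:: d * r + c; a * r + d + b; a + d; a] * Poly [:: r; 1; 1; 0]) /
  tofrac (Poly [:: r; 1; 1; 0]) ^+ 2.
Proof.
move=> /tofrac_neq0 Q0.
have QE : tofrac (Poly [:: r; 1; 1; 0]) = x ^+ 2 + x + c_ r by rewrite Poly4E; ring.
have WE : tofrac (Poly [:: d * r + c; a * r + d + b; a + d; a]) =
    (c_ a * x + c_ d) * (x ^+ 2 + x + c_ r) + (c_ b * x + c_ c).
  by rewrite Poly4E; ring.
by rewrite QE in Q0; rewrite rmorphM QE WE; field.
Qed.

Lemma cubic_rhs Q a b c d : Q != 0 ->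
  (c_ a * x ^+ 2 + c_ b * x + c_ c) / tofrac Q + c_ d =
  tofrac ((Poly [:: c; b; a; 0] + d *: Q) * Q) / tofrac Q ^+ 2.
Proof.
move=> /tofrac_neq0 Q0.
have LE : tofrac (Poly [:: c; b; a; 0]) = c_ a * x ^+ 2 + c_ b * x + c_ c.
  by rewrite Poly4E; ring.
by rewrite -mul_polyC !(rmorphD, rmorphM) /= LE; field.
Qed.

Lemma type13_rhs a b c d : c_ a * x ^+ 3 + c_ b * x + c_ c / x + c_ d =
  tofrac (Poly [:: 0; c; d; b; 0; a; 0]) / tofrac (Poly [:: 0; 1; 0; 0]) ^+ 2.
Proof.
have x0 : x != 0 by rewrite tofrac_neq0 ?polyX_eq0.
have QE : tofrac (Poly [:: 0; 1; 0; 0]) = x by rewrite Poly4E; ring.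
have PE : tofrac (Poly [:: 0; c; d; b; 0; a; 0]) =
    c_ c * x + c_ d * x ^+ 2 + c_ b * x ^+ 3 + c_ a * x ^+ 5 by rewrite Poly7E; ring.
by rewrite QE PE; field.
Qed.

Lemma type5_rhs a b c d : c_ a * x ^+ 5 + c_ b * x ^+ 4 + c_ c * x ^+ 3 + c_ d =
  tofrac (Poly [:: d; 0; 0; c; b; a; 0]) / tofrac (Poly [:: 1; 0; 0; 0]) ^+ 2.
Proof.
have QE : tofrac (Poly [:: 1; 0; 0; 0]) = 1 by rewrite Poly4E; ring.
by rewrite QE expr1n divr1 Poly7E; ring.
Qed.

End RightHandSides.

(** * The group k/AS(k) and its subgroups of order two *)

Section TwistGroup.
Variables (k : fieldType) (k2 : 2%N \in [pchar k]).
Let two0 : 2 = 0 :> k := pcharf0 k2.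

Lemma twist_class_eq e f : twist_class k2 e = twist_class k2 f <-> e - f \in AS k.
Proof.
have -> : (e - f \in AS k) = (e - f \in AS_subgroup k2) by [].
rewrite Quotient.idealrBE; split=> [h|/eqP //]; exact/eqP.
Qed.

Lemma twist_class0 : twist_class k2 0 = 0.
Proof. exact: raddf0. Qed.

Lemma twist_classD e f : twist_class k2 (e + f) = twist_class k2 e + twist_class k2 f.
Proof. exact: raddfD. Qed.

Lemma twist_class_eq0 e : twist_class k2 e = 0 <-> e \in AS k.
Proof. by rewrite -twist_class0 twist_class_eq subr0. Qed.

Lemma AS_addr e f : e \in AS k -> f \in AS k -> e + f \in AS k.
Proof.
by move=> /twist_class_eq0 e0 /twist_class_eq0 f0; apply/twist_class_eq0;
  rewrite twist_classD e0 f0 addr0.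
Qed.

Lemma twist_group_addrr (h : twist_group k2) : h + h = 0.
Proof.
have -> : h = twist_class k2 (repr h) by rewrite /twist_class reprK.
by rewrite -twist_classD -mulr2n -mulr_natl two0 mul0r twist_class0.
Qed.

Lemma isotropyP P Q : smooth_model P Q ->
  isotropy_group k2 (ratfrac k P / ratfrac k Q ^+ 2) =
  [set h | exists2 e, twist_class k2 e = h & twistable P Q e].
Proof.
move=> sm; have Q0 : Q != 0 by case: sm.
have tw e : curve_isom (twist (ratfrac k P / ratfrac k Q ^+ 2) e)
    (ratfrac k P / ratfrac k Q ^+ 2) <-> twistable P Q e.
  have -> : twist (ratfrac k P / ratfrac k Q ^+ 2) e =
      ratfrac k (P + e *: Q ^+ 2) / ratfrac k Q ^+ 2.
    exact: (twist_rhs (@ratfrac_neq0 k) P e Q0).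
  apply: (curve_isom_criterion two0) => //.
  exact: (smooth_model_twist (@ratfrac_neq0 k) two0 e sm).
by apply/seteqP; split=> h [e eh /tw he]; exists e.
Qed.

End TwistGroup.

Section CyclicTwo.
Variables (V : zmodType) (h : V).
Hypotheses (h0 : h <> 0) (hh : h + h = 0).

Lemma subgroup_gen_order2 : [set 0; h] = subgroup_gen h.
Proof.
apply/seteqP; split=> x.
  by case=> ->; [exists 0; rewrite ?mulr0z|exists 1; rewrite ?mulr1z].
move=> [n _ <-]; have h2 m : h *+ m = 0 \/ h *+ m = h.
  elim: m => [|m [] IH]; first by left.
    by right; rewrite mulrS IH addr0.
  by left; rewrite mulrS IH.
have hN : - h = h by apply/eqP; rewrite eq_sym -addr_eq0 hh.
case: n => m; rewrite ?NegzE ?mulrNz -?pmulrn; first by case: (h2 m) => ->; [left|right].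
by case: (h2 m.+1) => ->; [left; rewrite oppr0|right; rewrite hN].
Qed.

Lemma isog_C2_order2 : isog_C2 [set 0; h].
Proof.
pose f (i : 'Z_2) : V := h *+ i.
have fD : zmod_morphism f.
  have hN : - h = h by apply/eqP; rewrite eq_sym -addr_eq0 hh.
  move=> [[|[|//]] ?] [[|[|//]] ?]; rewrite /f /= ?mulr1n ?mulr0n;
  by rewrite ?subr0 ?sub0r ?hN ?hh ?subrr ?mulr1n ?mulr0n.
pose fa : {additive 'Z_2 -> V} :=
  HB.pack f (GRing.isZmodMorphism.Build _ _ f fD).
exists fa; split.
  move=> [[|[|//]] ?] [[|[|//]] ?]; rewrite /= /f /= ?mulr1n ?mulr0n => e;
  try exact: val_inj; by case: h0.
apply/seteqP; split=> x.
  by move=> [[[|[|//]] ?] _ <-]; rewrite /= /f /= ?mulr1n ?mulr0n; [left|right].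
by case=> ->; [exists 0|exists 1].
Qed.

End CyclicTwo.

(** * Isotropy groups of the models *)

Section Isotropy.
Variables (k : fieldType) (k2 : 2%N \in [pchar k]).
Let two0 : 2 = 0 :> k := pcharf0 k2.

Lemma isotropy_trivial P Q : smooth_model P Q ->
  (forall e, twistable P Q e -> e \in AS k) ->
  isotropy_group k2 (ratfrac k P / ratfrac k Q ^+ 2) = [set 0].
Proof.
move=> sm tw; rewrite (isotropyP k2 sm); apply/seteqP; split=> [h [e <- /tw eAS]|h ->].
  exact/twist_class_eq0.
by exists 0; [exact: twist_class0|exact: twistable0].
Qed.

Lemma isotropy_order2 P Q f : smooth_model P Q -> twistable P Q f -> f \notin AS k ->
  (forall e, twistable P Q e -> e \in AS k \/ e - f \in AS k) ->
  isog_C2 (isotropy_group k2 (ratfrac k P / ratfrac k Q ^+ 2)) /\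
  isotropy_group k2 (ratfrac k P / ratfrac k Q ^+ 2) = subgroup_gen (twist_class k2 f).
Proof.
move=> sm twf fAS tw.
have -> : isotropy_group k2 (ratfrac k P / ratfrac k Q ^+ 2) =
    [set 0; twist_class k2 f].
  rewrite (isotropyP k2 sm); apply/seteqP; split=> h.
    move=> [e <- /tw[eAS|efAS]]; [left|right]; first exact/twist_class_eq0.
    exact/twist_class_eq.
  case=> ->; last by exists f.
  by exists 0; [exact: twist_class0|exact: twistable0].
have f0 : twist_class k2 f <> 0 by move/twist_class_eq0; apply/negP.
split; first by apply: isog_C2_order2 => //; apply: twist_group_addrr.
by apply: subgroup_gen_order2; apply: twist_group_addrr.
Qed.

Lemma isotropy_type5 (a b c d : k) : a != 0 ->
  isotropy_group k2 (model_rhs (Type5 a b c d)) = delta k2 a b c @` Gamma a b c.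
Proof.
move=> a0; have sm := type5_smooth two0 b c d a0.
have -> : model_rhs (Type5 a b c d) = ratfrac k (Poly [:: d; 0; 0; c; b; a; 0]) /
    ratfrac k (Poly [:: 1; 0; 0; 0]) ^+ 2 := type5_rhs (ratfrac k) a b c d.
rewrite (isotropyP k2 sm); apply/seteqP; split=> h.
  move=> [e <- /(type5_twistable two0 a0)[g gG eg]]; exists g => //.
  by apply/esym/twist_class_eq.
by move=> [g gG <-]; exists (a * g.2 ^+ 5 + b * g.2 ^+ 4 + c * g.2 ^+ 3) => //;
  apply: type5_twistable_Gamma.
Qed.

Lemma isotropy_type13 (a b c d : k) : a != 0 -> c != 0 ->
  isotropy_group k2 (model_rhs (Type13 a b c d)) = [set 0].
Proof.
move=> a0 c0; have sm := type13_smooth two0 b d a0 c0.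
have -> : model_rhs (Type13 a b c d) = ratfrac k (Poly [:: 0; c; d; b; 0; a; 0]) /
    ratfrac k (Poly [:: 0; 1; 0; 0]) ^+ 2 := type13_rhs (@ratfrac_neq0 k) a b c d.
by apply: (isotropy_trivial sm) => e; apply: type13_twistable.
Qed.

Lemma isotropy_cubic_form (Q : {poly k}) (a b c d : k) : irreducible_poly Q ->
  size Q = 4 -> Q^`() != 0 -> (a, b, c) != (0, 0, 0) ->
  isotropy_group k2 (ratfrac k ((Poly [:: c; b; a; 0] + d *: Q) * Q) /
    ratfrac k Q ^+ 2) = [set 0].
Proof.
move=> Qirr Q4 dQ abc0.
have L3 : (size (Poly [:: c; b; a; 0])%R <= 3)%N.
  by apply/leq_sizeP => -[|[|[|[|j]]]] // _; rewrite coef_Poly //= nth_nil.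
have L0 : Poly [:: c; b; a; 0 : k] != 0.
  apply: contraNneq abc0 => e; have h := Poly_eq0 e.
  by have /= -> := h 0%N; have /= -> := h 1%N; have /= -> := h 2%N.
apply: isotropy_trivial; first exact: cubic_smooth.
by move=> e; apply: cubic_twistable.
Qed.

Lemma isotropy_cubic (s a b c d : k) :
  irreducible_poly ('X^3 + s *: 'X + s%:P) -> (a, b, c) != (0, 0, 0) ->
  isotropy_group k2 (model_rhs (Cubic111 s a b c d)) = [set 0].
Proof.
have -> : 'X^3 + s *: 'X + s%:P = Poly [:: s; s; 0; 1].
  by rewrite Poly4E -mul_polyC; ring.
move=> Qirr abc0; have Q0 := irredp_neq0 Qirr.
have Q4 : size (Poly [:: s; s; 0; 1 : k]) = 4.
  by rewrite (@PolyK _ 0) //= oner_neq0.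
have -> : model_rhs (Cubic111 s a b c d) =
    ratfrac k ((Poly [:: c; b; a; 0] + d *: Poly [:: s; s; 0; 1]) * Poly [:: s; s; 0; 1]) /
    ratfrac k (Poly [:: s; s; 0; 1]) ^+ 2.
  rewrite -(cubic_rhs (@ratfrac_neq0 k) a b c d Q0).
  have -> : ratfrac k (Poly [:: s; s; 0; 1]) = ratfrac k 'X ^+ 3 + ratfrac k s%:P * ratfrac k 'X + ratfrac k s%:P.
    by rewrite Poly4E; ring.
  exact: erefl.
apply: isotropy_cubic_form => //.
rewrite (deriv_Poly4 two0); apply/eqP => /polyP/(_ 2%N).
by rewrite coefD coefC coefCM coefXn ?coef0 /= mulr1 add0r => /eqP; rewrite oner_eq0.
Qed.

Lemma isotropy_pure_cubic (s a b c d : k) :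
  irreducible_poly ('X^3 + s%:P) -> (a, b, c) != (0, 0, 0) ->
  isotropy_group k2 (model_rhs (PureCubic111 s a b c d)) = [set 0].
Proof.
have -> : 'X^3 + s%:P = Poly [:: s; 0; 0; 1] by rewrite Poly4E; ring.
move=> Qirr abc0; have Q0 := irredp_neq0 Qirr.
have Q4 : size (Poly [:: s; 0; 0; 1 : k]) = 4.
  by rewrite (@PolyK _ 0) //= oner_neq0.
have -> : model_rhs (PureCubic111 s a b c d) =
    ratfrac k ((Poly [:: c; b; a; 0] + d *: Poly [:: s; 0; 0; 1]) * Poly [:: s; 0; 0; 1]) /
    ratfrac k (Poly [:: s; 0; 0; 1]) ^+ 2.
  rewrite -(cubic_rhs (@ratfrac_neq0 k) a b c d Q0).
  have -> : ratfrac k (Poly [:: s; 0; 0; 1]) = ratfrac k 'X ^+ 3 + ratfrac k s%:P.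
    by rewrite Poly4E; ring.
  exact: erefl.
apply: isotropy_cubic_form => //.
rewrite (deriv_Poly4 two0); apply/eqP => /polyP/(_ 2%N).
by rewrite coefD coefC coefCM coefXn ?coef0 /= mulr1 add0r => /eqP; rewrite oner_eq0.
Qed.

Section Split.
Variables (a b c d : k).
Hypotheses (a0 : a != 0) (b0 : b != 0) (c0 : c != 0).
Let sm := split_smooth two0 d a0 b0 c0.
Let rhsE : model_rhs (Split111 a b c d) =
  ratfrac k (Poly [:: b; d + b + c; a + d; a] * Poly [:: 0; 1; 1; 0]) /
  ratfrac k (Poly [:: 0; 1; 1; 0]) ^+ 2 := split_rhs (@ratfrac_neq0 k) a b c d.

Lemma isotropy_split f : third_coefficient a b c f -> f \notin AS k ->
  isog_C2 (isotropy_group k2 (model_rhs (Split111 a b c d))) /\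
  isotropy_group k2 (model_rhs (Split111 a b c d)) = subgroup_gen (twist_class k2 f).
Proof.
move=> fE fAS; rewrite rhsE; apply: (isotropy_order2 sm) => //.
  exact: third_twistable.
move=> e /(split_twistable two0)[g [->|gE] eg]; first by left; rewrite subr0 in eg.
(* Two different alternatives of [third_coefficient] can hold together only if a = b = c, so the
   third coefficient is unique. *)
right; suff -> : f = g by [].
case: fE gE => [[? ->]|[? ->]|[? ->]] [[? ->]|[? ->]|[? ->]]; congruence.
Qed.

Lemma isotropy_split_trivial :
  (forall f, third_coefficient a b c f -> f \in AS k) ->
  isotropy_group k2 (model_rhs (Split111 a b c d)) = [set 0].
Proof.
move=> fAS; rewrite rhsE; apply: (isotropy_trivial sm) => e.
move=> /(split_twistable two0)[f [->|/fAS fA]]; first by rewrite subr0.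
by move=> efA; rewrite -[e](subrK f); apply: AS_addr.
Qed.

End Split.

Section Quadratic.
Variables (r a b c d : k).
Hypotheses (rAS : r \notin AS k) (a0 : a != 0) (bc0 : (b, c) != (0, 0)).
Let sm := quadratic_smooth two0 d rAS a0 bc0.
Let rhsE : model_rhs (Quadratic111 r a b c d) =
  ratfrac k (Poly [:: d * r + c; a * r + d + b; a + d; a] * Poly [:: r; 1; 1; 0]) /
  ratfrac k (Poly [:: r; 1; 1; 0]) ^+ 2.
Proof.
exact: (quadratic_rhs (@ratfrac_neq0 k) a b c d
  (irredp_neq0 (quadratic_irreducible two0 rAS).1)).
Qed.

Lemma isotropy_quadratic : b = 0 -> a \notin AS k ->
  isog_C2 (isotropy_group k2 (model_rhs (Quadratic111 r a b c d))) /\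
  isotropy_group k2 (model_rhs (Quadratic111 r a b c d)) = subgroup_gen (twist_class k2 a).
Proof.
move=> b0 aAS; rewrite rhsE; apply: (isotropy_order2 sm) => //.
  by rewrite b0; apply: quadratic_twistable_a.
by move=> e /(quadratic_twistable two0 rAS)[|[]]; [left|right].
Qed.

Lemma isotropy_quadratic_trivial : (b = 0 -> a \in AS k) ->
  isotropy_group k2 (model_rhs (Quadratic111 r a b c d)) = [set 0].
Proof.
move=> aAS; rewrite rhsE; apply: (isotropy_trivial sm) => e.
move=> /(quadratic_twistable two0 rAS)[//|[/aAS aA eaA]].
by rewrite -[e](subrK a); apply: AS_addr.
Qed.

End Quadratic.

End Isotropy.

Unset Implicit Arguments.

Theorem proposition25 (k : fieldType) (k_perfect : perfect k)
    (k2 : 2%N \in [pchar k]) (M : rational_model k) (M_adm : admissible M) :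
  let H_C := isotropy_group k2 (model_rhs M) in
  [/\ forall a b c d : k, M = Type5 a b c d ->
        H_C = delta k2 a b c @` Gamma a b c,
      forall e : k, split_case M e ->
        isog_C2 H_C /\ H_C = subgroup_gen (twist_class k2 e),
      forall a : k, quadratic_case M a ->
        isog_C2 H_C /\ H_C = subgroup_gen (twist_class k2 a)
    & ~ supersingular_model M -> ~ (exists e, split_case M e) ->
        ~ (exists a, quadratic_case M a) -> H_C = [set 0]].
Proof.
move=> H_C; split.
- by move=> a b c d ME; move: M_adm; rewrite /H_C ME; apply: isotropy_type5.
- move=> e [a [b [c [d [ME eE eAS]]]]]; move: M_adm; rewrite /H_C ME.
  by move=> [a0 b0 c0]; apply: isotropy_split.
- move=> a [r [b [c [d [ME b0 aAS]]]]]; move: M_adm; rewrite /H_C ME b0.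
  by move=> [rAS a0 bc0]; apply: isotropy_quadratic.
move=> n5 nsplit nquad; rewrite /H_C; case: M M_adm n5 nsplit nquad {H_C}.
- move=> a b c d [a0 b0 c0] _ nsplit _.
  apply: isotropy_split_trivial => // f fE; apply: contrapT => fAS.
  by apply: nsplit; exists f, a, b, c, d; split=> //; apply/negP.
- move=> r a b c d [rAS a0 bc0] _ _ nquad.
  apply: isotropy_quadratic_trivial => // b0; apply: contrapT => aAS.
  by apply: nquad; exists a, r, b, c, d; split=> //; apply/negP.
- by move=> s a b c d [Qirr abc0] _ _ _; apply: isotropy_cubic.
- by move=> s a b c d [Qirr abc0] _ _ _; apply: isotropy_pure_cubic.
- by move=> a b c d [a0 c0] _ _ _; apply: isotropy_type13.
- by move=> a b c d _ n5; case: n5; exists a, b, c, d.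
Qed.
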